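(* Let $\lambda>8$, let $H_{\mathrm F}$ be the Fibonacci Hamiltonian on $\ell^2(\mathbb{Z})$ with coupling constant $\lambda$, and let $\alpha_u^+(\lambda)$ be its upper transport exponent. Let $\eta=\frac{\sqrt5+1}{2}$, $\zeta(\lambda)=\frac{\lambda-4+\sqrt{(\lambda-4)^2-12}}{2}$, $r(\lambda)=2\lambda+22$, and $$\alpha(\lambda)=\frac{3\log r(\lambda)-\log(\zeta(\lambda)\eta)}{\log(r(\lambda)\eta)}\cdot\frac{2\log\eta}{\log\zeta(\lambda)} .$$ Then $\alpha_u^+(\lambda)\le\alpha(\lambda)$.
   Context: The Fibonacci Hamiltonian is $(H_{\mathrm F}\psi)_n=\psi_{n+1}+\psi_{n-1}+V_n\psi_n$ on $\ell^2(\mathbb{Z})$ with $V_n=\lambda\,\chi_{[1-\theta,1)}(n\theta \bmod 1)$, $\theta=\frac{\sqrt5-1}{2}$, where $\chi_I$ is the characteristic function of $I$. For $q\ge0$, $T>0$, $$P(q,T)=\sum_{n\in\mathbb{Z},\,|n|>q}\frac2T\int_0^\infty\bigl|\langle\delta_n,e^{-itH_{\mathrm F}}\delta_1\rangle\bigr|^2e^{-2t/T}dt,$$ and $$\alpha_u^+(\lambda)=\sup\Bigl\{\alpha>0:\limsup_{T\to\infty}\frac{\log P(T^\alpha,T)}{\log T}>-\infty\Bigr\}.$$ *)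

(* Defs.v *)
From mathcomp Require Import all_boot all_order all_algebra.
From mathcomp Require Import all_classical all_reals all_analysis.
From mathcomp Require Import complex ring lra zify.

Set Implicit Arguments.
Unset Strict Implicit.
Unset Printing Implicit Defensive.

Import Order.TTheory GRing.Theory Num.Theory numFieldNormedType.Exports.

Local Open Scope classical_set_scope.
Local Open Scope ring_scope.

Notation normc := ComplexField.Normc.normc.

Section HilbertSpace.
Variable R : realType.
Implicit Types (psi phi : int -> R[i]) (A : (int -> R[i]) -> (int -> R[i])).

Definition l2normsq psi : \bar R :=
  \esum_(n in [set: int]) (normc (psi n) ^+ 2)%:E.

Definition ell2 : set (int -> R[i]) := [set psi | (l2normsq psi < +oo)%E].

Definition delta (n : int) : int -> R[i] := fun m => (m == n)%:R.

(* The series over Z defining the inner product converges absolutely on ell2,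
   so it may be summed along the windows [-N, N].  [R[i]^o] is [R[i]] with the
   topology of its modulus. *)
Definition inner phi psi : R[i] :=
  lim ((fun N : nat => \sum_(0 <= k < N.*2.+1)
          (phi (k%:Z - N%:Z))^*%C * psi (k%:Z - N%:Z) : R[i]^o) @ \oo).

Definition exp_partial A (z : R[i]) (N : nat) psi : int -> R[i] :=
  fun n => \sum_(0 <= k < N) z ^+ k / k`!%:R * iter k A psi n.

(* [phi] is [exp(z A) psi]: the sum, in the norm of ell2, of the exponential
   series of [z A] applied to [psi]. *)
Definition is_exp_op A (z : R[i]) psi phi : Prop :=
  ell2 phi /\
  l2normsq (fun n => exp_partial A z N psi n - phi n) @[N --> \oo] --> 0%E.

Definition exp_op A (z : R[i]) psi : int -> R[i] :=
  xget 0 [set phi | is_exp_op A z psi phi].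

End HilbertSpace.

Section FibonacciHamiltonian.
Variable R : realType.
Implicit Types (lambda q T t : R).

Definition theta : R := (Num.sqrt 5 - 1) / 2.

Definition frac (x : R) : R := x - (Num.floor x)%:~R.

Definition fib_potential lambda (n : int) : R :=
  lambda * \1_(`[1 - theta, 1[%classic) (frac (n%:~R * theta)).

Definition fib_hamiltonian lambda (psi : int -> R[i]) : int -> R[i] :=
  fun n => psi (n + 1) + psi (n - 1) + (fib_potential lambda n)%:C%C * psi n.

Definition evolution lambda t : (int -> R[i]) -> (int -> R[i]) :=
  exp_op (fib_hamiltonian lambda) (- 'i%C * t%:C%C).

Definition averaged_prob lambda T (n : int) : \bar R :=
  ((2 / T)%:E * \int[lebesgue_measure]_(t in `[0%R, +oo[)
     (normc (inner (delta R n) (evolution lambda t (delta R 1))) ^+ 2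
        * expR (- (2 * t) / T))%:E)%E.

Definition outside_prob lambda q T : \bar R :=
  \esum_(n in [set n : int | q < `|n|%:~R]) averaged_prob lambda T n.

(* [lne] is the extended logarithm, with [lne 0 = -oo]. *)
Definition alpha_u_plus lambda : \bar R :=
  ereal_sup [set a%:E | a in [set a : R | 0 < a /\
    (-oo < limf_esup
             (fun T : R => lne (outside_prob lambda (T `^ a) T) * ((ln T)^-1)%:E)
             (pinfty_nbhs R))%E]].

Definition eta : R := (Num.sqrt 5 + 1) / 2.

Definition zeta lambda : R :=
  (lambda - 4 + Num.sqrt ((lambda - 4) ^+ 2 - 12)) / 2.

Definition rr lambda : R := 2 * lambda + 22.

Definition alpha_bound lambda : R :=
  (3 * ln (rr lambda) - ln (zeta lambda * eta)) / ln (rr lambda * eta)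
  * (2 * ln eta / ln (zeta lambda)).

End FibonacciHamiltonian.

(* [exp_op] and [inner] do not return default values where they are used:
   [evolutionP], [is_exp_op_unique], [delta_ell2] and [inner_delta]. *)
Section WellPosedness.
Variable R : realType.
Implicit Types (psi phi : int -> R[i]).

Lemma sqr_normcE (z : R[i]) : normc z ^+ 2 = complex.Re z ^+ 2 + complex.Im z ^+ 2.
Proof. by case: z => a b /=; rewrite sqr_sqrtr// addr_ge0// sqr_ge0. Qed.

Lemma normc_ge0 (z : R[i]) : 0 <= normc z.
Proof. by case: z => a b /=; rewrite sqrtr_ge0. Qed.

Lemma l2normsq_ge0 psi : (0 <= l2normsq psi)%E.
Proof. by apply: esum_ge0 => n _; rewrite lee_fin sqr_ge0. Qed.

Lemma l2normsq_leP psi (c : R) : (l2normsq psi <= c%:E)%E <->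
  forall s : seq int, uniq s -> \sum_(n <- s) normc (psi n) ^+ 2 <= c.
Proof.
split=> [h s us|h].
- rewrite -lee_fin -sumEFin; apply: le_trans h.
  rewrite fsbig_seq//; apply: ereal_sup_ubound.
  by exists [set` s] => //; split => //; exact: finite_seq.
- apply: ge_ereal_sup => _ [F [finF _] <-].
  rewrite fsbig_finite// sumEFin lee_fin; apply: h.
  exact: finmap.fset_uniq.
Qed.

Lemma inner_delta psi (n : int) : inner (delta R n) psi = psi n.
Proof.
rewrite /inner; apply: (@norm_cvg_lim R[i] (R[i]^o)).
apply: (@cvg_near_cst _ (R[i]^o)).
near=> N.
have hN : (absz n <= N)%N by near: N; exact: nbhs_infty_ge.
have [k hk kE] : exists2 k, (k < N.*2.+1)%N & k%:Z - N%:Z = n.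
  exists (absz (n + N%:Z)); first by lia.
  by lia.
rewrite (bigD1_seq k) ?iota_uniq ?mem_index_iota//= kE /delta eqxx conjc1 mul1r.
rewrite big1 ?addr0// => j jk.
case: eqP => [jE|_]; last by rewrite conjc0 mul0r.
by move: jk; rewrite (_ : j = k) ?eqxx//; lia.
Unshelve. all: by end_near. Qed.

Lemma cvg_sum_seq (I : Type) (r : seq I) (f : I -> nat -> R) (l : I -> R) :
  (forall i, f i M @[M --> \oo] --> l i) ->
  (\sum_(i <- r) f i M) @[M --> \oo] --> \sum_(i <- r) l i.
Proof.
move=> h; elim: r => [|i r IH].
  by under eq_fun do rewrite big_nil; rewrite big_nil; exact: cvg_cst.
by under eq_fun do rewrite big_cons; rewrite big_cons; exact: cvgD.
Qed.

Lemma cauchy_sum (I : Type) (r : seq I) (w b : I -> R) :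
  (forall i, 0 <= w i) -> (forall i, 0 <= b i) ->
  (\sum_(i <- r) w i * b i) ^+ 2 <=
  (\sum_(i <- r) w i) * (\sum_(i <- r) w i * b i ^+ 2).
Proof.
move=> w0 b0; elim: r => [|i r IH]; first by rewrite !big_nil expr0n/= mul0r.
rewrite !big_cons.
set s := \sum_(j <- r) w j * b j in IH *.
set W := \sum_(j <- r) w j in IH *.
set Q := \sum_(j <- r) _ in IH *.
have hW : 0 <= W by exact: sumr_ge0.
have hQ : 0 <= Q by apply: sumr_ge0 => j _; rewrite mulr_ge0// sqr_ge0.
have hs : 0 <= s by apply: sumr_ge0 => j _; rewrite mulr_ge0.
suff h : 2 * (s * b i) <= W * b i ^+ 2 + Q.
  have := w0 i; have : 0 <= w i * (W * b i ^+ 2 + Q - 2 * (s * b i)).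
    by rewrite mulr_ge0// subr_ge0.
  by nra.
move: hW; rewrite le_eqVlt => /orP[/eqP W0|W0].
  have -> : s = 0.
    apply/eqP; rewrite -sqrf_eq0 eq_le sqr_ge0 andbT.
    by move: IH; rewrite -W0 mul0r.
  by rewrite -W0; lra.
rewrite -(ler_pM2l W0); have := sqr_ge0 (W * b i - s); nra.
Qed.

Section Exp.
Variables (A : (int -> R[i]) -> (int -> R[i])) (B : R) (z : R[i]).
Hypothesis B1 : 1 <= B.
Hypothesis hA : forall psi, (l2normsq (A psi) <= B%:E * l2normsq psi)%E.

Lemma iter_bound psi (S : R) (k : nat) : (l2normsq psi <= S%:E)%E ->
  (l2normsq (iter k A psi) <= (B ^+ k * S)%:E)%E.
Proof.
move=> hS; elim: k => [|k IH]; first by rewrite mul1r.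
rewrite iterS; apply: le_trans (hA _) _.
rewrite exprS -mulrA EFinM; apply: lee_wpmul2l => //.
by rewrite lee_fin (le_trans _ B1).
Qed.

Lemma normc_sum (I : Type) (r : seq I) (f : I -> R[i]) :
  normc (\sum_(i <- r) f i) <= \sum_(i <- r) normc (f i).
Proof.
elim: r => [|i r IH]; first by rewrite !big_nil ComplexField.Normc.normc0.
rewrite !big_cons; apply: le_trans (le_normcD _ _) _.
by rewrite lerD2l.
Qed.

Lemma normcX (x : R[i]) k : normc (x ^+ k) = normc x ^+ k.
Proof.
elim: k => [|k IH]; first by rewrite ComplexField.Normc.normc1.
by rewrite !exprS ComplexField.Normc.normcM IH.
Qed.

Lemma normc_nat (k : nat) : normc (k%:R : R[i]) = k%:R.
Proof.
have -> : (k%:R : R[i]) = (k%:R : R)%:C%C by rewrite rmorph_nat.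
by rewrite /= expr0n addr0 sqrtr_sqr ger0_norm.
Qed.

Let u psi (k : nat) (n : int) : R[i] := z ^+ k / k`!%:R * iter k A psi n.

Let w (k : nat) : R := exp_coeff (normc z * B) k.

Let B0 : 0 < B. Proof. exact: lt_le_trans B1. Qed.

Let w_ge0 k : 0 <= w k.
Proof. by rewrite exp_coeff_ge0// mulr_ge0 ?normc_ge0// ltW. Qed.

Lemma normc_u psi k n : normc (u psi k n) = w k * (normc (iter k A psi n) / B ^+ k).
Proof.
rewrite /u !ComplexField.Normc.normcM ComplexField.Normc.normcV normcX normc_nat.
rewrite /w /exp_coeff /= exprMn.
have Bk : B ^+ k != 0 by rewrite expf_neq0// gt_eqF.
have fk : k`!%:R != 0 :> R by rewrite pnatr_eq0 -lt0n fact_gt0.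
by field; rewrite Bk fk.
Qed.

Lemma block_bound psi (S : R) (N M : nat) (s : seq int) :
  (l2normsq psi <= S%:E)%E -> uniq s ->
  \sum_(n <- s) normc (\sum_(N <= k < M) u psi k n) ^+ 2 <=
  (\sum_(N <= k < M) w k) ^+ 2 * S.
Proof.
move=> hS us.
set W := \sum_(N <= k < M) w k.
pose b k n := normc (iter k A psi n) / B ^+ k.
have b0 k n : 0 <= b k n.
  by rewrite /b divr_ge0 ?normc_ge0// exprn_ge0// ltW.
have W0 : 0 <= W by exact: sumr_ge0.
apply: (@le_trans _ _ (\sum_(n <- s) W * \sum_(N <= k < M) w k * b k n ^+ 2)).
  apply: ler_sum => n _.
  apply: le_trans (cauchy_sum _ w_ge0 (b0^~ n)).
  rewrite ler_sqr ?nnegrE ?normc_ge0//; last first.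
    by apply: sumr_ge0 => k _; rewrite mulr_ge0.
  apply: le_trans (normc_sum _ _) _.
  by apply: ler_sum => k _; rewrite normc_u.
rewrite -mulr_sumr expr2 -mulrA ler_wpM2l//.
rewrite exchange_big/= /W mulr_suml; apply: ler_sum => k _.
rewrite -mulr_sumr ler_wpM2l//.
have /l2normsq_leP/(_ s us) hk := iter_bound k hS.
have S0 : 0 <= S by rewrite -lee_fin (le_trans (l2normsq_ge0 psi)).
have Bk1 : 1 <= B ^+ k by rewrite exprn_ege1.
have Bk0 : 0 < B ^+ k by exact: lt_le_trans Bk1.
rewrite (eq_bigr (fun n => (B ^+ k) ^- 2 * normc (iter k A psi n) ^+ 2)); last first.
  by move=> n _; rewrite /b expr_div_n mulrC.
rewrite -mulr_sumr mulrC ler_pdivrMr ?exprn_gt0//.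
apply: le_trans hk _; rewrite expr2 mulrC ler_wpM2l//.
by rewrite ler_peMr// ltW.
Qed.

Lemma is_cvg_w : cvgn (series w).
Proof. exact: is_cvg_series_exp_coeff. Qed.

Lemma w_le N M : (N <= M)%N ->
  \sum_(N <= k < M) w k <= limn (series w) - series w N.
Proof.
move=> NM; have -> : \sum_(N <= k < M) w k = series w M - series w N.
  by rewrite /series/= (@big_cat_nat _ _ _ N 0 M)//= [X in _ = X - _]addrC addrK.
rewrite lerD2r; apply: nondecreasing_cvgn_le; last exact: is_cvg_w.
by apply/nondecreasing_seqP => n; rewrite /series/= big_nat_recr//= lerDl.
Qed.

Lemma is_exp_op_ex psi : ell2 psi -> exists phi, is_exp_op A z psi phi.
Proof.
move=> psi2.
have [S hS] : exists S : R, (l2normsq psi <= S%:E)%E.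
  exists (fine (l2normsq psi)); rewrite fineK// ge0_fin_numE//.
  exact: l2normsq_ge0.
have S0 : 0 <= S by rewrite -lee_fin (le_trans (l2normsq_ge0 psi)).
have ub k n : normc (u psi k n) <= w k * (S + 1).
  rewrite normc_u ler_wpM2l//.
  have Bk1 : 1 <= B ^+ k by rewrite exprn_ege1.
  have Bk0 : 0 < B ^+ k by exact: lt_le_trans Bk1.
  rewrite ler_pdivrMr//.
  have /l2normsq_leP/(_ [:: n] isT) := iter_bound k hS.
  rewrite big_seq1 => h.
  rewrite -ler_sqr ?nnegrE ?normc_ge0//; last by rewrite mulr_ge0 ?ltW// ltr_wpDl.
  apply: le_trans h _; rewrite exprMn [leRHS]mulrC.
  apply: ler_pM => //; first exact: ltW.
    by rewrite expr2 ler_peMr// ltW.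
  by nra.
have cK : cvgn (series (fun k => w k * (S + 1))).
  have -> : series (fun k => w k * (S + 1)) = (fun N => series w N * (S + 1)).
    by apply/funext => N; rewrite /series/= mulr_suml.
  by apply: is_cvgM; [exact: is_cvg_w|exact: is_cvg_cst].
have cRe n : cvgn (series (fun k => complex.Re (u psi k n))).
  apply: normed_cvg; apply: (series_le_cvg _ _ _ cK) => [k|k|k] /=.
  - exact: normr_ge0.
  - by rewrite mulr_ge0// addr_ge0.
  - apply: le_trans (ub k n).
    rewrite -ler_sqr ?nnegrE ?normc_ge0// sqr_normcE real_normK ?num_real//.
    by rewrite lerDl sqr_ge0.
have cIm n : cvgn (series (fun k => complex.Im (u psi k n))).
  apply: normed_cvg; apply: (series_le_cvg _ _ _ cK) => [k|k|k] /=.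
  - exact: normr_ge0.
  - by rewrite mulr_ge0// addr_ge0.
  - apply: le_trans (ub k n).
    rewrite -ler_sqr ?nnegrE ?normc_ge0// sqr_normcE real_normK ?num_real//.
    by rewrite lerDr sqr_ge0.
pose phi n : R[i] := (limn (series (fun k => complex.Re (u psi k n))) +i*
                      limn (series (fun k => complex.Im (u psi k n))))%C.
pose tl N := limn (series w) - series w N.
have tail N : (l2normsq (fun n => (exp_partial A z N psi n - phi n)%R) <=
               (tl N ^+ 2 * S)%:E)%E.
  apply/l2normsq_leP => s us.
  pose f M := \sum_(n <- s) normc (exp_partial A z N psi n - exp_partial A z M psi n) ^+ 2.
  have cf : f M @[M --> \oo] -->
      \sum_(n <- s) normc (exp_partial A z N psi n - phi n) ^+ 2.
    apply: cvg_sum_seq => n.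
    rewrite sqr_normcE.
    have ReE (x y : R[i]) : complex.Re (x - y) = complex.Re x - complex.Re y by case: x; case: y.
    have ImE (x y : R[i]) : complex.Im (x - y) = complex.Im x - complex.Im y by case: x; case: y.
    under eq_fun do rewrite sqr_normcE ReE ImE.
    rewrite ReE ImE.
    have pRe M : complex.Re (exp_partial A z M psi n) = series (fun k => complex.Re (u psi k n)) M.
      by rewrite /exp_partial /series/= raddf_sum.
    have pIm M : complex.Im (exp_partial A z M psi n) = series (fun k => complex.Im (u psi k n)) M.
      by rewrite /exp_partial /series/= raddf_sum.
    apply: cvgD.
    - rewrite expr2; under eq_fun do rewrite expr2.
      have h : complex.Re (exp_partial A z N psi n) - complex.Re (exp_partial A z M psi n) @[M --> \oo]
         --> complex.Re (exp_partial A z N psi n) - complex.Re (phi n).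
        apply: cvgB; first exact: cvg_cst.
        by under eq_fun do rewrite pRe; exact: cRe.
      exact: cvgM.
    - rewrite expr2; under eq_fun do rewrite expr2.
      have h : complex.Im (exp_partial A z N psi n) - complex.Im (exp_partial A z M psi n) @[M --> \oo]
         --> complex.Im (exp_partial A z N psi n) - complex.Im (phi n).
        apply: cvgB; first exact: cvg_cst.
        by under eq_fun do rewrite pIm; exact: cIm.
      exact: cvgM.
  rewrite -(cvg_lim _ cf)//; apply: limr_le; first by apply/cvg_ex; eexists; exact: cf.
  near=> M.
  have NM : (N <= M)%N by near: M; exact: nbhs_infty_ge.
  apply: (@le_trans _ _ ((\sum_(N <= k < M) w k) ^+ 2 * S)).
    apply: le_trans (block_bound N M hS us).
    apply: ler_sum => n _.
    rewrite -normcN opprB /exp_partial.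
    by rewrite (@big_cat_nat _ _ _ N 0 M)//= [X in normc (X - _)]addrC addrK.
  rewrite ler_wpM2r// ler_sqr ?nnegrE ?w_le//.
    exact: sumr_ge0.
  by apply: le_trans (w_le NM); exact: sumr_ge0.
exists phi; split.
  apply: (@le_lt_trans _ _ (tl 0 ^+ 2 * S)%:E); last exact: ltry.
  apply: le_trans (tail 0); apply: le_esum => n _.
  by rewrite /exp_partial big_geq// sub0r normcN.
apply: (@squeeze_cvge _ _ _ _ (fun=> 0%E) _ (fun N => (tl N ^+ 2 * S)%:E)).
- by apply: nearW => N; rewrite l2normsq_ge0 tail.
- exact: cvg_cst.
- apply: cvg_EFin; first exact: nearW.
  have h : tl N @[N --> \oo] --> (0:R).
    rewrite -(subrr (limn (series w))); apply: cvgB; first exact: cvg_cst.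
    exact: is_cvg_w.
  have -> : 0 = 0 * 0 * S :> R by rewrite !mul0r.
  by apply: cvgM; [under eq_fun do rewrite expr2; exact: cvgM|exact: cvg_cst].
Unshelve. all: by end_near. Qed.

End Exp.

Lemma is_exp_op_unique A (z : R[i]) psi phi phi' :
  is_exp_op A z psi phi -> is_exp_op A z psi phi' -> phi = phi'.
Proof.
move=> [_ h] [_ h']; apply/funext => n.
have h2 : (2%:E * (l2normsq (fun n => (exp_partial A z N psi n - phi n)%R)
     + l2normsq (fun n => (exp_partial A z N psi n - phi' n)%R)))%E @[N --> \oo] --> 0%E.
  have -> : 0%E = (2%:E * (0 + 0))%E :> \bar R by rewrite adde0 mule0.
  by apply: cvgeZl => //; exact: cvgeD.
suff : ((normc (phi n - phi' n) ^+ 2)%:E <= 0 :> \bar R)%E.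
  rewrite lee_fin => h3; apply/eqP; rewrite -subr_eq0; apply/eqP.
  apply: ComplexField.Normc.eq0_normc; apply/eqP.
  by rewrite -sqrf_eq0 eq_le h3 sqr_ge0.
rewrite -(cvg_lim _ h2)//; apply: lime_ge; first by apply/cvg_ex; eexists; exact: h2.
apply: nearW => N.
apply: (@le_trans _ _ (2%:E * ((normc (exp_partial A z N psi n - phi n)%R ^+ 2)%:E +
  (normc (exp_partial A z N psi n - phi' n)%R ^+ 2)%:E))%E).
  rewrite -EFinD -EFinM lee_fin !sqr_normcE.
  case: (exp_partial _ _ _ _ _) (phi n) (phi' n) => a b [c d] [e f] /=.
  have := sqr_ge0 (2*a - c - e); have := sqr_ge0 (2*b - d - f).
  by nra.
apply: lee_wpmul2l => //; apply: leeD.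
- apply: (esum_ge (ex_intro2 _ _ [set n] _ _)); first by split=> //; exact: finite_set1.
  by rewrite fsbig_set1.
- apply: (esum_ge (ex_intro2 _ _ [set n] _ _)); first by split=> //; exact: finite_set1.
  by rewrite fsbig_set1.
Qed.

Lemma l2normsq_shift psi (a : int) : l2normsq (fun n => psi (n + a)) = l2normsq psi.
Proof.
rewrite /l2normsq [RHS](@reindex_esum _ _ _ setT setT (fun n => n + a))//.
split=> //; first by move=> x y _ _ /addIr.
by move=> y _; exists (y - a) => //=; rewrite subrK.
Qed.

Lemma fib_potential_le (lambda : R) n : `|fib_potential lambda n| <= `|lambda|.
Proof.
rewrite /fib_potential normrM indicE.
by case: (_ \in _); rewrite ?normr1 ?mulr1// normr0 mulr0.
Qed.

Lemma fib_hamiltonian_bounded (lambda : R) psi :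
  (l2normsq (fib_hamiltonian lambda psi) <=
   (6 + 3 * lambda ^+ 2)%:E * l2normsq psi)%E.
Proof.
have [fin|] := boolP (l2normsq psi \is a fin_num); last first.
  rewrite ge0_fin_numE ?l2normsq_ge0// -leNgt leye_eq => /eqP ->.
  rewrite gt0_muley ?leey// lte_fin.
  by have := sqr_ge0 lambda; lra.
have [S hS] : exists S : R, l2normsq psi = S%:E.
  by exists (fine (l2normsq psi)); rewrite fineK.
rewrite hS -EFinM; apply/l2normsq_leP => s us.
have h0 : (l2normsq psi <= S%:E)%E by rewrite hS.
have h1 : (l2normsq (fun n => psi (n + 1)%R) <= S%:E)%E by rewrite l2normsq_shift hS.
have h2 : (l2normsq (fun n => psi (n - 1)%R) <= S%:E)%E by rewrite l2normsq_shift hS.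
move/l2normsq_leP/(_ s us) : h0 => h0.
move/l2normsq_leP/(_ s us) : h1 => h1.
move/l2normsq_leP/(_ s us) : h2 => h2.
apply: (@le_trans _ _ (\sum_(n <- s) (3 * normc (psi (n + 1)) ^+ 2 +
  3 * normc (psi (n - 1)) ^+ 2 + 3 * lambda ^+ 2 * normc (psi n) ^+ 2))); last first.
  rewrite !big_split/= -!mulr_sumr.
  by have := ler_wpM2l (sqr_ge0 lambda) h0; lra.
apply: ler_sum => n _.
have hV : fib_potential lambda n ^+ 2 <= lambda ^+ 2.
  rewrite -[leLHS]real_normK ?num_real// -[leRHS]real_normK ?num_real//.
  by rewrite ler_sqr ?nnegrE// fib_potential_le.
rewrite /fib_hamiltonian !sqr_normcE.
move: (fib_potential lambda n) hV => V hV.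
case: (psi (n+1)) (psi (n-1)) (psi n) => a b [c d] [e f] /=.
rewrite !mul0r subr0 addr0.
have h x y v : (x + y + v) ^+ 2 <= 3 * x ^+ 2 + 3 * y ^+ 2 + 3 * v ^+ 2 :> R.
  by have := sqr_ge0 (x - y); have := sqr_ge0 (x - v); have := sqr_ge0 (y - v); nra.
have := h a c (V * e); have := h b d (V * f).
have h' x : (V * x) ^+ 2 <= lambda ^+ 2 * x ^+ 2 by rewrite exprMn ler_wpM2r// sqr_ge0.
have := h' e; have := h' f; lra.
Qed.

Lemma delta_ell2 (n : int) : ell2 (delta R n).
Proof.
rewrite /ell2/=; apply: (@le_lt_trans _ _ 1%:E); last exact: ltry.
apply/l2normsq_leP => s us.
have [ns|ns] := boolP (n \in s).
  rewrite (bigD1_seq n)//= big1 ?addr0.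
    by rewrite /delta eqxx ComplexField.Normc.normc1 expr1n.
  by move=> i /negPf; rewrite /delta => ->; rewrite ComplexField.Normc.normc0 expr0n.
rewrite big_seq big1// => i is_.
rewrite /delta; case: eqP => [E|_]; first by rewrite -E is_ in ns.
by rewrite ComplexField.Normc.normc0 expr0n.
Qed.

Lemma evolutionP (lambda t : R) psi : ell2 psi ->
  is_exp_op (fib_hamiltonian lambda) (- 'i%C * t%:C%C) psi
    (evolution lambda t psi).
Proof.
move=> psi2; rewrite /evolution /exp_op.
have B1 : 1 <= 6 + 3 * lambda ^+ 2 by have := sqr_ge0 lambda; lra.
have [phi hphi] := is_exp_op_ex (- 'i%C * t%:C%C) B1
  (fib_hamiltonian_bounded lambda) psi2.
exact: (xgetI (P := [set phi | is_exp_op _ _ _ phi]) 0 hphi).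
Qed.

End WellPosedness.

(* Main.v *)
(** A bound on the Green function of the Fibonacci Hamiltonian at height about
    1/T above the real axis is turned into a bound on the evolution up to time
    about T by expanding exp(-itH) delta_1 along the Chebyshev wave
    u_(m+1) = b H u_m - u_(m-1), u_0 = delta_1.  Its generating function in w,
    |w| < 1, solves (z - H) uh = delta_1 / (b w) with z = (w + 1/w) / b, so that
    Cauchy's estimate bounds u_m by uh on a circle; the expansion coefficients
    are those of the free evolution on the half line, hence bounded.

    The potential starts with squares of Fibonacci blocks, on both sides of the
    origin.  By Cayley-Hamilton over such a square, uh is at the end of the
    first block at most of the order of the inverse of the trace of the block
    transfer matrix, and beyond that point Green's identity controls it.  The
    traces follow the trace map: as long as its orbit keeps returning to a
    neighbourhood of [-1, 1] the imaginary part grows by a factor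
    (lambda + 1) / 4 at each return, that is at least every second step.  Hence
    the orbit of a point with imaginary part about 1/T escapes, and then grows
    super-exponentially, after about 2 ln T / ln ((lambda + 1) / 4) steps, which
    corresponds to a distance T^a with a = 2 ln eta / ln ((lambda + 1) / 4).
    This a is at most alpha(lambda) when zeta(lambda) > eta^4, and otherwise
    alpha(lambda) >= 1 and ballistic propagation suffices. *)
Require Import Defs.
From mathcomp Require Import all_boot all_order all_algebra.
From mathcomp Require Import all_classical all_reals all_analysis.
From mathcomp Require Import complex.
From mathcomp Require Import ring lra zify.

Set Implicit Arguments.
Unset Strict Implicit.
Unset Printing Implicit Defensive.

Import Order.TTheory GRing.Theory Num.Theory numFieldNormedType.Exports.

Local Open Scope classical_set_scope.
Local Open Scope ring_scope.

(** Cauchy's estimate needs a bound uniform over a whole circle of points [w], so the trace map is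
    followed for arbitrary complex [z], near the spectrum or not. On the Fricke-Vogt surface two
    bounded half traces force the third to have size about [lambda / 2]. This is what stretches
    imaginary parts, by [lambda] minus a constant; [rate] is a weaker factor that the estimates
    still give at [lambda = 11.29]. The scale [b = 1 / (lambda + 4)] is about half of the natural
    [2 / ||H||]. It gives [b ||H|| < 1], which makes the conserved energy of the wave positive
    definite and the wave bounded. It also lets the ellipse traced by [z] meet the real axis only
    near [2 (lambda + 4)] and [- 2 (lambda + 4)], far from the spectrum; over the spectrum its
    height is at least [1 - |w|]. *)

Section Modulus.
Variable R : realType.
Implicit Types (x y z : R[i]) (a : R).

Lemma normcM x y : normc (x * y) = normc x * normc y.
Proof. exact: ComplexField.Normc.normcM. Qed.

Lemma normcD x y : normc (x + y) <= normc x + normc y.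
Proof. exact: le_normcD. Qed.

Lemma normcB x y : normc (x - y) <= normc x + normc y.
Proof. by rewrite -(normcN y) normcD. Qed.

Lemma normc_ge_sub x y : normc x - normc y <= normc (x + y).
Proof. by rewrite lerBlDr -{1}(addrK y x) (le_trans (normcB _ _)). Qed.

Lemma normc_real a : normc a%:C%C = `|a|.
Proof. by rewrite /= expr0n addr0 sqrtr_sqr. Qed.

Lemma sqr_lt_of_norm (a b : R) : `|a| < b -> a ^+ 2 < b ^+ 2.
Proof.
move=> h; rewrite -(real_normK (num_real a)) ltr_sqr ?nnegrE//.
exact: le_trans (normr_ge0 a) (ltW h).
Qed.

Lemma le_of_sqr (a b : R) : 0 <= b -> a ^+ 2 <= b ^+ 2 -> a <= b.
Proof.
move=> b0; apply: contraTT; rewrite -!ltNge => ab.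
by rewrite ltr_sqr ?nnegrE// (le_trans b0) ?ltW.
Qed.

Lemma normc_Re x : `|complex.Re x| <= normc x.
Proof.
rewrite -ler_sqr ?nnegrE ?normc_ge0// sqr_normcE real_normK ?num_real//.
by rewrite lerDl sqr_ge0.
Qed.

Lemma normc_Im x : `|complex.Im x| <= normc x.
Proof.
rewrite -ler_sqr ?nnegrE ?normc_ge0// sqr_normcE real_normK ?num_real//.
by rewrite lerDr sqr_ge0.
Qed.

Lemma normc_le_ReIm x : normc x <= `|complex.Re x| + `|complex.Im x|.
Proof.
rewrite -ler_sqr ?nnegrE ?normc_ge0 ?addr_ge0// sqr_normcE sqrrD.
rewrite !real_normK ?num_real// lerD2r lerDl mulrn_wge0// mulr_ge0//.
Qed.

Lemma normc_eq0 x : normc x = 0 -> x = 0.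
Proof. exact: ComplexField.Normc.eq0_normc. Qed.

Lemma ReD x y : complex.Re (x + y) = complex.Re x + complex.Re y.
Proof. by case: x; case: y. Qed.
Lemma ImD x y : complex.Im (x + y) = complex.Im x + complex.Im y.
Proof. by case: x; case: y. Qed.
Lemma ReN x : complex.Re (- x) = - complex.Re x.
Proof. by case: x. Qed.
Lemma ImN x : complex.Im (- x) = - complex.Im x.
Proof. by case: x. Qed.
Lemma ReM x y : complex.Re (x * y) =
  complex.Re x * complex.Re y - complex.Im x * complex.Im y.
Proof. by case: x; case: y. Qed.
Lemma ImM x y : complex.Im (x * y) =
  complex.Re x * complex.Im y + complex.Im x * complex.Re y.
Proof. by case: x; case: y. Qed.

Definition ReImE := (ReD, ImD, ReN, ImN, ReM, ImM).

End Modulus.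

(** * Stretching of imaginary parts on the Fricke-Vogt surface *)

Section TraceMap.
Variable R : realType.
Variable lambda : R.
Implicit Types (a b L x z : R[i]).

(* Half traces of modulus at most [trace_cst] count as bounded.  Any constant
   close enough to 1 would do; the estimates below are tuned to this one and to
   [lambda >= 11.29], which holds when [eta ^+ 4 < zeta lambda]. *)
Definition trace_cst : R := 101 / 100.
Local Notation c := trace_cst.
Definition rate : R := (lambda + 1) / 4.

(* The Fricke-Vogt invariant takes the value lambda^2 / 4 along the orbit. *)
Definition trace_surface a b L : Prop :=
  L * L - 2 * (a * b * L) + a * a + b * b = 1 + (lambda ^+ 2 / 4)%:C%C.

Lemma surface_large a b L : 1129 / 100 <= lambda -> normc a <= c -> normc b <= c ->
  trace_surface a b L ->
  lambda / 2 - 71 / 50 <= `|complex.Re L| /\ normc L <= `|complex.Re L| + 1 / 4.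
Proof.
move=> hl ha hb hs.
have cE : c = 101 / 100 by [].
have na := normc_ge0 a; have nb := normc_ge0 b.
(* Completing the square in [L] turns the surface equation into [D ^ 2 = lambda ^ 2 / 4 + m] with
   [m] bounded, so [D] lies near [lambda / 2] or [- lambda / 2]. *)
set D := L - a * b; set m := (1 - a * a) * (1 - b * b).
have hD : D * D = (lambda ^+ 2 / 4)%:C%C + m.
  have -> : (lambda ^+ 2 / 4)%:C%C = L * L - 2 * (a * b * L) + a * a + b * b - 1.
    by rewrite hs; ring.
  by rewrite /D /m; ring.
have hab : normc (a * b) <= 103 / 100.
  by rewrite normcM; move: ha hb; rewrite cE; nra.
have hm : normc m <= 413 / 100.
  rewrite /m normcM.
  have h1 : normc (1 - a * a) <= 203 / 100.
    apply: le_trans (normcB _ _) _; rewrite ComplexField.Normc.normc1 normcM.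
    by move: ha; rewrite cE; nra.
  have h2 : normc (1 - b * b) <= 203 / 100.
    apply: le_trans (normcB _ _) _; rewrite ComplexField.Normc.normc1 normcM.
    by move: hb; rewrite cE; nra.
  have := normc_ge0 (1 - a * a); have := normc_ge0 (1 - b * b); nra.
have hRe : complex.Re D ^+ 2 - complex.Im D ^+ 2 = lambda ^+ 2 / 4 + complex.Re m.
  by rewrite -[lambda ^+ 2 / 4]/(complex.Re (lambda ^+ 2 / 4)%:C%C) -ReD -hD ReM !expr2.
have hIm : 2 * (complex.Re D * complex.Im D) = complex.Im m.
  have -> : complex.Im m = complex.Im ((lambda ^+ 2 / 4)%:C%C + m).
    by rewrite ImD /= add0r.
  by rewrite -hD ImM; ring.
have mR := normc_Re m; have mI := normc_Im m.
have lR : L = D + a * b by rewrite /D subrK.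
have abR := normc_Re (a * b); have abI := normc_Im (a * b).
have hX : lambda / 2 - 38 / 100 <= `|complex.Re D|.
  rewrite leNgt; apply/negP => h.
  have : complex.Re D ^+ 2 < (lambda / 2 - 38 / 100) ^+ 2.
    by apply: sqr_lt_of_norm h.
  have : - complex.Re m <= 413 / 100 by have := ler_norm (- complex.Re m); rewrite normrN; lra.
  have := sqr_ge0 (complex.Im D); nra.
have hY : `|complex.Im D| <= 40 / 100.
  have : 2 * (`|complex.Re D| * `|complex.Im D|) <= 413 / 100.
    by rewrite -normrM -[2]ger0_norm// -normrM hIm (le_trans mI).
  have := normr_ge0 (complex.Im D); nra.
have ReL : complex.Re L = complex.Re D + complex.Re (a * b) by rewrite {1}lR ReD.
have ImL : complex.Im L = complex.Im D + complex.Im (a * b) by rewrite {1}lR ImD.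
have hR : lambda / 2 - 71 / 50 <= `|complex.Re L|.
  have := lerB_normD (complex.Re D) (complex.Re (a * b)); rewrite -ReL.
  lra.
split=> //.
have hI : `|complex.Im L| <= 143 / 100.
  by rewrite ImL; apply: le_trans (ler_normD _ _) _; lra.
apply: le_of_sqr; first by have := normr_ge0 (complex.Re L); lra.
rewrite sqr_normcE -[complex.Re L ^+ 2]real_normK ?num_real//.
rewrite -[complex.Im L ^+ 2]real_normK ?num_real//.
have := normr_ge0 (complex.Im L); nra.
Qed.

(* The imaginary part of the surface equation is linear in [Im L], [Im a] and
   [Im b], with bounded coefficients. *)
Lemma surface_im a b L : 1129 / 100 <= lambda -> normc a <= c -> normc b <= c ->
  trace_surface a b L ->
  `|complex.Im L| <= 7 / 4 * (`|complex.Im a| + `|complex.Im b|).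
Proof.
move=> hl ha hb hs.
have cE : c = 101 / 100 by [].
have [hR hL] := surface_large hl ha hb hs.
have na := normc_ge0 a; have nb := normc_ge0 b; have nL := normc_ge0 L.
(* The real part of [pE] is half the imaginary part of the surface equation, and its imaginary part
   holds identically. In this complex form all coefficients are estimated by moduli. *)
pose p := (complex.Im L)%:C%C * ((complex.Re L)%:C%C - conjc a * conjc b).
have pE : p = (complex.Im a)%:C%C * (b * L - (complex.Re a)%:C%C)
            + (complex.Im b)%:C%C * (conjc a * L - (complex.Re b)%:C%C).
  move: hs; rewrite /trace_surface /p.
  case: a b L {ha hb hR hL na nb nL p} => a1 a2 [b1 b2] [l1 l2].
  move/eqP; rewrite eq_complex !ReImE /= => /andP[_ /eqP hi].
  apply/eqP; rewrite eq_complex !ReImE /=; apply/andP; split; apply/eqP; lra.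
have nconj x : normc (conjc x) = normc x by case: x => u v /=; rewrite sqrrN.
have h1 : normc p >= `|complex.Im L| * (`|complex.Re L| - 103 / 100).
  rewrite /p normcM normc_real ler_wpM2l//.
  apply: le_trans (normc_ge_sub _ _); rewrite normcN normcM !nconj normc_real.
  by rewrite lerD2l lerN2; move: ha hb; rewrite cE; nra.
have hc u v : normc u <= c -> normc v <= c ->
    normc (u * L - (complex.Re v)%:C%C) <= 101 / 100 * (normc L + 1).
  move=> hu hv; apply: le_trans (normcB _ _) _; rewrite normcM normc_real.
  have := normc_Re v; have := normc_ge0 u; move: hu hv; rewrite cE; nra.
have h2 : normc p <= (`|complex.Im a| + `|complex.Im b|) * (101 / 100 * (normc L + 1)).
  rewrite pE; apply: le_trans (normcD _ _) _.
  rewrite !normcM !normc_real mulrDl; apply: lerD; apply: ler_wpM2l => //.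
    exact: hc.
  by apply: hc => //; rewrite nconj.
have hA := normr_ge0 (complex.Im a); have hB := normr_ge0 (complex.Im b).
have h3 : 101 / 100 * (normc L + 1) <= 7 / 4 * (`|complex.Re L| - 103 / 100) by lra.
have h4 : 0 < `|complex.Re L| - 103 / 100 by lra.
rewrite -(ler_pM2r h4); apply: le_trans h1 _; apply: le_trans h2 _.
rewrite [leRHS](_ : _ = (`|complex.Im a| + `|complex.Im b|) * (7 / 4 * (`|complex.Re L| - 103 / 100))); last by ring.
by rewrite ler_wpM2l// addr_ge0.
Qed.

(** The term [2 * Im a * Re L] dominates, with modulus at least [(lambda - 71 / 25) * |Im a|]. By
    [surface_im] and the ratio hypothesis on [Im b] the other terms are bounded multiples of
    [|Im a|]. *)
Lemma im_growth_return a b L : 1129 / 100 <= lambda -> normc a <= c -> normc b <= c ->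
  trace_surface a b L -> rate * `|complex.Im b| <= `|complex.Im a| ->
  rate * `|complex.Im a| <= `|complex.Im (2 * a * L - b)|.
Proof.
move=> hl ha hb hs hab.
have cE : c = 101 / 100 by [].
have [hR hL] := surface_large hl ha hb hs.
have hI := surface_im hl ha hb hs.
have hA := normr_ge0 (complex.Im a); have hB := normr_ge0 (complex.Im b).
(* For [lambda >= 1129 / 100] the factor [rate] is at least [307 / 100]. *)
have hB' : `|complex.Im b| <= 100 / 307 * `|complex.Im a|.
  by move: hab; rewrite /rate; nra.
have -> : complex.Im (2 * a * L - b) = 2 * (complex.Im a * complex.Re L)
   + (2 * (complex.Re a * complex.Im L) - complex.Im b).
  by rewrite !ReImE /=; ring.
apply: le_trans (lerB_normD _ _).
have h2 : `|2 * (complex.Re a * complex.Im L) - complex.Im b| <=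
    202 / 100 * `|complex.Im L| + `|complex.Im b|.
  apply: le_trans (ler_normB _ _) _; rewrite lerD2r !normrM (@ger0_norm _ 2)//.
  have := normc_Re a; have := normr_ge0 (complex.Im L); move: ha; rewrite cE; nra.
rewrite !normrM (@ger0_norm _ 2)//.
have h3 : (lambda / 2 - 71 / 50) * `|complex.Im a| <= `|complex.Im a| * `|complex.Re L|.
  by rewrite mulrC ler_wpM2l.
have h4 : rate * `|complex.Im a| <= (lambda - 81 / 10) * `|complex.Im a|.
  by rewrite ler_wpM2r// /rate; clear -lambda hl; lra.
apply: le_trans h4 _; clear -lambda h2 h3 hI hB' hA; nra.
Qed.

(** The orbit passes through the unbounded point [2 a L - b] and returns to [(4 a^2 - 1) L - 2 a b].
    As this is bounded while [L] is large, [4 a^2 - 1] is small, so [Re a] stays away from 0. The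
    main term [8 * Re a * Im a * Re L] is then at least [2 * |Im a * Re L|], as for a simple
    return. *)
Lemma im_growth_double_return a b L : 1129 / 100 <= lambda -> normc a <= c -> normc b <= c ->
  trace_surface a b L -> rate * `|complex.Im b| <= `|complex.Im a| ->
  normc (2 * a * (2 * a * L - b) - L) <= c ->
  rate * `|complex.Im a| <= `|complex.Im (2 * a * (2 * a * L - b) - L)|.
Proof.
move=> hl ha hb hs hab.
have cE : c = 101 / 100 by [].
have [hR hL] := surface_large hl ha hb hs.
have hI := surface_im hl ha hb hs.
have hA := normr_ge0 (complex.Im a); have hB := normr_ge0 (complex.Im b).
have hB' : `|complex.Im b| <= 100 / 307 * `|complex.Im a|.
  by move: hab; rewrite /rate; nra.
pose P := 4 * (a * a) - 1.
have -> : 2 * a * (2 * a * L - b) - L = P * L - 2 * (a * b) by rewrite /P; ring.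
move=> hc.
have na := normc_ge0 a; have nb := normc_ge0 b; have nL := normc_ge0 L.
have nP := normc_ge0 P.
have hPL : normc P * normc L <= 307 / 100.
  rewrite -normcM; have -> : P * L = (P * L - 2 * (a * b)) + 2 * (a * b) by ring.
  apply: le_trans (normcD _ _) _; rewrite !normcM normc_nat.
  by move: ha hb hc; rewrite cE; nra.
have hP : normc P <= 3 / 4.
  have := normc_Re L; nra.
have rP := normc_Re P.
have ReP : complex.Re P = 4 * (complex.Re a ^+ 2 - complex.Im a ^+ 2) - 1.
  by rewrite /P !ReImE /=; ring.
have ImP : complex.Im P = 8 * (complex.Re a * complex.Im a).
  by rewrite /P !ReImE /=; ring.
have hra : 1 / 4 <= `|complex.Re a|.
  rewrite leNgt; apply/negP => h.
  have : complex.Re a ^+ 2 < (1 / 4) ^+ 2.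
    by apply: sqr_lt_of_norm h.
  have := sqr_ge0 (complex.Im a); have : - complex.Re P <= 3 / 4.
    by have := ler_norm (- complex.Re P); rewrite normrN; lra.
  rewrite ReP; lra.
have -> : complex.Im (P * L - 2 * (a * b)) = 8 * (complex.Re a * (complex.Im a * complex.Re L))
   + (complex.Re P * complex.Im L
      - 2 * (complex.Re a * complex.Im b + complex.Im a * complex.Re b)).
  by rewrite ImD ImN !ImM ImP /=; ring.
apply: le_trans (lerB_normD _ _).
have h2 : `|complex.Re P * complex.Im L
      - 2 * (complex.Re a * complex.Im b + complex.Im a * complex.Re b)| <=
    3 / 4 * `|complex.Im L| + 202 / 100 * (`|complex.Im a| + `|complex.Im b|).
  apply: le_trans (ler_normB _ _) _; apply: lerD.
    by rewrite normrM ler_wpM2r//; apply: le_trans rP hP.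
  rewrite normrM (@ger0_norm _ 2)//.
  have h := ler_normD (complex.Re a * complex.Im b) (complex.Im a * complex.Re b).
  rewrite !normrM in h.
  have := normc_Re a; have := normc_Re b; move: ha hb; rewrite cE.
  clear -lambda hA hB h na nb; nra.
rewrite !normrM (@ger0_norm _ 8)//.
have h3 : (lambda / 2 - 71 / 50) * `|complex.Im a| <= `|complex.Im a| * `|complex.Re L|.
  by rewrite mulrC ler_wpM2l.
have h4 : 1 / 4 * (`|complex.Im a| * `|complex.Re L|) <= `|complex.Re a| * (`|complex.Im a| * `|complex.Re L|).
  by rewrite ler_wpM2r// mulr_ge0.
have h5 : rate * `|complex.Im a| <= (lambda - 76 / 10) * `|complex.Im a|.
  by rewrite ler_wpM2r// /rate; clear -lambda hl; lra.
apply: le_trans h5 _; clear -lambda h2 h3 h4 hI hB' hA; nra.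
Qed.

End TraceMap.

(** * Escape of the complex trace-map orbit *)

Fixpoint fibn (n : nat) : nat :=
  if n is m.+1 then (if m is p.+1 then fibn m + fibn p else 1)%N else 1%N.

Lemma fibnSS n : fibn n.+2 = (fibn n.+1 + fibn n)%N.
Proof. by []. Qed.

Lemma fibn_gt0 n : (0 < fibn n)%N.
Proof. by elim/ltn_ind: n => -[|[|n]] ih //=; rewrite addn_gt0 (ih n.+1). Qed.

Lemma fibn_leS n : (fibn n <= fibn n.+1)%N.
Proof. by case: n => // n; rewrite fibnSS leq_addr. Qed.

Lemma fibn_homo m n : (m <= n)%N -> (fibn m <= fibn n)%N.
Proof. exact: (homo_leq leqnn leq_trans fibn_leS). Qed.

Section HalfTraces.
Variable R : realType.
Variable lambda : R.
Implicit Types (z : R[i]).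
Local Notation c := (trace_cst R).
Local Notation rho := (rate lambda).

(* [htrace z n] is half the trace of the transfer matrix over a Fibonacci block,
   with the index shifted so that the orbit of the trace map starts at the
   points 1, z/2, (z - lambda)/2. *)
Fixpoint htrace z (n : nat) : R[i] :=
  match n with
  | 0 => 1
  | 1 => z / 2
  | 2 => (z - lambda%:C%C) / 2
  | ((m.+1 as m1).+1 as m2).+1 => 2 * htrace z m2 * htrace z m1 - htrace z m
  end.

Lemma htraceS z n :
  htrace z n.+3 = 2 * htrace z n.+2 * htrace z n.+1 - htrace z n.
Proof. by []. Qed.

Lemma htraceSC z n :
  htrace z n.+3 = 2 * htrace z n.+1 * htrace z n.+2 - htrace z n.
Proof. by rewrite htraceS mulrAC. Qed.

Lemma two_neq0 : (2 : R[i]) != 0.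
Proof. by rewrite pnatr_eq0. Qed.

Lemma htrace_surface z n :
  trace_surface lambda (htrace z n.+1) (htrace z n) (htrace z n.+2).
Proof.
rewrite /trace_surface; elim: n => [|n IH].
  have -> : (lambda ^+ 2 / 4)%:C%C = lambda%:C%C ^+ 2 / 4 :> R[i].
    by rewrite rmorphM fmorphV rmorphXn rmorph_nat.
  have -> : htrace z 0 = 1 by [].
  have -> : htrace z 1 = z / 2 by [].
  have -> : htrace z 2 = (z - lambda%:C%C) / 2 by [].
  have h2 := two_neq0; have h4 : (4 : R[i]) != 0 by rewrite pnatr_eq0.
  by field.
rewrite -IH htraceS; ring.
Qed.

Lemma htrace_surface_mid z n :
  trace_surface lambda (htrace z n.+2) (htrace z n) (htrace z n.+1).
Proof. by have := htrace_surface z n; rewrite /trace_surface => <-; ring. Qed.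

Definition escapes z j : Prop :=
  [/\ normc (htrace z j) <= c, c < normc (htrace z j.+1) &
      c < normc (htrace z j.+2)].

(* Either two consecutive half traces are bounded, or two bounded ones surround
   an unbounded one; [g] bounds the accumulated growth of the imaginary part. *)
Definition returning z (k : nat) (g : R) : Prop :=
  [/\ normc (htrace z k) <= c, g <= `|complex.Im (htrace z k)| &
  (exists2 m, k = m.+1 & normc (htrace z m) <= c /\
     rho * `|complex.Im (htrace z m)| <= `|complex.Im (htrace z k)|) \/
  (exists2 m, k = m.+2 & normc (htrace z m) <= c /\
     rho * `|complex.Im (htrace z m)| <= `|complex.Im (htrace z k)|)].

Lemma surface_unbounded (a b L : R[i]) : 1129 / 100 <= lambda -> normc a <= c ->
  normc b <= c -> trace_surface lambda a b L -> c < normc L.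
Proof.
move=> hl ha hb hs; have [h _] := surface_large hl ha hb hs.
by apply: lt_le_trans (normc_Re L); rewrite /trace_cst; lra.
Qed.

(** Three consecutive half traces are never all bounded. After two bounded ones the next is
    therefore unbounded and only the one after it can return; after a bounded, unbounded, bounded
    triple the next two are tested in turn. If no return occurs, the last bounded point is followed
    by two unbounded ones. *)
Lemma returning_step z k g : 1129 / 100 <= lambda -> returning z k g ->
  escapes z k \/ exists2 k', (k' <= k.+2)%N & returning z k' (rho * g).
Proof.
move=> hl [hk gk hm].
have rate_ge0 : 0 <= rho by rewrite /rate; lra.
have gk' : rho * g <= rho * `|complex.Im (htrace z k)| by rewrite ler_wpM2l.
case: hm => -[m E [hm1 hm2]]; subst k.
- have hs := htrace_surface z m.
  have h1 := surface_unbounded hl hk hm1 hs.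
  case: (leP (normc (htrace z m.+3)) c) => h3; last by left.
  right; exists m.+3 => //.
  have G := im_growth_return hl hk hm1 hs hm2; rewrite -htraceSC in G.
  split=> //; first exact: le_trans gk' G.
  by right; exists m.+1.
- have hs := htrace_surface_mid z m.
  have G := im_growth_return hl hk hm1 hs hm2; rewrite -htraceS in G.
  case: (leP (normc (htrace z m.+3)) c) => h3.
    right; exists m.+3; first by rewrite leqnSn.
    split=> //; first exact: le_trans gk' G.
    by left; exists m.+2.
  case: (leP (normc (htrace z m.+4)) c) => h4; last by left.
  right; exists m.+4 => //.
  have E4 : htrace z m.+4 = 2 * htrace z m.+2 * (2 * htrace z m.+2 * htrace z m.+1 - htrace z m) - htrace z m.+1.
    by rewrite htraceS htraceS; ring.
  have h4' := h4; rewrite E4 in h4'.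
  have G2 := im_growth_double_return hl hk hm1 hs hm2 h4'; rewrite -E4 in G2.
  split=> //; first exact: le_trans gk' G2.
  by right; exists m.+2.
Qed.

Lemma normc_half (z : R[i]) : normc (z / 2) = normc z / 2.
Proof. by rewrite normcM ComplexField.Normc.normcV normc_nat. Qed.

Lemma escapes_or_returning z n : 1129 / 100 <= lambda ->
  (exists2 j, (j <= n.*2)%N & escapes z j) \/
  (exists2 k, (k <= n.*2.+2)%N & returning z k (rho ^+ n * (`|complex.Im z| / 2))).
Proof.
move=> hl; elim: n => [|n IH].
  have h0 : normc (htrace z 0) <= c.
    by rewrite ComplexField.Normc.normc1 /trace_cst; lra.
  (* The orbit starts at the real point 1, which makes the ratio condition of [returning] trivial
     for the first bounded point after it. *)
  have Im1 : complex.Im (htrace z 0) = 0 by [].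
  have half x : complex.Im (x / 2) = complex.Im x / 2 :> R.
    have -> : x / 2 = x * (2^-1)%:C%C by rewrite fmorphV rmorph_nat.
    by rewrite ImM /= mulr0 add0r.
  have n2 (x : R) : `|x / 2| = `|x| / 2 by rewrite normrM (@ger0_norm _ 2^-1).
  rewrite expr0 mul1r.
  case: (leP (normc (htrace z 1)) c) => h1.
    right; exists 1%N => //; split => //; first by rewrite /= half n2.
    by left; exists 0%N => //; rewrite Im1 normr0 mulr0.
  case: (leP (normc (htrace z 2)) c) => h2; last by left; exists 0%N.
  right; exists 2%N => //; split => //.
    by rewrite [htrace z 2]/= half n2 ImD ImN /= subr0.
  by right; exists 0%N => //; rewrite Im1 normr0 mulr0.
case: IH => [[j hj ej]|[k hk rk]].
  by left; exists j => //; rewrite (leq_trans hj)// leq_double.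
case: (returning_step hl rk) => [ek|[k' hk' rk']].
  by left; exists k => //; rewrite doubleS.
right; exists k'; last by rewrite exprS -mulrA.
by rewrite doubleS (leq_trans hk').
Qed.

(** After [n] returns the imaginary part would exceed the bound [c] on the half trace itself. For
    [|z| > lambda + 2 c] the orbit escapes at once from its initial point 1. *)
Lemma escape_time z n : 1129 / 100 <= lambda ->
  2 * c < rho ^+ n * `|complex.Im z| \/ lambda + 2 * c < normc z ->
  exists2 j, (j <= n.*2)%N & escapes z j.
Proof.
move=> hl [hz|hz].
  case: (escapes_or_returning z n hl) => // -[k _ [h1 h2 _]].
  have := normc_Im (htrace z k); move: h1 h2 hz; lra.
have cE : c = 101 / 100 by [].
exists 0%N => //; split.
- by rewrite ComplexField.Normc.normc1 cE; lra.
- by rewrite [htrace z 1]/= normc_half; move: hz; rewrite cE; lra.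
- rewrite [htrace z 2]/= normc_half.
  have := normc_ge_sub z (- lambda%:C%C); rewrite normcN normc_real ger0_norm; last by lra.
  by move: hz; rewrite cE; lra.
Qed.

(** As long as [|x_m| <= |x_(m+1)| |x_(m+2)|], the trace map gives
    [|x_(m+3)| >= |x_(m+1)| |x_(m+2)|], and the inequality propagates. This is a Fibonacci recursion
    for the logarithms. *)
Lemma escape_growth z j i : escapes z j ->
  c ^+ fibn i <= normc (htrace z (j + i).+1).
Proof.
move=> [h0 h1 h2].
have c1 : 1 <= c by rewrite /trace_cst; lra.
suff : [/\ c ^+ fibn i <= normc (htrace z (j + i).+1),
  c ^+ fibn i.+1 <= normc (htrace z (j + i).+2) &
  normc (htrace z (j + i)) <= normc (htrace z (j + i).+1) * normc (htrace z (j + i).+2)].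
  by case.
elim: i => [|i [IH1 IH2 IH3]].
  rewrite addn0 !expr1; split; [exact: ltW|exact: ltW|].
  apply: le_trans h0 _; rewrite -[leLHS]mulr1; apply: ler_pM => //.
  - by rewrite (le_trans _ c1).
  - exact: ltW.
  - exact: le_trans c1 (ltW h2).
rewrite addnS; set m := (j + i)%N in IH1 IH2 IH3 *.
have key : normc (htrace z m.+1) * normc (htrace z m.+2) <= normc (htrace z m.+3).
  rewrite htraceS; apply: le_trans (normc_ge_sub _ _).
  by rewrite normcN !normcM normc_nat; move: IH3; lra.
have p1 : 1 <= normc (htrace z m.+2) by apply: le_trans IH2; rewrite exprn_ege1.
split=> //.
  rewrite fibnSS exprD mulrC; apply: le_trans key.
  by apply: ler_pM => //; rewrite exprn_ge0// (le_trans _ c1).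
apply: (@le_trans _ _ (1 * (normc (htrace z m.+1) * normc (htrace z m.+2)))).
  by rewrite mul1r ler_peMr ?normc_ge0.
apply: ler_pM => //.
by rewrite mulr_ge0 ?normc_ge0.
Qed.

End HalfTraces.

(** * Repetitions and reflection symmetry of the potential *)

Section RotationCoding.
Variable R : realType.
Implicit Types (n m : int).
Local Notation th := (theta R).

Lemma sqrt5_sqr : Num.sqrt (5 : R) ^+ 2 = 5.
Proof. by rewrite sqr_sqrtr. Qed.

Lemma theta_sqr : th ^+ 2 = 1 - th.
Proof. by have := sqrt5_sqr; rewrite /theta; lra. Qed.

Lemma sqrt5_bounds : 11 / 5 < Num.sqrt (5 : R) < 9 / 4.
Proof.
have h := sqrt5_sqr; have := sqrtr_ge0 (5 : R); move: h.
set s := Num.sqrt _ => h h0; apply/andP; split; nra.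
Qed.

Lemma theta_bounds : 3 / 5 < th < 5 / 8.
Proof. by have /andP[h1 h2] := sqrt5_bounds; rewrite /theta; apply/andP; split; lra. Qed.

Definition rot_floor n : int := Num.floor (n%:~R * th).

Lemma rot_floor_eq n m : m%:~R <= n%:~R * th -> n%:~R * th < m%:~R + 1 ->
  rot_floor n = m.
Proof. by move=> h1 h2; apply/eqP; rewrite /rot_floor floor_eq intrD h1 h2. Qed.

Lemma rot_floor_itv n :
  (rot_floor n)%:~R <= n%:~R * th < (rot_floor n)%:~R + 1.
Proof. by have := floor_itv (n%:~R * th); rewrite intrD. Qed.

(** The fractional part of [n theta] is at least [1 - theta] exactly when adding [theta] crosses an
    integer. Repetitions of the potential thereby reduce to those of integer parts. *)
Lemma fib_potentialE (lambda : R) n : fib_potential lambda n =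
  if rot_floor (n + 1) == rot_floor n + 1 then lambda else 0.
Proof.
rewrite /fib_potential /Defs.frac -/(rot_floor n) indicE.
have /andP[h1 h2] := rot_floor_itv n; have /andP[t1 t2] := theta_bounds.
case: eqP => h.
  rewrite mem_set ?mulr1//= in_itv /=.
  have /andP[] := rot_floor_itv (n + 1).
  by rewrite h !intrD !mulr1z => h3 h4; apply/andP; split; lra.
rewrite memNset ?mulr0//= in_itv /= => /andP[h3 h4]; apply: h.
by apply: rot_floor_eq; rewrite !intrD ?mulr1z; lra.
Qed.

(** The form factors as [(m - n theta)(m + n (1 + theta))], so this is the irrationality of [theta].
    Four times it is [(2 m + n)^2 - 5 n^2], and the parity of the exponent of 5 excludes the value
    0. *)
Lemma norm_form_neq0 n m : n != 0 -> m ^+ 2 + m * n - n ^+ 2 != 0.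
Proof.
move=> n0; apply/eqP => h.
have h5 : (2 * m + n) ^+ 2 = 5 * n ^+ 2 :> int by lia.
move: (2 * m + n) h5 => a h5.
have {h5} h5 : (`|a| ^ 2 = 5 * `|n| ^ 2)%N.
  by have := congr1 absz h5; rewrite abszM !abszX.
have n0' : (0 < `|n|)%N by rewrite absz_gt0.
have := congr1 (logn 5) h5.
rewrite lognM ?expn_gt0 ?n0'// !lognX (_ : logn 5 5 = 1%N)//; lia.
Qed.

Variable k : nat.
Local Notation p := (fibn k).
Local Notation q := (fibn k.+1).
Let e : R := q%:R * th - p%:R.

Lemma cassini (j : nat) :
  `|((fibn j)%:Z ^+ 2 + (fibn j)%:Z * (fibn j.+1)%:Z - (fibn j.+1)%:Z ^+ 2)%R| = 1.
Proof.
elim: j => // j <-; rewrite -normrN fibnSS PoszD; congr `| _ |; ring.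
Qed.

Lemma eta_theta : eta R = 1 + th.
Proof. by rewrite /eta /theta; lra. Qed.

(** The second factor is the algebraic conjugate of [e] up to sign, so the product is the norm form
    at [(p, q)], which Cassini's identity evaluates. *)
Lemma rot_err_mul : `|e| * (p%:R + q%:R * (1 + th)) = 1.
Proof.
have t2 := theta_sqr; have /andP[t1 _] := theta_bounds.
rewrite -[X in _ * X]ger0_norm -?normrM; last first.
  by rewrite addr_ge0// mulr_ge0//; lra.
have -> : e * (p%:R + q%:R * (1 + th)) =
  - ((p%:Z ^+ 2 + p%:Z * q%:Z - q%:Z ^+ 2)%:~R).
  rewrite intrB intrD intrM !rmorphXn /= -!pmulrn /e.
  have -> : (q%:R * th - p%:R) * (p%:R + q%:R * (1 + th)) =
     q%:R ^+ 2 * (th ^+ 2 + th) - p%:R * q%:R - p%:R ^+ 2 by ring.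
  by rewrite t2; ring.
by rewrite normrN -intr_norm cassini.
Qed.


Lemma rot_err_mul_lt (x : R) : x <= p%:R + q%:R * (8 / 5) -> `|e| * x <= 1.
Proof.
have /andP[t1 _] := theta_bounds; move=> hx; rewrite -rot_err_mul ler_wpM2l//.
by apply: le_trans hx _; rewrite lerD2l ler_wpM2l//; lra.
Qed.

Lemma rot_err_lt : (1 <= k)%N -> `|e| < 1 / 4.
Proof.
move=> k1.
have hp : 1 <= p%:R :> R by rewrite ler1n fibn_gt0.
have hq : 2 <= q%:R :> R.
  by rewrite ler_nat; case: k k1 => // j _; rewrite fibnSS (leq_add (fibn_gt0 _) (fibn_gt0 _)).
have : `|e| * (21 / 5) <= 1 by apply: rot_err_mul_lt; lra.
lra.
Qed.

Lemma rot_err_lt2 : (2 <= k)%N -> `|e| < 3 / 16.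
Proof.
move=> k2.
have hp : 2 <= p%:R :> R by rewrite ler_nat (fibn_homo k2).
have hq : 3 <= q%:R :> R by rewrite ler_nat (@fibn_homo 3).
have : `|e| * (34 / 5) <= 1 by apply: rot_err_mul_lt; lra.
lra.
Qed.

(* A smaller denominator has a larger error: the norm form takes nonzero integer
   values, and the value 1 is attained at (p, q). *)
Lemma rot_best_approx n m : 0 < n -> n < q%:Z ->
  `|e| < `|m%:~R - n%:~R * th|.
Proof.
move=> n0 nq; rewrite ltNge; apply/negP => h.
have /andP[t1 t1'] := theta_bounds; have t2 := theta_sqr.
have E := rot_err_mul; have e0 := normr_ge0 e.
have n1 : 1 <= n%:~R :> R by rewrite (ler_int _ 1); lia.
have nq' : n%:~R + 1 <= q%:R :> R.
  by rewrite -(mulr1z 1) -intrD [q%:R]pmulrn ler_int; lia.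
have eq : e <= `|e| by exact: ler_norm.
have eq' : - e <= `|e| by rewrite -normrN ler_norm.
have hN : 1 <= `|m%:~R - n%:~R * th| * `|m%:~R + n%:~R * (1 + th)|.
  rewrite -normrM.
  have -> : (m%:~R - n%:~R * th) * (m%:~R + n%:~R * (1 + th)) =
      (m ^+ 2 + m * n - n ^+ 2)%:~R.
    rewrite intrB intrD intrM !rmorphXn /=.
    have -> : (m%:~R - n%:~R * th) * (m%:~R + n%:~R * (1 + th)) =
      m%:~R ^+ 2 + m%:~R * n%:~R - n%:~R ^+ 2 * (th ^+ 2 + th) by ring.
    by rewrite t2; ring.
  rewrite -intr_norm (ler_int _ 1).
  by have := @norm_form_neq0 n m; rewrite gt_eqF// => /(_ isT); lia.
have d1 : m%:~R - n%:~R * th <= `|e| by apply: le_trans h; rewrite ler_norm.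
have d2 : - (m%:~R - n%:~R * th) <= `|e| by apply: le_trans h; rewrite -normrN ler_norm.
have p0 : 0 <= p%:R :> R by [].
have e1 : `|e| <= 1.
  have q1 : 1 <= q%:R :> R by rewrite ler1n fibn_gt0.
  by rewrite -[leLHS]mulr1; apply: rot_err_mul_lt; lra.
have nth : 0 <= n%:~R * th by rewrite mulr_ge0; lra.
have M0 : 0 <= m%:~R + n%:~R * (1 + th).
  by move: d2 nth; rewrite mulrDr mulr1; lra.
rewrite (ger0_norm M0) in hN.
have pE : p%:R = q%:R * th - e by rewrite /e; ring.
rewrite pE in E.
have E' : `|e| * (q%:R * (1 + 2 * th) - e) = 1 by rewrite -[RHS]E; ring.
(* With an error at most [|e|], the conjugate factor of [n] is at most [n (1 + 2 theta) + |e|]. That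
   of [q] is [q (1 + 2 theta) - e], which is larger because [n + 1 <= q] and [|e| <= 1]. *)
have N' : 1 <= `|e| * (n%:~R * (1 + 2 * th) + `|e|).
  apply: le_trans hN _; apply: ler_pM => //; lra.
have ep : 0 < `|e|.
  rewrite lt_neqAle e0 andbT; apply/eqP => E0; move: E'; rewrite -E0 mul0r; lra.
have : q%:R * (1 + 2 * th) - e <= n%:~R * (1 + 2 * th) + `|e|.
  by rewrite -(ler_pM2l ep) E'.
nra.
Qed.

(** A shift by [q] moves [n theta] by [p + e], and for [n < q] best approximation keeps [n theta]
    farther than [|e|] from the integers. At [n = q] the distance is [|e|] itself and the sign of
    [e] decides. *)
Lemma rot_floor_shift n : (1 <= k)%N -> 0 < n -> n <= q%:Z ->
  rot_floor (n + q%:Z) = rot_floor n + p%:Z.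
Proof.
move=> k1 n0; rewrite le_eqVlt => /orP[/eqP->|nq].
  have he := rot_err_lt k1.
  have eq : e <= `|e| by exact: ler_norm.
  have eq' : - e <= `|e| by rewrite -normrN ler_norm.
  have qth : q%:Z%:~R * th = p%:R + e by rewrite /e -pmulrn; ring.
  case: (lerP 0 e) => e0.
  - have -> : rot_floor q%:Z = p%:Z.
      by apply: rot_floor_eq; rewrite qth -pmulrn; lra.
    by apply: rot_floor_eq; rewrite !intrD mulrDl qth -!pmulrn; lra.
  - have -> : rot_floor q%:Z = p%:Z - 1.
      by apply: rot_floor_eq; rewrite qth intrB mulr1z -?pmulrn; lra.
    by apply: rot_floor_eq; rewrite !intrD mulrDl qth intrN ?mulr1z -!pmulrn; lra.
have /andP[h1 h2] := rot_floor_itv n.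
have a1 := rot_best_approx (rot_floor n) n0 nq.
have a2 := rot_best_approx (rot_floor n + 1) n0 nq.
move: a1 a2; rewrite intrD mulr1z => a1 a2.
rewrite (@ler0_norm _ ((rot_floor n)%:~R - _)) in a1; last by lra.
rewrite (@ger0_norm _ ((rot_floor n)%:~R + 1 - _)) in a2; last by lra.
have eq : e <= `|e| by exact: ler_norm.
have eq' : - e <= `|e| by rewrite -normrN ler_norm.
have E : (n + q%:Z)%:~R * th = n%:~R * th + p%:R + e.
  by rewrite intrD -pmulrn /e; ring.
by apply: rot_floor_eq; rewrite E intrD -pmulrn; lra.
Qed.

(** The last site of a block involves the integer part at [q + 1]. The fractional part there is
    close to [theta < 5 / 8], and [2 |e| < 3 / 8] keeps it below 1; this is where [2 <= k]
    enters. *)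
Lemma rot_floor_shift_succ : (2 <= k)%N ->
  rot_floor (q%:Z + 1 + q%:Z) = rot_floor (q%:Z + 1) + p%:Z.
Proof.
move=> k2; have he := rot_err_lt2 k2.
have eq : e <= `|e| by exact: ler_norm.
have eq' : - e <= `|e| by rewrite -normrN ler_norm.
have /andP[t1 t1'] := theta_bounds.
have qth : q%:Z%:~R * th = p%:R + e by rewrite /e -pmulrn; ring.
have -> : rot_floor (q%:Z + 1) = p%:Z.
  by apply: rot_floor_eq; rewrite intrD mulrDl qth mulr1z -pmulrn; lra.
by apply: rot_floor_eq; rewrite !intrD !mulrDl qth mulr1z -!pmulrn; lra.
Qed.

Lemma fib_potential_period (lambda : R) n : (1 <= k)%N -> 0 < n -> n < q%:Z ->
  fib_potential lambda (n + q%:Z) = fib_potential lambda n.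
Proof.
move=> k1 n0 nq; rewrite !fib_potentialE addrAC.
rewrite !rot_floor_shift //; try lia.
by rewrite [X in _ == X]addrAC (inj_eq (@addIr int _)).
Qed.

Lemma fib_potential_square (lambda : R) n : (2 <= k)%N -> 0 < n -> n <= q%:Z ->
  fib_potential lambda (n + q%:Z) = fib_potential lambda n.
Proof.
move=> k2 n0; rewrite le_eqVlt => /orP[/eqP->|nq]; last first.
  by apply: fib_potential_period => //; exact: ltnW.
rewrite !fib_potentialE addrAC rot_floor_shift_succ// rot_floor_shift ?(ltnW k2)//.
  by rewrite [X in _ == X]addrAC (inj_eq (@addIr int _)).
by have := fibn_gt0 k.+1; lia.
Qed.

End RotationCoding.

Section Reflection.
Variable R : realType.
Local Notation th := (theta R).

Lemma rot_floor_opp (n : int) : n != 0 -> rot_floor R (- n) = - rot_floor R n - 1.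
Proof.
move=> n0; have /andP[h1 h2] := rot_floor_itv R n.
have h3 : (rot_floor R n)%:~R != n%:~R * th :> R.
  apply/eqP => h; have := @norm_form_neq0 n (rot_floor R n) n0.
  rewrite -(intr_eq0 R) intrB intrD intrM !rmorphXn /= h.
  have -> : (n%:~R * th) ^+ 2 + n%:~R * th * n%:~R - n%:~R ^+ 2 =
    n%:~R ^+ 2 * (th ^+ 2 + th - 1) by ring.
  by rewrite theta_sqr subrK subrr mulr0 eqxx.
have {h3 h1} h1 : (rot_floor R n)%:~R < n%:~R * th by rewrite lt_neqAle h3.
by apply: rot_floor_eq; rewrite ?intrB !intrN mulNr ?mulr1z; lra.
Qed.

(** Off the integers [floor (- x) = - floor x - 1], so the coding by jumps is symmetric about
    [- 1 / 2]. The left half line thus becomes a copy of the right one. *)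
Lemma fib_potential_reflect (lambda : R) (n : int) : 0 < n ->
  fib_potential lambda (- 1 - n) = fib_potential lambda n.
Proof.
move=> n0; rewrite !fib_potentialE.
have -> : - 1 - n + 1 = - n by lia.
have -> : - 1 - n = - (n + 1) by lia.
rewrite !rot_floor_opp; try lia.
by congr (if _ then _ else _); apply/eqP/eqP; move: (rot_floor R n) (rot_floor R (n + 1)) => a b; lia.
Qed.

Lemma fib_potential1 (lambda : R) : fib_potential lambda 1 = lambda.
Proof.
have /andP[t1 t2] := theta_bounds R.
rewrite fib_potentialE (rot_floor_eq (m := 1)) ?(rot_floor_eq (m := 0)) //=;
  rewrite ?intrD ?mulr1z; lra.
Qed.

Lemma fib_potential2 (lambda : R) : fib_potential lambda 2 = 0.
Proof.
have /andP[t1 t2] := theta_bounds R.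
have E2 : (2 : int)%:~R = 2 :> R by rewrite -pmulrn.
have E3 : (2 + 1 : int)%:~R = 3 :> R by rewrite -pmulrn.
rewrite fib_potentialE (rot_floor_eq (n := 2 + 1) (m := 1)) ?(rot_floor_eq (n := 2) (m := 1)) //=;
  rewrite ?E2 ?E3 ?mulr1z; lra.
Qed.

End Reflection.

(** * Transfer matrices, Gordon's argument and Green's identity *)

Section TransferMatrices.
Variable R : realType.
Implicit Types (z : R[i]) (V : nat -> R) (y : nat -> R[i]).

Record mat2 := Mat2 { e11 : R[i]; e12 : R[i]; e21 : R[i]; e22 : R[i] }.

Definition mat2_mul (A B : mat2) := Mat2
  (e11 A * e11 B + e12 A * e21 B) (e11 A * e12 B + e12 A * e22 B)
  (e21 A * e11 B + e22 A * e21 B) (e21 A * e12 B + e22 A * e22 B).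

Definition mat2_tr (A : mat2) := e11 A + e22 A.
Definition mat2_det (A : mat2) := e11 A * e22 A - e12 A * e21 A.
Definition mat2_act (A : mat2) (u : R[i] * R[i]) :=
  (e11 A * u.1 + e12 A * u.2, e21 A * u.1 + e22 A * u.2).

Lemma mat2_mulA A B C : mat2_mul A (mat2_mul B C) = mat2_mul (mat2_mul A B) C.
Proof. by rewrite /mat2_mul /=; congr Mat2; ring. Qed.

Lemma mat2_actM A B u : mat2_act (mat2_mul A B) u = mat2_act A (mat2_act B u).
Proof. by rewrite /mat2_act /=; congr pair; ring. Qed.

Lemma mat2_detM A B : mat2_det (mat2_mul A B) = mat2_det A * mat2_det B.
Proof. by rewrite /mat2_det /=; ring. Qed.

(** Cayley-Hamilton for [B] and cyclicity of the trace. For consecutive blocks [A] and [B] this is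
    the trace map. *)
Lemma mat2_tr_sandwich A B : mat2_det B = 1 ->
  mat2_tr (mat2_mul B (mat2_mul A B)) =
  mat2_tr (mat2_mul A B) * mat2_tr B - mat2_tr A.
Proof.
move=> hB; have -> : mat2_tr A = mat2_tr A * mat2_det B by rewrite hB mulr1.
by rewrite /mat2_tr /mat2_det /=; ring.
Qed.

Lemma mat2_cayley_hamilton A u : mat2_det A = 1 ->
  mat2_act A (mat2_act A u) =
  (mat2_tr A * (mat2_act A u).1 - u.1, mat2_tr A * (mat2_act A u).2 - u.2).
Proof.
case: u => u v hA /=; rewrite -{1}[u]mul1r -{1}[v]mul1r.
have E x : x = mat2_det A * x by rewrite hA mul1r.
rewrite [X in _ - X]E [X in (_, _ - X)]E /mat2_act /mat2_tr /mat2_det /=.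
by congr pair; ring.
Qed.

Definition one_step z (v : R) := Mat2 (z - v%:C%C) (-1) 1 0.

Fixpoint transfer V z n : mat2 :=
  if n is m.+1 then mat2_mul (one_step z (V n)) (transfer V z m)
  else Mat2 1 0 0 1.

Lemma transfer_det V z n : mat2_det (transfer V z n) = 1.
Proof.
elim: n => [|n IH]; first by rewrite /mat2_det /=; ring.
by rewrite /= mat2_detM IH /mat2_det /=; ring.
Qed.

Definition recurrent V z y :=
  forall j, y j.+2 = (z - (V j.+1)%:C%C) * y j.+1 - y j.

Lemma transfer_act V z y n : recurrent V z y ->
  mat2_act (transfer V z n) (y 1%N, y 0%N) = (y n.+1, y n).
Proof.
move=> h; elim: n => [|n IH]; first by rewrite /mat2_act /=; congr pair; ring.
by rewrite mat2_actM IH /mat2_act /= h; congr pair; ring.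
Qed.

Lemma transfer_periodic V z m n :
  (forall i, (0 < i <= n)%N -> V (m + i)%N = V i) ->
  transfer V z (m + n) = mat2_mul (transfer V z n) (transfer V z m).
Proof.
elim: n => [|n IH] h.
  by rewrite addn0 /mat2_mul /=; case: transfer => a b c d /=; congr Mat2; ring.
rewrite addnS /= -mat2_mulA -IH.
  by rewrite -addnS h//= leqnn.
by move=> i /andP[i0 il]; rewrite h// i0 ltnW.
Qed.

(** A repeated block with matrix [M] gives [M^2 u = tr M * M u - u]. For a bounded solution a large
    trace then forces [M u], the solution after one block, to be small. *)
Lemma gordon_square V z y q : recurrent V z y ->
  (forall i, (0 < i <= q)%N -> V (q + i)%N = V i) ->
  y (q + q)%N.+1 = mat2_tr (transfer V z q) * y q.+1 - y 1%N /\
  y (q + q)%N = mat2_tr (transfer V z q) * y q - y 0%N.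
Proof.
move=> hy hV; have := transfer_act (q + q) hy.
rewrite transfer_periodic// mat2_actM mat2_cayley_hamilton ?transfer_det//.
by rewrite transfer_act//= => -[-> ->].
Qed.

Lemma gordon_bound V z y q (C : R) : recurrent V z y ->
  (forall i, (0 < i <= q)%N -> V (q + i)%N = V i) ->
  (forall j, normc (y j) <= C) ->
  normc (mat2_tr (transfer V z q)) * normc (y q) <= C + C /\
  normc (mat2_tr (transfer V z q)) * normc (y q.+1) <= C + C.
Proof.
move=> hy hV hC; have [h1 h2] := gordon_square hy hV.
have {}h1 : mat2_tr (transfer V z q) * y q.+1 = y (q + q)%N.+1 + y 1%N by rewrite h1 subrK.
have {}h2 : mat2_tr (transfer V z q) * y q = y (q + q)%N + y 0%N by rewrite h2 subrK.
by rewrite -!normcM h1 h2; split; apply: le_trans (normcD _ _) _; exact: lerD.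
Qed.

Definition normc2 (x : R[i]) : R := normc x ^+ 2.

Lemma normc2_ge0 x : 0 <= normc2 x.
Proof. exact: sqr_ge0. Qed.

Lemma conj_mul_norm (x : R[i]) : conjc x * x = (normc2 x)%:C%C.
Proof.
rewrite /normc2 sqr_normcE; case: x => a b; apply/eqP.
by rewrite eq_complex !ReImE /=; apply/andP; split; apply/eqP; ring.
Qed.

Lemma rCM (a b : R) : (a * b)%:C%C = a%:C%C * b%:C%C.
Proof. by rewrite rmorphM. Qed.

Lemma rCB (a b : R) : (a - b)%:C%C = a%:C%C - b%:C%C.
Proof. by rewrite rmorphB. Qed.

Lemma rCV (a : R) : (a^-1)%:C%C = (a%:C%C)^-1.
Proof. by rewrite fmorphV. Qed.

Lemma rCD (a b : R) : (a + b)%:C%C = a%:C%C + b%:C%C.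
Proof. by rewrite rmorphD. Qed.

Section HalfLine.
Variables (V : nat -> R) (z : R[i]) (y : nat -> R[i]) (lambda : R).
Hypothesis hy : recurrent V z y.
Hypothesis hV : forall j, `|V j| <= lambda.

Let S M : R := \sum_(j < M) normc2 (y j.+1).

(** [h] is the quadratic form of the operator truncated to the first [M + 1] sites, and the
    right-hand side is the boundary term. The slack [- normc2 (y M.+1)] in the bound on [h] pays for
    the cross term [r] with the next site in the induction. *)
Lemma green_identity M : exists h : R,
  `|h| <= (lambda + 2) * S M.+1 - normc2 (y M.+1) /\
  z * (S M.+1)%:C%C - h%:C%C = conjc (y M.+1) * y M.+2 + conjc (y 1%N) * y 0%N.
Proof.
elim: M => [|M [h [hh hE]]].
  exists (V 1 * normc2 (y 1%N)); rewrite /S big_ord_recl big_ord0 addr0; split.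
    have := ler_wpM2r (normc2_ge0 (y 1%N)) (hV 1).
    rewrite normrM (@ger0_norm _ (normc2 _)) ?normc2_ge0//.
    have := normc2_ge0 (y 1%N); lra.
  rewrite rCM -conj_mul_norm hy; ring.
pose r := 2 * complex.Re (conjc (y M.+1) * y M.+2).
exists (h + V M.+2 * normc2 (y M.+2) + r); rewrite /S big_ord_recr -/(S M.+1) /=; split.
  have hr : `|r| <= normc2 (y M.+1) + normc2 (y M.+2).
    rewrite /r normrM (@ger0_norm _ 2)//.
    have := normc_Re (conjc (y M.+1) * y M.+2).
    have -> : normc (conjc (y M.+1) * y M.+2) = normc (y M.+1) * normc (y M.+2).
      by rewrite normcM; case: (y M.+1) => a b /=; rewrite sqrrN.
    rewrite /normc2; have := sqr_ge0 (normc (y M.+1) - normc (y M.+2)); nra.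
  have h3 := ler_wpM2r (normc2_ge0 (y M.+2)) (hV M.+2).
  apply: le_trans (ler_normD _ _) _; apply: le_trans (lerD (ler_normD _ _) (lexx _)) _.
  rewrite normrM (@ger0_norm _ (normc2 _)) ?normc2_ge0//.
  by move: hh hr h3; lra.
have rE : r%:C%C = conjc (y M.+1) * y M.+2 + conjc (y M.+2) * y M.+1.
  rewrite /r; case: (y M.+1) (y M.+2) => a b [c d]; apply/eqP.
  by rewrite eq_complex !ReImE /=; apply/andP; split; apply/eqP; ring.
have hE' : z * (S M.+1)%:C%C = conjc (y M.+1) * y M.+2 + conjc (y 1%N) * y 0%N + h%:C%C.
  by rewrite -hE subrK.
rewrite (rCD (S M.+1)) (rCD _ r) (rCD h) (rCM (V M.+2)) mulrDr hE' -conj_mul_norm rE [y M.+3]hy; ring.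
Qed.

Lemma half_line_bound M (d : R) :
  d <= `|complex.Im z| \/ d <= normc z - (lambda + 2) ->
  d * S M.+1 <= normc (y M.+1) * normc (y M.+2) + normc (y 1%N) * normc (y 0%N).
Proof.
move=> hd; have [h [hh hE]] := green_identity M.
have nconj x : normc (conjc x) = normc x :> R by case: x => u v /=; rewrite sqrrN.
apply: (@le_trans _ _ (normc (z * (S M.+1)%:C%C - h%:C%C))); last first.
  by rewrite hE; apply: le_trans (normcD _ _) _; rewrite !normcM !nconj.
have S0 : 0 <= S M.+1 by apply: sumr_ge0 => j _; rewrite sqr_ge0.
case: hd => hd.
  apply: le_trans (normc_Im _); rewrite ImD ImN ImM /= oppr0 addr0 mulr0 add0r.
  by rewrite normrM (ger0_norm S0) ler_wpM2r.
apply: le_trans (normc_ge_sub _ _); rewrite normcN normcM !normc_real (ger0_norm S0).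
have := normc2_ge0 (y M.+1); have := ler_wpM2r S0 hd; move: hh; lra.
Qed.

Lemma half_line_decay (d C : R) (n : nat) : 0 < d -> 0 <= C ->
  d <= `|complex.Im z| \/ d <= normc z - (lambda + 2) ->
  (forall j, normc (y j) <= C) ->
  (forall eps, 0 < eps -> exists M0, forall M, (M0 <= M)%N -> normc (y M) <= eps) ->
  d * normc (y n.+1) ^+ 2 <= normc (y 1%N) * normc (y 0%N).
Proof.
move=> d0 C0 hd hC h0; apply/ler_addgt0Pr => e e0.
have [M0 hM0] := h0 (e / (C + 1)) (divr_gt0 e0 (ltr_wpDl C0 ltr01)).
pose M := maxn M0 n.
apply: (@le_trans _ _ (d * S M.+1)).
  rewrite ler_pM2l// /S (bigD1 (Ordinal (leq_maxr M0 n : (n < M.+1)%N)))//= lerDl.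
  by apply: sumr_ge0 => j _; rewrite sqr_ge0.
apply: le_trans (half_line_bound M hd) _; rewrite addrC lerD2l.
have h1 : normc (y M.+1) <= e / (C + 1) by apply: hM0; rewrite leqW// leq_maxl.
apply: le_trans (ler_pM (normc_ge0 _) (normc_ge0 _) h1 (hC _)) _.
rewrite mulrAC ler_pdivrMr ?ltr_wpDl//; nra.
Qed.

End HalfLine.
End TransferMatrices.

Section FibonacciBlocks.
Variable R : realType.
Variable lambda : R.
Implicit Types (z : R[i]).

Definition vpot (j : nat) : R := fib_potential lambda j%:Z.

Lemma vpot_period k i : (1 <= k)%N -> (0 < i <= fibn k)%N ->
  vpot (fibn k.+1 + i) = vpot i.
Proof.
move=> k1 /andP[i0 ik]; rewrite /vpot addnC PoszD fib_potential_period//.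
rewrite ltz_nat (leq_ltn_trans ik)//; case: k k1 {ik} => // k _.
by rewrite fibnSS -addn1 leq_add2l fibn_gt0.
Qed.

Lemma vpot_square k i : (2 <= k)%N -> (0 < i <= fibn k.+1)%N ->
  vpot (fibn k.+1 + i) = vpot i.
Proof. by move=> k1 /andP[i0 ik]; rewrite /vpot addnC PoszD fib_potential_square. Qed.

(** From [k = 1] on, the block of length [fibn k.+2] is the one of length [fibn k.+1] followed by
    the one of length [fibn k]. The recursion reaches back three indices, so three blocks are
    computed by hand. *)
Lemma transfer_htrace z n :
  mat2_tr (transfer vpot z (fibn n.+1)) = 2 * htrace lambda z n.+2.
Proof.
pose W k := transfer vpot z (fibn k).
have WE k : (1 <= k)%N -> W k.+2 = mat2_mul (W k) (W k.+1).
  by move=> k1; rewrite /W fibnSS transfer_periodic// => i; exact: vpot_period.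
rewrite -/(W n.+1).
have h2 : (2 : R[i]) != 0 by rewrite pnatr_eq0.
have v1 : vpot 1 = lambda by exact: fib_potential1.
have v2 : vpot 2 = 0 by exact: fib_potential2.
suff : [/\ mat2_tr (W n.+1) = 2 * htrace lambda z n.+2,
  mat2_tr (W n.+2) = 2 * htrace lambda z n.+3 &
  mat2_tr (W n.+3) = 2 * htrace lambda z n.+4] by case.
elim: n => [|n [IH1 IH2 IH3]].
  split.
  - by rewrite /W /= /mat2_tr /= v1; field.
  - by rewrite /W /= /mat2_tr /= v1 v2 /=; field.
  - by rewrite WE// /W /= /mat2_tr /= v1 v2 /=; field.
split; [exact: IH2|exact: IH3|].
rewrite (WE n.+2)// (WE n.+1)// mat2_tr_sandwich ?transfer_det// -(WE n.+1)// IH1 IH2 IH3 (htraceS _ _ n.+2).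
ring.
Qed.

End FibonacciBlocks.

(** * The Chebyshev wave and its conserved energy *)

Section WindowSums.
Variable R : realType.
Implicit Types (f g : int -> R) (a : int).

Definition wsum a (N : nat) f : R := \sum_(k < N) f (a + k%:Z).

Lemma wsum_shift a N f :
  wsum a N (fun n => f (n + 1)) = wsum a N f - f a + f (a + N%:Z).
Proof.
rewrite /wsum; elim: N => [|N IH]; first by rewrite !big_ord0 addr0; ring.
rewrite !big_ord_recr /= IH (_ : a + N%:Z + 1 = a + N.+1%:Z); last by lia.
ring.
Qed.

Lemma wsum_shift0 a N f : f a = 0 -> f (a + N%:Z) = 0 ->
  wsum a N (fun n => f (n + 1)) = wsum a N f.
Proof. by move=> h1 h2; rewrite wsum_shift h1 h2 subr0 addr0. Qed.

Lemma eq_wsum a N f g : f =1 g -> wsum a N f = wsum a N g.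
Proof. by move=> h; apply: eq_bigr => k _. Qed.

Lemma wsumD a N f g : wsum a N (fun n => f n + g n) = wsum a N f + wsum a N g.
Proof. exact: big_split. Qed.

Lemma wsumZ a N (c : R) f : wsum a N (fun n => c * f n) = c * wsum a N f.
Proof. by rewrite /wsum mulr_sumr. Qed.

Lemma ler_wsum a N f g : (forall n, f n <= g n) -> wsum a N f <= wsum a N g.
Proof. by move=> h; apply: ler_sum. Qed.

Lemma wsum_ge a N f n : (forall n, 0 <= f n) -> a <= n -> n < a + N%:Z ->
  f n <= wsum a N f.
Proof.
move=> f0 an nN; have hk : (absz (n - a)%R < N)%N by lia.
rewrite /wsum (bigD1 (Ordinal hk))//= (_ : a + `|(n - a)%R|%N%:Z = n); last by lia.
by rewrite lerDl sumr_ge0.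
Qed.

End WindowSums.

Section Wave.
Variable R : realType.
Variables (V : int -> R) (b lambda : R).

Definition rham (f : int -> R) (n : int) : R := f (n + 1) + f (n - 1) + V n * f n.

Fixpoint wave_pair (m : nat) : (int -> R) * (int -> R) :=
  if m is m'.+1 then
    let p := wave_pair m' in (p.2, fun n => b * rham p.2 n - p.1 n)
  else (fun=> 0, fun n => (n == 1)%:R).

(* [wave m] is U_m(b H / 2) delta_1 with U_m the Chebyshev polynomial of the
   second kind. *)
Definition wave m := (wave_pair m).2.
Definition wave_prev m := (wave_pair m).1.

Lemma waveS m n : wave m.+1 n = b * rham (wave m) n - wave_prev m n.
Proof. by []. Qed.

Lemma wave_prevS m : wave_prev m.+1 = wave m.
Proof. by []. Qed.

Lemma wave_support m n : (m < `|(n - 1)%R|)%N -> wave m n = 0 /\ wave_prev m n = 0.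
Proof.
elim: m n => [|m IH] n hn.
  by split => //; rewrite /wave /=; case: eqP hn => // ->.
have [h1 h2] := IH n (ltnW hn).
split; last by rewrite wave_prevS.
rewrite waveS /rham h1 h2 (IH (n + 1) _).1; last by lia.
by rewrite (IH (n - 1) _).1; [ring|lia].
Qed.

Lemma rham_sym (f g : int -> R) a N :
  (forall n, n <= a + 1 -> f n = 0 /\ g n = 0) ->
  (forall n, a + N%:Z - 1 <= n -> f n = 0 /\ g n = 0) ->
  wsum a N (fun n => rham f n * g n) = wsum a N (fun n => f n * rham g n).
Proof.
move=> ha hN.
rewrite (@eq_wsum _ _ _ _ (fun n => f (n + 1) * g n + f (n - 1) * g n + V n * f n * g n)); last first.
  by move=> n; rewrite /rham; ring.
rewrite (@eq_wsum _ _ _ (fun n => f n * rham g n)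
  (fun n => f n * g (n - 1) + f n * g (n + 1) + V n * f n * g n)); last first.
  by move=> n; rewrite /rham; ring.
rewrite !wsumD; congr (_ + _ + _).
  rewrite -[RHS]wsum_shift0; first by apply: eq_wsum => n; rewrite addrK.
    by rewrite (ha a _).1 ?mul0r//; lia.
  by rewrite (hN (a + N%:Z) _).1 ?mul0r//; lia.
rewrite -[LHS]wsum_shift0; first by apply: eq_wsum => n; rewrite addrK.
  by rewrite (ha a _).2 ?mulr0//; lia.
by rewrite (hN (a + N%:Z) _).2 ?mulr0//; lia.
Qed.

Let energy L m := wsum (- L%:Z) L.*2.+1
  (fun n => wave m n ^+ 2 + wave_prev m n ^+ 2 - b * rham (wave m) n * wave_prev m n).

(** The recursion and the symmetry of [rham] turn the energy of one step into that of the previous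
    one, as for a discrete wave equation. The window exceeds the support by enough to kill all
    boundary terms. *)
Lemma wave_energy L m : (m + 5 <= L)%N -> energy L m = 1.
Proof.
elim: m => [|m IH] hm.
  rewrite /energy (@eq_wsum _ _ _ _ (fun n => (n == 1)%:R)); last first.
    by move=> n; rewrite /wave /wave_prev /=; case: (n == 1); rewrite /=; ring.
  have hk : (L + 1 < L.*2.+1)%N by lia.
  rewrite /wsum (bigD1 (Ordinal hk)) //=.
  rewrite (_ : (_ == 1) = true); last by apply/eqP; lia.
  rewrite big1 ?addr0// => i /eqP hi.
  rewrite (_ : (_ == 1) = false)//; apply/eqP => E; apply: hi; apply: val_inj => /=; lia.
rewrite -IH; last by lia.
rewrite /energy.
have S : wsum (- L%:Z) L.*2.+1 (fun n => rham (wave m.+1) n * wave m n) =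
         wsum (- L%:Z) L.*2.+1 (fun n => wave m.+1 n * rham (wave m) n).
  apply: rham_sym => n hn; split;
    by [rewrite (wave_support (m := m.+1) (n := n) _).1//; lia |
        rewrite (wave_support (m := m) (n := n) _).1//; lia].
rewrite wave_prevS.
rewrite (@eq_wsum _ _ _ _ (fun n => wave m.+1 n ^+ 2 + wave m n ^+ 2
  + (- b) * (rham (wave m.+1) n * wave m n))); last by move=> n; ring.
rewrite wsumD wsumZ S -wsumZ -wsumD; apply: eq_wsum => n.
rewrite waveS; ring.
Qed.

(** Since [b * (lambda + 2) <= 1], the mixed term of the energy is at most half the sum of the two
    squared norms, so that the energy 1 bounds this sum by 2. *)
Lemma wave_bound m n : 0 <= b -> b * (lambda + 2) <= 1 ->
  (forall j, `|V j| <= lambda) -> `|wave m n| <= 2.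
Proof.
move=> b0 bl hV.
have l0 : 0 <= lambda := le_trans (normr_ge0 _) (hV 0).
pose L := (absz n + m + 5)%N.
have E := @wave_energy L m ltac:(rewrite /L; lia).
pose u := wave m; pose p := wave_prev m.
pose A (f : int -> R) : R := wsum (- L%:Z) L.*2.+1 (fun n => f n ^+ 2).
have us (j : int) : (m < `|(j - 1)%R|)%N -> u j = 0 by move=> /wave_support[].
have supL (f : int -> R) : (forall j : int, (m < `|(j - 1)%R|)%N -> f j = 0) ->
    wsum (- L%:Z) L.*2.+1 (fun n => f (n + 1) ^+ 2) = A f /\
    wsum (- L%:Z) L.*2.+1 (fun n => f (n - 1) ^+ 2) = A f.
  move=> hf; split.
    rewrite (wsum_shift0 (f := fun n => f n ^+ 2))// hf ?expr0n//; rewrite /L; lia.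
  rewrite -(wsum_shift0 (f := fun n => f (n - 1) ^+ 2)); last 2 first.
  - by rewrite hf ?expr0n//; rewrite /L; lia.
  - by rewrite hf ?expr0n//; rewrite /L; lia.
  by apply: eq_wsum => j; rewrite addrK.
have [u1 u2] := supL _ us.
have hle : wsum (- L%:Z) L.*2.+1 (fun n => b * rham u n * p n) <= 1 / 2 * (A u + A p).
  apply: (@le_trans _ _ (wsum (- L%:Z) L.*2.+1 (fun n => b / 2 *
    ((u (n + 1) ^+ 2 + u (n - 1) ^+ 2) + (lambda * u n ^+ 2 + (lambda + 2) * p n ^+ 2))))).
    apply: ler_wsum => j.
    have -> : b * rham u j * p j = b / 2 * (2 * (rham u j * p j)) by field.
    rewrite ler_wpM2l ?divr_ge0// /rham.
    have h1 := sqr_ge0 (u (j + 1) - p j); have h2 := sqr_ge0 (u (j - 1) - p j).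
    have h3 : 2 * (V j * u j * p j) <= lambda * (u j ^+ 2 + p j ^+ 2).
      apply: le_trans (ler_norm _) _; rewrite !normrM (@ger0_norm _ 2)// -mulrA mulrCA.
      apply: le_trans (ler_wpM2r _ (hV j)) _; first by rewrite !mulr_ge0.
      rewrite ler_wpM2l//.
      rewrite -[u j ^+ 2]real_normK ?num_real// -[p j ^+ 2]real_normK ?num_real//.
      have := sqr_ge0 (`|u j| - `|p j|); nra.
    move: h1 h2 h3; nra.
  rewrite wsumZ !wsumD !wsumZ u1 u2 -/(A u) -/(A p).
  have -> : b / 2 * (A u + A u + (lambda * A u + (lambda + 2) * A p)) =
    (b * (lambda + 2)) * (1 / 2 * (A u + A p)) by field.
  rewrite ler_piMl// mulr_ge0// addr_ge0//; apply: sumr_ge0 => j _; exact: sqr_ge0.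
have {}E : A u + A p - wsum (- L%:Z) L.*2.+1 (fun n => b * rham u n * p n) = 1.
  rewrite -E /energy /A -wsumD -[X in _ - X]mul1r -mulNr -wsumZ -wsumD.
  by apply: eq_wsum => j; rewrite mulN1r.
have Ap : 0 <= A p by apply: sumr_ge0 => j _; exact: sqr_ge0.
have Au : u n ^+ 2 <= A u.
  by apply: (wsum_ge (f := fun n => u n ^+ 2)) => [j||]; [exact: sqr_ge0|rewrite /L; lia|rewrite /L; lia].
apply: le_of_sqr => //; rewrite real_normK ?num_real//.
by move: E hle Ap Au; rewrite /u; lra.
Qed.

End Wave.

(** * Power series with bounded coefficients and Cauchy's estimate *)

Section PowerSeries.
Variable R : realType.
Implicit Types (a x : nat -> R) (w s : R[i]) (rho C : R).

Lemma geometric_tail_le rho K n : 0 <= rho -> rho < 1 ->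
  \sum_(K <= m < K + n) rho ^+ m <= rho ^+ K / (1 - rho).
Proof.
move=> r0 r1; rewrite ler_pdivlMr ?subr_gt0//.
suff -> : (\sum_(K <= m < K + n) rho ^+ m) * (1 - rho) = rho ^+ K - rho ^+ (K + n).
  by rewrite gerBl exprn_ge0.
elim: n => [|n IH]; first by rewrite addn0 big_geq// mul0r subrr.
rewrite addnS big_nat_recr ?leq_addr//= mulrDl IH exprS; ring.
Qed.

Lemma real_series_tail x rho C : 0 <= rho -> rho < 1 -> 0 <= C ->
  (forall m, `|x m| <= C * rho ^+ m) ->
  exists s : R, forall K, `|s - \sum_(0 <= m < K) x m| <= C * rho ^+ K / (1 - rho).
Proof.
move=> r0 r1 C0 hx.
have cx : cvgn (series x).
  apply: normed_cvg; apply: (series_le_cvg (v_ := geometric C rho)) => [m|m|m|] /=.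
  - exact: normr_ge0.
  - by rewrite mulr_ge0// exprn_ge0.
  - exact: hx.
  - by apply: is_cvg_geometric_series; rewrite ger0_norm.
have part K n : `|\sum_(0 <= m < K + n) x m - \sum_(0 <= m < K) x m| <= C * rho ^+ K / (1 - rho).
  rewrite (@big_cat_nat _ _ _ K 0 (K + n))//= ?leq_addr// addrAC subrr add0r.
  apply: le_trans (ler_norm_sum _ _ _) _.
  apply: (@le_trans _ _ (\sum_(K <= m < K + n) C * rho ^+ m)); first exact: ler_sum.
  by rewrite -mulr_sumr -mulrA ler_wpM2l// geometric_tail_le.
exists (limn (series x)) => K.
have ub M : (K <= M)%N -> series x M <= \sum_(0 <= m < K) x m + C * rho ^+ K / (1 - rho).
  by move=> KM; have := part K (M - K)%N; rewrite subnKC// ler_norml => /andP[_]; rewrite /series/=; lra.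
have lb M : (K <= M)%N -> \sum_(0 <= m < K) x m - C * rho ^+ K / (1 - rho) <= series x M.
  by move=> KM; have := part K (M - K)%N; rewrite subnKC// ler_norml => /andP[+ _]; rewrite /series/=; lra.
have h1 : limn (series x) <= \sum_(0 <= m < K) x m + C * rho ^+ K / (1 - rho).
  by apply: limr_le => //; near=> M; apply: ub; near: M; exact: nbhs_infty_ge.
have h2 : \sum_(0 <= m < K) x m - C * rho ^+ K / (1 - rho) <= limn (series x).
  by apply: limr_ge => //; near=> M; apply: lb; near: M; exact: nbhs_infty_ge.
by rewrite ler_norml; apply/andP; split; lra.
Unshelve. all: by end_near. Qed.

Definition psum a w K : R[i] := \sum_(0 <= m < K) (a m)%:C%C * w ^+ m.

Lemma psumS a w K : psum a w K.+1 = psum a w K + (a K)%:C%C * w ^+ K.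
Proof. by rewrite /psum big_nat_recr. Qed.

(** The sum of the series is encoded by its rate of convergence, so that identities pass to the
    limit by bounding an error by a multiple of [normc w ^+ K]. The factor 2 comes from summing real
    and imaginary parts separately. *)
Definition is_gensum C a w s : Prop :=
  forall K, normc (s - psum a w K) <= 2 * C / (1 - normc w) * normc w ^+ K.

Lemma gensum_exists C a w : normc w < 1 -> 0 <= C -> (forall m, `|a m| <= C) ->
  exists s, is_gensum C a w s.
Proof.
move=> w1 C0 ha.
have w0 := normc_ge0 w.
have hn m : normc ((a m)%:C%C * w ^+ m) <= C * normc w ^+ m.
  by rewrite normcM normc_real normcX ler_wpM2r ?exprn_ge0.
have [s1 h1] := @real_series_tail (fun m => complex.Re ((a m)%:C%C * w ^+ m)) _ _ w0 w1 C0
  (fun m => le_trans (normc_Re _) (hn m)).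
have [s2 h2] := @real_series_tail (fun m => complex.Im ((a m)%:C%C * w ^+ m)) _ _ w0 w1 C0
  (fun m => le_trans (normc_Im _) (hn m)).
exists (s1 +i* s2)%C => K.
apply: le_trans (normc_le_ReIm _) _.
have rP : complex.Re (psum a w K) = \sum_(0 <= m < K) complex.Re ((a m)%:C%C * w ^+ m).
  by rewrite /psum raddf_sum.
have iP : complex.Im (psum a w K) = \sum_(0 <= m < K) complex.Im ((a m)%:C%C * w ^+ m).
  by rewrite /psum raddf_sum.
have -> : (s1 +i* s2)%C - psum a w K =
  ((s1 - \sum_(0 <= m < K) complex.Re ((a m)%:C%C * w ^+ m)) +i*
   (s2 - \sum_(0 <= m < K) complex.Im ((a m)%:C%C * w ^+ m)))%C.
  by apply/eqP; rewrite eq_complex ReD ImD ReN ImN rP iP !eqxx.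
apply: le_trans (lerD (h1 K) (h2 K)) _.
have n1 : 1 - normc w != 0 by rewrite subr_eq0 eq_sym lt_eqF.
by rewrite le_eqVlt; apply/orP; left; apply/eqP; field.
Qed.

Lemma geometric_limit_le rho (u v C : R) : 0 <= rho -> rho < 1 ->
  (forall K : nat, u <= v + C * rho ^+ K) -> u <= v.
Proof.
move=> r0 r1 h.
have h1 : (fun K => v + C * rho ^+ K) K @[K --> \oo] --> v + 0.
  by apply: cvgD; [exact: cvg_cst|apply: cvg_geometric; rewrite ger0_norm].
rewrite -[v]addr0 -(cvg_lim _ h1)//.
apply: limr_ge; first by apply/cvg_ex; eexists; exact: h1.
exact: nearW.
Qed.

Lemma geometric_limit_eq0 rho w C : 0 <= rho -> rho < 1 ->
  (forall K : nat, normc w <= C * rho ^+ K) -> w = 0.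
Proof.
move=> r0 r1 h; apply: normc_eq0; apply/eqP; rewrite eq_le normc_ge0 andbT.
by apply: (geometric_limit_le r0 r1) => K; rewrite add0r; exact: h.
Qed.

Lemma prim_root_exists n : (0 < n)%N -> exists w, n.-primitive_root w.
Proof.
pose p : {poly R[i]} := 'X^n - 1; have [r Dp] := closed_field_poly_normal p.
move=> n_gt0; rewrite (monicP _) ?monicXnsubC// scale1r in Dp.
have rn1 : all n.-unity_root r by apply/allP=> z; rewrite -root_prod_XsubC -Dp.
have sz_r : (n < (size r).+1)%N.
  by rewrite -(size_prod_XsubC r id) -Dp size_XnsubC.
have [|z] := hasP (cyclic.has_prim_root n_gt0 rn1 _ sz_r); last by exists z.
by rewrite -separable.separable_prod_XsubC -Dp cyclotomic.separable_Xn_sub_1// pnatr_eq0 -lt0n.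
Qed.

Lemma sum_prim_root n (w : R[i]) k : n.-primitive_root w ->
  \sum_(j < n) (w ^+ k) ^+ j = if (n %| k)%N then n%:R else 0.
Proof.
move=> hw; case: ifP => hk.
  have -> : w ^+ k = 1 by apply/eqP; rewrite -(prim_order_dvd hw).
  by rewrite (eq_bigr (fun=> 1)) ?sumr_const ?card_ord// => j _; rewrite expr1n.
have h1 : w ^+ k - 1 != 0 by rewrite subr_eq0 -(prim_order_dvd hw) hk.
apply: (mulfI h1); rewrite mulr0 -subrX1 -exprM mulnC exprM (prim_expr_order hw).
by rewrite expr1n subrr.
Qed.

(** Discrete Fourier inversion: [w ^+ (j * (n - m))] stands for the power [- j m], and among the
    indices below [n] only [m] is congruent to [m] modulo [n]. *)
Lemma coef_extract a rho n m (w : R[i]) : n.-primitive_root w -> (m < n)%N ->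
  n%:R * ((a m)%:C%C * rho%:C%C ^+ m) =
  \sum_(j < n) psum a (rho%:C%C * w ^+ j) n * w ^+ (j * (n - m)).
Proof.
move=> hw mn.
have E (j : 'I_n) : psum a (rho%:C%C * w ^+ j) n * w ^+ (j * (n - m)) =
  \sum_(i < n) (a i)%:C%C * rho%:C%C ^+ i * (w ^+ (i + (n - m))) ^+ j.
  rewrite /psum big_mkord mulr_suml; apply: eq_bigr => i _.
  by rewrite exprMn -!exprM mulnDl exprD (mulnC i j) (mulnC j (n - m)%N); ring.
rewrite (eq_bigr _ (fun j _ => E j)) exchange_big /=.
rewrite (bigD1 (Ordinal mn))//= -mulr_sumr sum_prim_root// subnKC ?(ltnW mn)// dvdnn.
rewrite big1 ?addr0; first by rewrite mulrC.
move=> i im; rewrite -mulr_sumr sum_prim_root//.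
case: ifP => [/dvdnP[q hq]|_]; last by rewrite mulr0.
have im' : (nat_of_ord i <> m)%N by move=> Ei; move/eqP: im; apply; apply: val_inj.
have := ltn_ord i; case: q hq => [|[|q]] hq; rewrite ?mulSn in hq; lia.
Qed.

(* Averaging over the roots of unity isolates a single coefficient. *)
Lemma cauchy_estimate a rho C G m : 0 <= rho -> rho < 1 -> 0 <= C ->
  (forall j, `|a j| <= C) ->
  (forall w s, normc w = rho -> is_gensum C a w s -> normc s <= G) ->
  `|a m| * rho ^+ m <= G.
Proof.
move=> r0 r1 C0 ha hG.
pose D := 2 * C / (1 - rho).
have D0 : 0 <= D by rewrite divr_ge0 ?mulr_ge0// subr_ge0 ltW.
suff h n : (m < n)%N -> `|a m| * rho ^+ m <= G + D * rho ^+ n.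
  apply: (geometric_limit_le r0 r1 (C := D)) => K.
  apply: le_trans (h (K + m.+1)%N _) _; first by rewrite addnS ltnS leq_addl.
  rewrite lerD2l ler_wpM2l// exprD ler_piMr ?exprn_ge0//.
  exact: exprn_ile1 r0 (ltW r1).
move=> mn; have n0 : (0 < n)%N by apply: leq_ltn_trans mn.
have [w hw] := prim_root_exists n0.
have nw : normc w = 1.
  apply/eqP; rewrite -(@pexpr_eq1 _ _ n)// ?normc_ge0//.
  by rewrite -normcX (prim_expr_order hw) ComplexField.Normc.normc1.
have hp (j : 'I_n) : normc (psum a (rho%:C%C * w ^+ j) n * w ^+ (j * (n - m))) <= G + D * rho ^+ n.
  rewrite normcM [X in _ * X]normcX nw expr1n mulr1.
  have nr : normc (rho%:C%C * w ^+ j) = rho.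
    by rewrite normcM normcX nw expr1n mulr1 normc_real ger0_norm.
  have [|s hs] := @gensum_exists C a (rho%:C%C * w ^+ j) _ C0 ha; first by rewrite nr.
  have h1 := hG _ _ nr hs; have := hs n; rewrite nr -/D => h2.
  have -> : psum a (rho%:C%C * w ^+ j) n = s - (s - psum a (rho%:C%C * w ^+ j) n).
    by rewrite opprB addrC subrK.
  by apply: le_trans (normcB _ _) _; exact: lerD.
have := congr1 (@normc R) (@coef_extract a rho n m w hw mn).
rewrite normcM normc_nat normcM normc_real normcX normc_real (ger0_norm r0) => E.
have n0' : 0 < n%:R :> R by rewrite ltr0n.
rewrite -(ler_pM2l n0') E; apply: le_trans (normc_sum _ _) _.
apply: le_trans (ler_sum _ (fun j _ => hp j)) _.
by rewrite sumr_const card_ord mulr_natl.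
Qed.

End PowerSeries.

(** * The Green function as generating function of the wave *)

Section GreenFunction.
Variable R : realType.
Variable lambda : R.
Local Notation V := (fib_potential lambda).
Local Notation c := (trace_cst R).

Definition wave_scale : R := (lambda + 4)^-1.
Local Notation b := wave_scale.
Definition fwave : nat -> int -> R := wave V b.

(** The generating function [1 / (1 - x w + w^2)] of [U_m(x / 2)] has its pole at [x = w + 1 / w];
    with [x = b H] this is the point of the resolvent of [H]. *)
Definition spectral_point (w : R[i]) : R[i] := (w + w^-1) / b%:C%C.

Lemma wave_scale_gt0 : 0 <= lambda -> 0 < b.
Proof. by move=> l0; rewrite invr_gt0; lra. Qed.

Lemma fwave_bound m n : 0 <= lambda -> `|fwave m n| <= 2.
Proof.
move=> l0; apply: (@wave_bound _ _ _ lambda) => [||j].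
- exact/ltW/wave_scale_gt0.
- by rewrite mulrC ler_pdivrMr; lra.
- by apply: le_trans (fib_potential_le _ _) _; rewrite ger0_norm.
Qed.

Lemma fwaveSS m n : fwave m.+2 n = b * (fwave m.+1 (n + 1) + fwave m.+1 (n - 1) +
  V n * fwave m.+1 n) - fwave m n.
Proof. by []. Qed.

Lemma fwave1 n : fwave 1 n = b * (fwave 0 (n + 1) + fwave 0 (n - 1) + V n * fwave 0 n).
Proof. by rewrite -[RHS]subr0. Qed.

Section Generating.
Variables (w : R[i]) (uh : int -> R[i]).
Hypothesis l0 : 0 <= lambda.
Hypothesis w1 : normc w < 1.
Hypothesis w0 : w != 0.
Hypothesis huh : forall n, is_gensum 2 (fwave^~ n) w (uh n).

Let D : R := 2 * 2 / (1 - normc w).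

Let P (n : int) K := psum (fwave^~ n) w K.

Lemma gensum_cst_ge0 : 0 <= D.
Proof. by rewrite /D divr_ge0// subr_ge0 ltW. Qed.

(** The truncations at [K + 2], [K + 1] and [K] are staggered so that the relation is exact for
    every [K]. *)
Lemma gensum_identity n K :
  P n K.+2 + w ^+ 2 * P n K - b%:C%C * w * (P (n + 1) K.+1 + P (n - 1) K.+1
     + (V n)%:C%C * P n K.+1) = (n == 1)%:R.
Proof.
have E m : (fwave m.+2 n)%:C%C = b%:C%C * ((fwave m.+1 (n + 1))%:C%C +
   (fwave m.+1 (n - 1))%:C%C + (V n)%:C%C * (fwave m.+1 n)%:C%C) - (fwave m n)%:C%C.
  by rewrite fwaveSS rCB (rCM b) rCD rCD rCM.
have E1 : (fwave 1 n)%:C%C = b%:C%C * ((fwave 0 (n + 1))%:C%C +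
   (fwave 0 (n - 1))%:C%C + (V n)%:C%C * (fwave 0 n)%:C%C).
  by rewrite fwave1 (rCM b) rCD rCD rCM.
have E0 : (fwave 0 n)%:C%C = (n == 1)%:R :> R[i].
  by rewrite /fwave /wave /= rmorph_nat.
rewrite /P; elim: K => [|K IH].
  rewrite !psumS /psum !big_geq// E1 -E0 !expr0 expr1; ring.
rewrite -IH !psumS E !exprS; ring.
Qed.

Lemma gensum_equation n : (1 + w ^+ 2) * uh n
  - b%:C%C * w * (uh (n + 1) + uh (n - 1) + (V n)%:C%C * uh n) = (n == 1)%:R.
Proof.
have D0 := gensum_cst_ge0; have r0 := normc_ge0 w.
apply/eqP; rewrite -subr_eq0; apply/eqP.
apply: (@geometric_limit_eq0 _ (normc w) _ (D * (2 + `|b| * (2 + lambda))) r0 w1) => K.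
rewrite -(gensum_identity n K).
have -> : (1 + w ^+ 2) * uh n - b%:C%C * w * (uh (n + 1) + uh (n - 1) + (V n)%:C%C * uh n)
  - (P n K.+2 + w ^+ 2 * P n K - b%:C%C * w * (P (n + 1) K.+1 + P (n - 1) K.+1
     + (V n)%:C%C * P n K.+1)) =
  ((uh n - P n K.+2) + w ^+ 2 * (uh n - P n K)) - b%:C%C * w *
   ((uh (n + 1) - P (n + 1) K.+1) + (uh (n - 1) - P (n - 1) K.+1)
     + (V n)%:C%C * (uh n - P n K.+1)) by ring.
have rK j : normc w ^+ j <= 1 by apply: exprn_ile1 => //; exact: ltW.
have rK0 : 0 <= normc w ^+ K by exact: exprn_ge0.
have hu m j : normc (uh m - P m (j + K)%N) <= D * normc w ^+ K.
  apply: le_trans (huh m (j + K)) _; rewrite -/D ler_wpM2l// exprD ler_piMl//.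
set e := D * normc w ^+ K in hu.
have e0 : 0 <= e by exact: mulr_ge0.
have hV : `|V n| <= lambda by apply: le_trans (fib_potential_le _ _) _; rewrite ger0_norm.
apply: le_trans (normcB _ _) _.
apply: (@le_trans _ _ ((e + e) + `|b| * (e + e + lambda * e))); last first.
  by rewrite /e le_eqVlt; apply/orP; left; apply/eqP; ring.
apply: lerD.
  apply: le_trans (normcD _ _) _; apply: lerD; first exact: (hu n 2).
  rewrite normcM normcX -[leRHS]mul1r; apply: ler_pM => //; rewrite ?normc_ge0 ?exprn_ge0//.
  exact: (hu n 0).
rewrite 2!normcM normc_real -mulrA ler_wpM2l// -[leRHS]mul1r.
apply: ler_pM => //; rewrite ?normc_ge0//; first exact: ltW.
apply: le_trans (normcD _ _) _; apply: lerD.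
  by apply: le_trans (normcD _ _) _; apply: lerD; [exact: (hu _ 1)|exact: (hu _ 1)].
by rewrite normcM normc_real; apply: ler_pM => //; rewrite ?normc_ge0//; exact: (hu _ 1).
Qed.

Lemma gensum_recurrence n : uh (n + 1) + uh (n - 1) =
  (spectral_point w - (V n)%:C%C) * uh n - (n == 1)%:R / (b%:C%C * w).
Proof.
have b0 : b%:C%C != 0 :> R[i].
  by rewrite -[0](rmorph0 (real_complex R)) (inj_eq (@complexI _)) gt_eqF// wave_scale_gt0.
have <- := gensum_equation n; rewrite /spectral_point; field.
by rewrite b0 w0.
Qed.

Lemma gensum_bound n : normc (uh n) <= D.
Proof. by have := huh n 0; rewrite /psum big_geq// subr0 expr0 mulr1. Qed.

(** The wave spreads one site per step, so the first [|n - 1|] coefficients vanish at [n] and the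
    rate of convergence becomes decay in space. *)
Lemma gensum_decay n : normc (uh n) <= D * normc w ^+ `|(n - 1)%R|%N.
Proof.
have := huh n `|(n - 1)%R|%N; rewrite /psum big_nat big1 ?subr0// => m /andP[_ hm].
by rewrite /fwave (wave_support _ _ hm).1 mul0r.
Qed.

Lemma gensum_vanish (y : nat -> R[i]) (f : nat -> int) :
  (forall j, y j.+1 = uh (f j.+1)) -> (forall j, (j <= `|(f j.+1 - 1)%R|)%N) ->
  forall eps, 0 < eps -> exists M0, forall M, (M0 <= M)%N -> normc (y M) <= eps.
Proof.
move=> hy hf eps e0.
have r0 := normc_ge0 w.
have h1 : (fun K => D * normc w ^+ K) K @[K --> \oo] --> (0 : R).
  by apply: cvg_geometric; rewrite ger0_norm.
have /cvgrPdist_le /(_ _ e0) [M0 _ hM0] := h1.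
exists M0.+1 => -[//|M] hM; rewrite hy; apply: le_trans (gensum_decay _) _.
have h2 : D * normc w ^+ M <= eps.
  by apply: le_trans (hM0 M hM); rewrite sub0r normrN ler_norm.
apply: le_trans h2; apply: ler_wpM2l; first exact: gensum_cst_ge0.
by apply: ler_wiXn2l => //; exact: ltW.
Qed.

Section Block.
Variables (k : nat) (d : R).
Hypothesis k2 : (2 <= k)%N.
Hypothesis d0 : 0 < d.
Hypothesis hd : d <= `|complex.Im (spectral_point w)| \/
  d <= normc (spectral_point w) - (lambda + 2).
Hypothesis wh : 1 / 2 <= normc w.
Let X := normc (htrace lambda (spectral_point w) k.+2).
Hypothesis X0 : 0 < X.
Let C : R := D + 2 / b.

Lemma gensum_cst_le : D <= C.
Proof. by rewrite /C lerDl divr_ge0// ltW// wave_scale_gt0. Qed.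

(** Gordon's argument bounds the solution by [C / X] at the sites [q] and [q + 1]; Green's identity
    started there carries the smallness to all further sites. *)
Lemma one_sided_bound (y : nat -> R[i]) j :
  recurrent (vpot lambda) (spectral_point w) y -> (forall j, normc (y j) <= C) ->
  (forall eps, 0 < eps -> exists M0, forall M, (M0 <= M)%N -> normc (y M) <= eps) ->
  (fibn k.+1 < j)%N -> d * normc (y j) ^+ 2 <= (C / X) ^+ 2.
Proof.
move=> hy hC h0 hj; set q := fibn k.+1 in hj *.
have C0 : 0 <= C := le_trans gensum_cst_ge0 gensum_cst_le.
have hV i : `|vpot lambda i| <= lambda.
  by apply: le_trans (fib_potential_le _ _) _; rewrite ger0_norm.
have [] := gordon_bound hy (fun i => @vpot_square _ lambda k i k2) hC.
rewrite transfer_htrace normcM normc_nat -/X -/q => h1 h2.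
have {}h1 : normc (y q) <= C / X by rewrite ler_pdivlMr//; lra.
have {}h2 : normc (y q.+1) <= C / X by rewrite ler_pdivlMr//; lra.
have hj' : (q + (j - q.+1).+1)%N = j by rewrite addnS -addSn subnKC.
rewrite -hj'.
pose y' i := y (q + i)%N.
have -> : y (q + (j - q.+1).+1)%N = y' (j - q.+1).+1 by [].
apply: (@le_trans _ _ (normc (y' 1%N) * normc (y' 0%N))).
  apply: (@half_line_decay _ (fun i => vpot lambda (q + i)%N) (spectral_point w) y' lambda _ _ d C) => //.
  - by move=> i; rewrite /y' !addnS hy.
  - by move=> i; exact: hC.
  - move=> eps e0; have [M0 hM0] := h0 _ e0; exists M0 => M hM; apply: hM0.
    by rewrite (leq_trans hM)// leq_addl.
rewrite /y' addn0 addn1 expr2; apply: ler_pM => //; exact: normc_ge0.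
Qed.

Lemma gensum_outside n : ((fibn k.+1).+1 < `|n|)%N ->
  d * normc (uh n) ^+ 2 <= (C / X) ^+ 2.
Proof.
move=> hn.
have DC := gensum_cst_le.
case: (lerP 0 n) => n0.
(* The source at 1 is absorbed into the value at 0, so that [y] solves the homogeneous recurrence.
   As [|w| >= 1 / 2], this costs the summand [2 / b] of [C]. *)
- pose y j := if j is j'.+1 then uh j%:Z else uh 0 + 1 / (b%:C%C * w).
  have -> : uh n = y `|n|%N.
    by case: n hn n0 => // -[//|m] hn n0.
  apply: one_sided_bound; last exact: ltnW.
  + case=> [|j]; rewrite /y /vpot.
      have := gensum_recurrence 1; rewrite addrN eqxx => E.
      have {}E : uh 2 = (spectral_point w - (V 1)%:C%C) * uh 1
          - 1 / (b%:C%C * w) - uh 0 by rewrite -[LHS](addrK (uh 0)) E.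
      by rewrite E; ring.
    have := gensum_recurrence j.+2%:Z; rewrite (_ : (_ == 1) = false); last by clear; lia.
    rewrite (_ : j.+2%:Z + 1 = j.+3%:Z); last by clear; lia.
    rewrite (_ : j.+2%:Z - 1 = j.+1%:Z); last by clear; lia.
    rewrite mul0r subr0 => <-; ring.
  + case=> [|j]; rewrite /y; last exact: le_trans (gensum_bound _) DC.
    apply: le_trans (normcD _ _) _; apply: lerD; first exact: gensum_bound.
    rewrite mul1r ComplexField.Normc.normcV normcM normc_real.
    have b0 := wave_scale_gt0 l0; rewrite gtr0_norm//.
    have wh' := wh; have w0' : 0 < normc w by lra.
    rewrite ler_pdivlMr// invfM mulrAC mulVf ?gt_eqF// mul1r.
    by rewrite invf_ple ?posrE//; lra.
  + apply: (gensum_vanish (f := fun j => j%:Z)) => j //; clear; lia.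
(* Reflection sends [- 1 - j] to [j]. The index of [n] is then [|n| - 1], hence the extra site in
   the hypothesis on [n]. *)
- pose y (j : nat) := uh (- 1 - j%:Z).
  have -> : uh n = y (`|n|.-1)%N by rewrite /y; congr uh; clear -n0 hn; lia.
  apply: one_sided_bound; last by clear -hn; lia.
  + move=> j; rewrite /y /vpot.
    have := gensum_recurrence (- 1 - j.+1%:Z); rewrite (_ : (_ == 1) = false); last by clear; lia.
    rewrite fib_potential_reflect; last by clear; lia.
    rewrite (_ : - 1 - j.+1%:Z + 1 = - 1 - j%:Z); last by clear; lia.
    rewrite (_ : - 1 - j.+1%:Z - 1 = - 1 - j.+2%:Z); last by clear; lia.
    rewrite mul0r subr0 => <-; ring.
  + by move=> j; exact: le_trans (gensum_bound _) DC.
  + apply: (gensum_vanish (f := fun j => - 1 - j%:Z)) => j //; clear; lia.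
Qed.

End Block.
End Generating.

(** If [|z| <= lambda + 2 c], then [|w + 1 / w| <= 1] because [1 / b = lambda + 4]. This forces
    [|Re w| <= rho / 2], hence [|Im w| >= rho / 2], and [Im z] is
    [(lambda + 4) (1 - rho^-2) Im w]. *)
Lemma spectral_point_far (w : R[i]) (rho : R) : 0 <= lambda ->
  1 / 2 <= rho -> rho < 1 -> normc w = rho ->
  lambda + 2 * c < normc (spectral_point w) \/
  1 - rho <= `|complex.Im (spectral_point w)|.
Proof.
move=> l0 r1 r2 wr.
case: (ltP (lambda + 2 * c) (normc (spectral_point w))) => h; [by left|right].
have b0 := wave_scale_gt0 l0.
have bi : b^-1 = lambda + 4 by rewrite /wave_scale invrK.
set v := w + w^-1.
have bz : spectral_point w = (lambda + 4)%:C%C * v by rewrite -bi (rCV b) mulrC.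
have l4 : `|lambda + 4| = lambda + 4 by apply: ger0_norm; lra.
have nv : normc v <= 1.
  move: h; rewrite bz normcM normc_real l4 => h.
  rewrite -(ler_pM2l (_ : 0 < lambda + 4)); last by lra.
  by apply: le_trans h _; rewrite /trace_cst; lra.
have w2 : complex.Re w ^+ 2 + complex.Im w ^+ 2 = rho ^+ 2 by rewrite -sqr_normcE wr.
have r20 : 0 < rho ^+ 2 by rewrite exprn_gt0//; lra.
have [vR vI] : complex.Re v = complex.Re w * (1 + rho ^- 2) /\
    complex.Im v = complex.Im w * (1 - rho ^- 2).
  by rewrite /v; move: w2; case: w {wr h v bz nv} => x y /= ->; split; ring.
have rv := le_trans (normc_Re v) nv.
set t := rho ^- 2 in vR vI.
have t1 : rho ^+ 2 * t = 1 by rewrite mulfV// gt_eqF.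
have tg : 1 < t by move: r2 r1 r20 t1; nra.
have hx : `|complex.Re w| <= rho / 2.
  move: rv; rewrite vR normrM (@ger0_norm _ (1 + t)); last by lra.
  have h2 : 1 <= rho / 2 * (1 + t).
    have : 0 <= (rho - 1) ^+ 2 by exact: sqr_ge0.
    have rt : rho * t * rho = 1 by rewrite -t1; ring.
    have : 0 < rho * t by rewrite mulr_gt0//; lra.
    nra.
  move=> h3; rewrite -(ler_pM2r (_ : 0 < 1 + t)); [exact: le_trans h3 h2|lra].
have hy : rho / 2 <= `|complex.Im w|.
  apply: le_of_sqr => //; rewrite real_normK ?num_real//.
  have : complex.Re w ^+ 2 <= (rho / 2) ^+ 2.
    by rewrite -[complex.Re w ^+ 2]real_normK ?num_real//; have := normr_ge0 (complex.Re w); nra.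
  by move: w2; nra.
rewrite bz ImM /= mul0r addr0 normrM l4 vI normrM.
rewrite (@ler0_norm _ (1 - t)); last by lra.
have h4 : rho / 2 * (t - 1) <= `|complex.Im w| * - (1 - t).
  by rewrite opprB ler_wpM2r//; lra.
have h5 : 1 - rho <= rho * (t - 1).
  have -> : rho * (t - 1) = (1 - rho) * (1 + rho) * (rho * t).
    rewrite -[X in _ = X * _]/((1 - rho) * (1 + rho)).
    have -> : (1 - rho) * (1 + rho) * (rho * t) = rho * t - rho * (rho ^+ 2 * t) by ring.
    by rewrite t1; ring.
  have rt : rho * t * rho = 1 by rewrite -t1; ring.
  have : 1 <= rho * t by nra.
  have : 0 <= (1 - rho) * rho by apply: mulr_ge0; lra.
  nra.
nra.
Qed.

Lemma wave_outside_bound (rho : R) (N l k : nat) m n :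
  1129 / 100 <= lambda -> 1 / 2 <= rho -> rho < 1 ->
  2 * c < rate lambda ^+ N * (1 - rho) -> (2 <= k)%N -> (N.*2 + l <= k.+1)%N ->
  ((fibn k.+1).+1 < `|n|)%N ->
  (`|fwave m n| * rho ^+ m) ^+ 2 <=
    ((4 / (1 - rho) + 2 / b) / c ^+ fibn l) ^+ 2 * (50 / (1 - rho)).
Proof.
move=> hl r1 r2 hN k2 hk hn.
have l0 : 0 <= lambda by lra.
have rho0 : 0 <= rho by lra.
have cE : c = 101 / 100 by [].
have c0 : 0 < c by rewrite cE; lra.
have b0 := wave_scale_gt0 l0.
set B := (_ + _) / _.
have C0 : 0 <= 4 / (1 - rho) + 2 / b.
  by rewrite addr_ge0// divr_ge0// ?(ltW b0)//; lra.
have B0 : 0 <= B by rewrite divr_ge0// exprn_ge0// ltW.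
pose G := Num.sqrt (B ^+ 2 * (50 / (1 - rho))).
have E0 : 0 <= B ^+ 2 * (50 / (1 - rho)).
  by rewrite mulr_ge0 ?sqr_ge0// divr_ge0//; lra.
suff h : `|fwave m n| * rho ^+ m <= G.
  rewrite -(sqr_sqrtr E0) ler_sqr ?nnegrE ?sqrtr_ge0//.
  by rewrite mulr_ge0// exprn_ge0.
apply: (@cauchy_estimate R (fun j => fwave j n) rho 2 G m rho0 r2) => // [j|w s hw hs].
  exact: fwave_bound.
have w1 : normc w < 1 by rewrite hw.
have w0 : w != 0.
  by apply/eqP => E; move: hw; rewrite E ComplexField.Normc.normc0; lra.
have hex j : exists s, is_gensum 2 (fwave^~ j) w s.
  by apply: gensum_exists => // i; exact: fwave_bound.
have [uh0 huh0] := choice hex.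
(* Cauchy's estimate supplies an arbitrary sum [s] at [n]; chosen sums at the other sites complete
   it to a function on all of Z. *)
pose uh j := if j == n then s else uh0 j.
have huh j : is_gensum 2 (fwave^~ j) w (uh j).
  by rewrite /uh; case: eqP => [->|_].
have -> : s = uh n by rewrite /uh eqxx.
have far := spectral_point_far l0 r1 r2 hw.
have [j hj ej] : exists2 j, (j <= N.*2)%N & escapes lambda (spectral_point w) j.
  apply: escape_time => //; case: far => h; [by right|left].
  apply: lt_le_trans hN _; rewrite ler_wpM2l// exprn_ge0// /rate; lra.
have hX : c ^+ fibn l <= normc (htrace lambda (spectral_point w) k.+2).
  have jk : (j <= k.+1)%N by rewrite (leq_trans hj)// (leq_trans (leq_addr l _)).
  rewrite -(subnKC jk).
  apply: le_trans (escape_growth _ ej); apply: ler_weXn2l; first by rewrite cE; lra.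
  by apply: fibn_homo; rewrite leq_subRL// (leq_trans _ hk)// leq_add2r.
have X0 : 0 < normc (htrace lambda (spectral_point w) k.+2).
  by apply: lt_le_trans hX; rewrite exprn_gt0.
(* [1 / 50] is [2 * c - 2], by which a point beyond [lambda + 2 * c] exceeds the bound [lambda + 2]
   on the spectrum. *)
pose d := (1 - rho) / 50.
have d0 : 0 < d by rewrite divr_gt0// subr_gt0.
have hd : d <= `|complex.Im (spectral_point w)| \/
  d <= normc (spectral_point w) - (lambda + 2).
  by rewrite /d; case: far => h; [right|left]; move: h; rewrite ?cE; clear -lambda r1 r2; lra.
have wh : 1 / 2 <= normc w by rewrite hw.
have := gensum_outside l0 w1 w0 huh k2 d0 hd wh X0 hn; rewrite hw => H.
apply: le_of_sqr; first exact: sqrtr_ge0.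
rewrite sqr_sqrtr//.
have -> : 50 / (1 - rho) = d^-1 by rewrite /d invf_div.
rewrite ler_pdivlMr// mulrC; apply: le_trans H _.
rewrite ler_sqr ?nnegrE//.
  rewrite /B (_ : 2 * 2 = 4 :> R); last by ring.
  by apply: ler_pM => //; rewrite ?invr_ge0 ?(ltW X0)// lef_pV2 ?posrE// exprn_gt0.
by rewrite divr_ge0 ?(ltW X0)// (_ : 2 * 2 = 4 :> R)//; ring.
Qed.

End GreenFunction.

(** * Chebyshev expansion of the evolution *)

Section PathCounts.
Variable R : realType.

(* Number of k-step paths from 0 to m in the half line. *)
Fixpoint paths (k m : nat) : R :=
  if k is k'.+1 then paths k' m.+1 + (if m is m'.+1 then paths k' m' else 0)
  else (m == 0%N)%:R.

Lemma paths_gt k m : (k < m)%N -> paths k m = 0.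
Proof.
elim: k m => [|k IH] [|m]//= km.
by rewrite !IH ?addr0// ltnW// ltnW.
Qed.

Lemma paths_ge0 k m : 0 <= paths k m.
Proof. by elim: k m => [|k IH] [|m] //=; rewrite addr_ge0. Qed.

Lemma paths_le k m : paths k m <= 2 ^+ k.
Proof.
elim: k m => [|k IH] m; first by rewrite expr0 /=; case: eqP.
rewrite exprS mulrDl mul1r; by apply: lerD => //; case: m.
Qed.

(** Symmetry of the adjacency matrix of the half line: one step moves from one factor to the
    other. *)
Lemma paths_swap j k N : (j < N)%N -> (k < N)%N ->
  \sum_(m < N) paths j.+1 m * paths k m = \sum_(m < N) paths j m * paths k.+1 m.
Proof.
case: N => // N jN kN.
rewrite (eq_bigr (fun m : 'I_N.+1 => paths j m.+1 * paths k m +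
   (if (m : nat) is m'.+1 then paths j m' else 0) * paths k m)); last first.
  by move=> m _; rewrite -mulrDl.
rewrite [RHS](eq_bigr (fun m : 'I_N.+1 => paths j m * paths k m.+1 +
   paths j m * (if (m : nat) is m'.+1 then paths k m' else 0))); last first.
  by move=> m _; rewrite -mulrDr.
rewrite !big_split /= [RHS]addrC; congr (_ + _).
  rewrite big_ord_recr /= (paths_gt jN) mul0r addr0.
  by rewrite [RHS]big_ord_recl /= mulr0 add0r.
rewrite big_ord_recl /= mul0r add0r.
by rewrite [RHS]big_ord_recr /= (paths_gt kN) mulr0 addr0.
Qed.

Lemma paths_dot j k N : (j + k < N)%N ->
  \sum_(m < N) paths j m * paths k m = paths (j + k) 0.
Proof.
elim: j k => [|j IH] k hN.
  case: N hN => // N hN; rewrite big_ord_recl /= mul1r big1 ?addr0// => m _.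
  by rewrite mul0r.
rewrite paths_swap; [|lia|lia].
by rewrite IH ?addnS// -addSnnS.
Qed.

End PathCounts.

Section ExponentialCoefficients.
Variable R : realType.
Implicit Types (s : R[i]) (tau : R).

Definition ecoef s (k : nat) : R[i] := s ^+ k / k`!%:R.

Lemma fact_neq0 k : (k`!%:R : R[i]) != 0.
Proof. by rewrite pnatr_eq0 -lt0n fact_gt0. Qed.

Lemma normc_ecoef s k : normc (ecoef s k) = normc s ^+ k / k`!%:R.
Proof. by rewrite /ecoef normcM normcX ComplexField.Normc.normcV normc_nat. Qed.

Lemma conjM (x y : R[i]) : conjc (x * y) = conjc x * conjc y.
Proof. by rewrite rmorphM. Qed.

Lemma conj_rc (a : R) : conjc a%:C%C = a%:C%C.
Proof. exact: conjc_real. Qed.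

Lemma conj_ecoef s k : conjc s = - s -> conjc (ecoef s k) = ecoef (- s) k.
Proof.
move=> hs; rewrite /ecoef conjM -[in RHS]hs; congr (_ * _).
  by elim: k => [|k IH]; [rewrite !expr0 conjc1|rewrite !exprS conjM IH].
by rewrite -(rmorph_nat (real_complex R)) -rCV conj_rc.
Qed.

Lemma ecoef_convolution s n : \sum_(j < n.+1) ecoef (- s) j * ecoef s (n - j) = (n == 0%N)%:R.
Proof.
apply: (mulfI (fact_neq0 n)).
transitivity ((s + - s) ^+ n).
  rewrite exprDn mulr_sumr; apply: eq_bigr => j _.
  have jn : (j <= n)%N by rewrite -ltnS.
  rewrite /ecoef -mulr_natr -(bin_fact jn) !natrM.
  have h1 := fact_neq0 j; have h2 := fact_neq0 (n - j).
  by field; rewrite h1 h2.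
by rewrite subrr expr0n; case: n => [|n]; rewrite /= ?mulr1 ?mulr0.
Qed.

Lemma triangle_sum (V : nmodType) (g : nat -> nat -> V) N :
  \sum_(j < N) \sum_(k < N - j) g j k = \sum_(n < N) \sum_(j < n.+1) g j (n - j)%N.
Proof.
elim: N => [|N IH]; first by rewrite !big_ord0.
rewrite [RHS]big_ord_recr /= -IH.
rewrite (eq_bigr (fun j : 'I_N.+1 => \sum_(k < N - j) g j k + g j (N - j)%N)).
  by rewrite big_split /= big_ord_recr /= subnn big_ord0 addr0.
by move=> j _; rewrite subSn -1?ltnS// big_ord_recr.
Qed.

Lemma sum_exp_coeff_le (y : R) N : 0 <= y -> \sum_(k < N) y ^+ k / k`!%:R <= expR y.
Proof.
move=> y0; have -> : \sum_(k < N) y ^+ k / k`!%:R = series (exp_coeff y) N.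
  by rewrite /series /= big_mkord.
apply: nondecreasing_cvgn_le; last exact: is_cvg_series_exp_coeff.
by apply/nondecreasing_seqP => n; rewrite /series/= big_nat_recr//= lerDl exp_coeff_ge0.
Qed.

(* Coefficient of U_m(x / 2) in the exponential series of [s x] truncated at
   order N. *)
Definition cheb_coef s N m : R[i] := \sum_(k < N) ecoef s k * (paths R k m)%:C%C.

Lemma normc_real_ge0 (x : R) : 0 <= x -> normc x%:C%C = x.
Proof. by move=> x0; rewrite normc_real ger0_norm. Qed.

(** Only [k >= m] contributes, where a factor [4 ^ (k - m) >= 1] can be inserted. Together with
    [paths k m <= 2 ^ k] it gives the exponential series of [8 |s|]. *)
Lemma cheb_coef_tail s N m :
  normc (cheb_coef s N m) <= 4 ^- m * expR (8 * normc s).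
Proof.
have s0 := normc_ge0 s.
apply: le_trans (normc_sum _ _) _.
apply: (@le_trans _ _ (\sum_(k < N) 4 ^- m * ((8 * normc s) ^+ k / k`!%:R))); last first.
  by rewrite -mulr_sumr ler_wpM2l ?invr_ge0 ?exprn_ge0// sum_exp_coeff_le// mulr_ge0.
apply: ler_sum => k _.
rewrite normcM normc_ecoef normc_real_ge0 ?paths_ge0//.
have f0 : 0 <= (k`!%:R : R)^-1 by rewrite invr_ge0.
case: (ltnP k m) => km.
  by rewrite paths_gt// mulr0 !mulr_ge0 ?invr_ge0 ?exprn_ge0// mulr_ge0.
have h4 : 1 <= 4 ^- m * 4 ^+ k :> R.
  by rewrite ler_pdivlMl ?exprn_gt0// mulr1 ler_weXn2l// ler1n.
have -> : 4 ^- m * ((8 * normc s) ^+ k / k`!%:R) =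
    (normc s ^+ k / k`!%:R) * (2 ^+ k * (4 ^- m * 4 ^+ k)) :> R.
  rewrite (_ : 8 = 2 * 4); last by rewrite -natrM.
  by rewrite !exprMn; ring.
apply: ler_wpM2l; first by rewrite mulr_ge0// exprn_ge0.
apply: le_trans (paths_le R k m) _; rewrite ler_peMr// exprn_ge0//.
Qed.

(** A coefficient is an entry of the unitary [exp (s J)], [J] the adjacency matrix of the half line,
    up to truncation. In the sum of squares over [m], expanded over pairs [(j, k)], the pairs with
    [j + k < N] give exactly 1 because [exp (- s) exp s = 1]; on the others
    [2 ^ (j + k) <= 2 ^- N * 4 ^ (j + k)]. *)
Lemma cheb_coef_normsq s N m : (0 < N)%N -> conjc s = - s ->
  normc (cheb_coef s N m) ^+ 2 <= 1 + 2 ^- N * expR (8 * normc s).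
Proof.
move=> N0 hs; have s0 := normc_ge0 s.
pose M := (N + N + m).+1.
pose g j k := ecoef (- s) j * ecoef s k * (paths R (j + k) 0)%:C%C.
have conj_coef m' : conjc (cheb_coef s N m') = \sum_(j < N) ecoef (- s) j * (paths R j m')%:C%C.
  rewrite /cheb_coef raddf_sum /=; apply: eq_bigr => j _.
  by rewrite conjM conj_ecoef// conj_rc.
have sumE : (\sum_(m' < M) normc (cheb_coef s N m') ^+ 2)%:C%C =
    \sum_(j < N) \sum_(k < N) g j k.
  rewrite raddf_sum /= (eq_bigr (fun m' : 'I_M => \sum_(j < N) \sum_(k < N)
     ecoef (- s) j * ecoef s k * (paths R j m' * paths R k m')%:C%C)); last first.
    move=> m' _; rewrite -conj_mul_norm conj_coef mulr_suml; apply: eq_bigr => j _.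
    by rewrite /cheb_coef mulr_sumr; apply: eq_bigr => k _; rewrite rCM; ring.
  rewrite exchange_big /=; apply: eq_bigr => j _.
  rewrite exchange_big /=; apply: eq_bigr => k _.
  rewrite -mulr_sumr -raddf_sum /= paths_dot// /M.
  by have := ltn_ord j; have := ltn_ord k; lia.
pose y := 4 * normc s.
pose h j k : R := 2 ^- N * ((y ^+ j / j`!%:R) * (y ^+ k / k`!%:R)).
have y0 : 0 <= y by rewrite mulr_ge0.
have fi0 j : 0 <= (j`!%:R : R)^-1 by rewrite invr_ge0.
have h0 j k : 0 <= h j k.
  by rewrite /h !mulr_ge0 ?invr_ge0 ?exprn_ge0// mulr_ge0.
have gh j k : (N <= j + k)%N -> normc (g j k) <= h j k.
  move=> hjk; rewrite /g 2!normcM !normc_ecoef normcN normc_real_ge0 ?paths_ge0//.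
  have -> : h j k = (normc s ^+ j / j`!%:R * (normc s ^+ k / k`!%:R)) * (2 ^- N * 4 ^+ (j + k)).
    by rewrite /h /y !exprMn exprD; ring.
  apply: ler_wpM2l; first by rewrite !mulr_ge0 ?invr_ge0 ?exprn_ge0// mulr_ge0.
  apply: le_trans (paths_le _ _ _) _.
  rewrite ler_pdivlMl ?exprn_gt0// (_ : 4 = 2 * 2); last by rewrite -natrM.
  by rewrite exprMn ler_wpM2r ?exprn_ge0// ler_weXn2l// ler1n.
have tri : \sum_(j < N) \sum_(k < N - j) g j k = 1.
  rewrite triangle_sum (eq_bigr (fun n : 'I_N => (n == 0%N :> nat)%:R)).
    case: N N0 {M g sumE h h0 gh conj_coef} => // N _.
    by rewrite big_ord_recl /= big1 ?addr0.
  move=> n _; rewrite /g (eq_bigr (fun j : 'I_n.+1 =>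
    ecoef (- s) j * ecoef s (n - j) * (paths R n 0)%:C%C)).
    rewrite -mulr_suml ecoef_convolution; case: (nat_of_ord n) => [|n'].
      by rewrite /= mulr1n mul1r.
    by rewrite /= mul0r.
  by move=> j _; rewrite subnKC// -ltnS.
have split_sum : \sum_(j < N) \sum_(k < N) g j k =
    1 + \sum_(j < N) \sum_(N - j <= k < N) g j k.
  rewrite -tri -big_split /=; apply: eq_bigr => j _.
  rewrite -[LHS](big_mkord xpredT (g j)) (@big_cat_nat _ _ _ (N - j)) ?leq_subr//=.
  by rewrite big_mkord.
have rem : normc (\sum_(j < N) \sum_(N - j <= k < N) g j k) <= 2 ^- N * expR (8 * normc s).
  apply: le_trans (normc_sum _ _) _.
  apply: (@le_trans _ _ (\sum_(j < N) \sum_(k < N) h j k)).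
    apply: ler_sum => j _; apply: le_trans (normc_sum _ _) _.
    apply: (@le_trans _ _ (\sum_(N - j <= k < N) h j k)).
      rewrite big_nat [leRHS]big_nat; apply: ler_sum => k /andP[hk _]; apply: gh; lia.
    rewrite -[leRHS](big_mkord xpredT (h j)) [leRHS](@big_cat_nat _ _ _ (N - j)) ?leq_subr//=.
    by rewrite lerDr sumr_ge0.
  rewrite /h (eq_bigr (fun j : 'I_N => 2 ^- N * ((y ^+ j / j`!%:R) * \sum_(k < N) y ^+ k / k`!%:R))).
    rewrite -mulr_sumr -mulr_suml ler_wpM2l ?invr_ge0 ?exprn_ge0//.
    have -> : 8 * normc s = y + y by rewrite /y; ring.
    have yN : 0 <= \sum_(k < N) y ^+ k / k`!%:R.
      by apply: sumr_ge0 => k _; rewrite mulr_ge0// exprn_ge0.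
    by rewrite expRD; apply: ler_pM => //; exact: sum_exp_coeff_le.
  by move=> j _; rewrite !mulr_sumr.
have hm : (m < M)%N by rewrite /M ltnS leq_addl.
apply: (@le_trans _ _ (\sum_(m' < M) normc (cheb_coef s N m') ^+ 2)).
  by rewrite (bigD1 (Ordinal hm))//= lerDl sumr_ge0// => i _; rewrite sqr_ge0.
rewrite -[leLHS]normc_real_ge0; last by apply: sumr_ge0 => i _; rewrite sqr_ge0.
rewrite sumE split_sum; apply: le_trans (normcD _ _) _.
by rewrite ComplexField.Normc.normc1 lerD2l.
Qed.

End ExponentialCoefficients.

Section EvolutionExpansion.
Variable R : realType.
Variable lambda : R.
Local Notation V := (fib_potential lambda).
Local Notation b := (wave_scale lambda).
Local Notation fw := (fwave lambda).

Lemma fib_hamiltonian_real (f : int -> R) :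
  fib_hamiltonian lambda (fun n => (f n)%:C%C) = (fun n => (rham V f n)%:C%C).
Proof. by apply/funext => n; rewrite /fib_hamiltonian /rham !rCD rCM. Qed.

Lemma iter_hamiltonian k : iter k (fib_hamiltonian lambda) (delta R 1) =
  (fun n => (iter k (rham V) (fun n => (n == 1)%:R) n)%:C%C).
Proof.
elim: k => [|k IH]; last by rewrite !iterS IH fib_hamiltonian_real.
by apply/funext => n; rewrite /= /delta rmorph_nat.
Qed.

Lemma rham_sum (I : Type) (r : seq I) (a : I -> R) (f : I -> int -> R) n :
  rham V (fun n => \sum_(i <- r) a i * f i n) n = \sum_(i <- r) a i * rham V (f i) n.
Proof.
rewrite /rham mulr_sumr -!big_split /=; apply: eq_bigr => i _; ring.
Qed.

Lemma rham_fwave m n : b != 0 ->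
  rham V (fw m) n = b^-1 * (fw m.+1 n + (if m is m'.+1 then fw m' n else 0)).
Proof.
move=> b0; case: m => [|m].
  by rewrite addr0 fwave1 mulKf.
by rewrite fwaveSS subrK mulKf.
Qed.

(** Since [b H u_m = u_(m+1) + u_(m-1)], the operator [b H] acts on the index of the wave as a step
    on the half line. *)
Lemma iter_rham_paths k K n : b != 0 -> (k < K)%N ->
  iter k (rham V) (fun n => (n == 1)%:R) n =
  b ^- k * \sum_(0 <= m < K) paths R k m * fw m n.
Proof.
move=> b0; elim: k K n => [|k IH] K n kK.
  rewrite expr0 invr1 mul1r; case: K kK => // K _.
  rewrite big_nat_recl//= mul1r big1 ?addr0// => m _; by rewrite mul0r.
have E : iter k (rham V) (fun n => (n == 1)%:R) =
    (fun n => \sum_(0 <= m < K) (b ^- k * paths R k m) * fw m n).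
  apply/funext => j; rewrite (IH K j (ltnW kK)) mulr_sumr.
  by apply: eq_bigr => m _; rewrite mulrA.
rewrite iterS E rham_sum.
under eq_bigr do rewrite rham_fwave//.
rewrite (eq_bigr (fun m => b ^- k.+1 * (paths R k m * fw m.+1 n +
   paths R k m * (if m is m'.+1 then fw m' n else 0)))); last first.
  by move=> m _; rewrite exprS invfM; case: m => [|m]; ring.
rewrite -mulr_sumr; congr (_ * _).
case: K kK {E} => // K kK; rewrite big_split /=.
rewrite big_nat_recr//= (@paths_gt _ k K) ?mul0r ?addr0//.
rewrite [X in _ + X]big_nat_recl//= mulr0 add0r.
rewrite [RHS](eq_bigr (fun m => paths R k m.+1 * fw m n +
   (if m is m'.+1 then paths R k m' else 0) * fw m n)); last first.
  by move=> m _; rewrite mulrDl.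
rewrite big_split /= addrC; congr (_ + _).
  by rewrite [RHS]big_nat_recr//= (@paths_gt _ k K.+1) ?mul0r ?addr0// ltnW.
by rewrite [RHS]big_nat_recl//= mul0r add0r.
Qed.

Lemma exp_partial_expansion (z : R[i]) N n : b != 0 ->
  exp_partial (fib_hamiltonian lambda) z N (delta R 1) n =
  \sum_(0 <= m < N) cheb_coef (z / b%:C%C) N m * (fw m n)%:C%C.
Proof.
move=> b0; rewrite /exp_partial /cheb_coef.
transitivity (\sum_(0 <= k < N) \sum_(0 <= m < N)
   ecoef (z / b%:C%C) k * (paths R k m)%:C%C * (fw m n)%:C%C).
  rewrite !big_nat; apply: eq_bigr => k /andP[_ kN].
  rewrite iter_hamiltonian (iter_rham_paths _ b0 kN) rCM raddf_sum /= !mulr_sumr.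
  apply: eq_bigr => m _; rewrite rCM /ecoef exprMn rCV rmorphXn /= exprVn; ring.
rewrite exchange_big /=; apply: eq_bigr => m _.
by rewrite big_mkord mulr_suml.
Qed.

Lemma exp_op_bound A (z : R[i]) psi phi n (G : R) N0 :
  is_exp_op A z psi phi ->
  (forall N, (N0 <= N)%N -> normc (exp_partial A z N psi n) <= G) ->
  normc (phi n) <= G.
Proof.
move=> [_ h] hG; apply/ler_addgt0Pr => e e0.
have e2 : 0 < e ^+ 2 by rewrite exprn_gt0.
have h1 : \forall N \near \oo, (l2normsq (fun n => (exp_partial A z N psi n - phi n)%R) < (e ^+ 2)%:E)%E.
  apply: (h [set x | (x < (e ^+ 2)%:E)%E]); apply: open_nbhs_nbhs; split.
    exact: open_ereal_lt_ereal.
  by rewrite /= lte_fin.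
have [N1 _ hN1] := h1.
pose N := maxn N0 N1.
have hN := hN1 N (leq_maxr _ _).
have h2 : normc (exp_partial A z N psi n - phi n) <= e.
  apply: le_of_sqr; first exact: ltW.
  have /l2normsq_leP/(_ [:: n] isT) := ltW hN.
  by rewrite big_seq1.
have -> : phi n = exp_partial A z N psi n - (exp_partial A z N psi n - phi n).
  by rewrite opprB addrC subrK.
apply: le_trans (normcB _ _) _; apply: lerD => //.
by apply: hG; rewrite leq_maxl.
Qed.

Lemma geometric_four_le M0 N :
  \sum_(M0 <= m < N) (4 : R) ^- m <= 2 * 4 ^- M0.
Proof.
case: (leqP N M0) => h; first by rewrite big_geq// mulr_ge0// invr_ge0 exprn_ge0.
have := @geometric_tail_le R 4^-1 M0 (N - M0); rewrite subnKC ?(ltnW h)//.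
rewrite (eq_bigr (fun m => (4 : R) ^- m)); last by move=> m _; rewrite exprVn.
have q0 : 0 <= 4^-1 :> R by rewrite invr_ge0.
have q1 : 4^-1 < 1 :> R by lra.
move=> /(_ q0 q1) H; apply: le_trans H _.
have -> : (1 - 4^-1)^-1 = 4 / 3 :> R by field.
by rewrite exprVn mulrC ler_wpM2r ?invr_ge0 ?exprn_ge0//; lra.
Qed.

(** The expansion is cut at [M0]: below it coefficients of modulus at most 2 meet [G], above it the
    tail bound on coefficients meets the uniform bound 2 on the wave. *)
Lemma evolution_bound (t G : R) n M0 : 0 <= lambda -> 0 <= t -> 0 <= G ->
  (forall m, (m < M0)%N -> `|fw m n| <= G) ->
  normc (evolution lambda t (delta R 1) n) <=
    2 * M0%:R * G + 4 * 4 ^- M0 * expR (8 * (t / b)).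
Proof.
move=> l0 t0 G0 hG.
have b0 := wave_scale_gt0 l0.
have bn : b != 0 by rewrite gt_eqF.
set tau := t / b; have tau0 : 0 <= tau by rewrite divr_ge0// ltW.
pose s : R[i] := - 'i%C * t%:C%C / b%:C%C.
have sE : s = (0 -i* tau)%C.
  rewrite /s -mulrA -rCV -rCM -/tau; apply/eqP; rewrite eq_complex /=.
  by apply/andP; split; apply/eqP; ring.
have hs : conjc s = - s by rewrite sE; apply/eqP; rewrite eq_complex /= oppr0 !eqxx.
have ns : normc s = tau.
  by rewrite sE /= expr0n add0r sqrrN sqrtr_sqr ger0_norm.
(* From this truncation order on, the error term of [cheb_coef_normsq] is at most 1. *)
have [N0 hN0] : exists N0 : nat, expR (8 * tau) <= 2 ^+ N0.
  exists (Num.truncn (expR (8 * tau))).+1.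
  have h1 := @truncnS_gt R (expR (8 * tau)).
  apply: le_trans (ltW h1) _; rewrite -natrX ler_nat ltnW// ltn_expl//.
apply: (@exp_op_bound _ _ _ _ _ _ N0.+1 (@evolutionP R lambda t _ (@delta_ell2 R 1))) => N hN.
have N_gt0 : (0 < N)%N by apply: leq_trans hN.
rewrite exp_partial_expansion// -/s.
have c2 m : normc (cheb_coef s N m) <= 2.
  apply: le_of_sqr => //; apply: le_trans (cheb_coef_normsq m N_gt0 hs) _.
  have : 2 ^- N * expR (8 * normc s) <= 1.
    rewrite ns ler_pdivrMl ?exprn_gt0// mulr1 (le_trans hN0)// ler_weXn2l ?ler1n//.
    exact: ltnW.
  by rewrite expr2; lra.
have term m : normc (cheb_coef s N m * (fw m n)%:C%C) = normc (cheb_coef s N m) * `|fw m n|.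
  by rewrite normcM normc_real.
have h1 : normc (\sum_(0 <= m < minn M0 N) cheb_coef s N m * (fw m n)%:C%C) <= 2 * M0%:R * G.
  apply: le_trans (normc_sum _ _) _.
  apply: (@le_trans _ _ (\sum_(0 <= m < minn M0 N) 2 * G)).
    rewrite !big_nat; apply: ler_sum => m /andP[_ hm]; rewrite term.
    apply: ler_pM => //; first exact: normc_ge0.
    by apply: hG; rewrite (leq_trans hm)// geq_minl.
  rewrite sumr_const_nat subn0.
  have -> : (2 * G) *+ minn M0 N = 2 * (minn M0 N)%:R * G by rewrite -mulr_natr; ring.
  by apply: ler_wpM2r => //; apply: ler_wpM2l => //; rewrite ler_nat geq_minl.
have h2 : normc (\sum_(minn M0 N <= m < N) cheb_coef s N m * (fw m n)%:C%C) <=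
    4 * 4 ^- M0 * expR (8 * tau).
  have E0 := expR_ge0 (8 * tau).
  case: (leqP M0 N) => MN; last first.
    by rewrite big_geq// ComplexField.Normc.normc0 !mulr_ge0// invr_ge0 exprn_ge0.
  apply: le_trans (normc_sum _ _) _.
  apply: (@le_trans _ _ (\sum_(M0 <= m < N) 4 ^- m * (2 * expR (8 * tau)))).
    apply: ler_sum => m _; rewrite term [2 * _]mulrC mulrA.
    apply: ler_pM; rewrite ?normc_ge0//; last exact: fwave_bound.
    by have := cheb_coef_tail s N m; rewrite ns.
  rewrite -mulr_suml; have := ler_wpM2r E0 (geometric_four_le M0 N); lra.
rewrite (@big_cat_nat _ _ _ (minn M0 N)) ?geq_minr//=.
by apply: le_trans (normcD _ _) _; exact: lerD.
Qed.

End EvolutionExpansion.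

(** * Time averages and sums over the sites *)

Section OutsideProbability.
Variable R : realType.
Variable lambda : R.
Implicit Types (t T : R) (n : int).

(** The integral is the supremum over simple functions below the integrand, hence monotone. It is
    applied to the amplitude as a function of time, whose measurability is never established. *)
Lemma ge0_integral_mono d (S : measurableType d) (mu : {measure set S -> \bar R})
    (f g : S -> \bar R) : (forall x, (0 <= f x)%E) -> (forall x, (f x <= g x)%E) ->
  (\int[mu]_x f x <= \int[mu]_x g x)%E.
Proof.
move=> f0 fg.
rewrite !ge0_integralTE//; last by move=> x; exact: le_trans (f0 x) (fg x).
apply: ereal_sup_le => _ [h hf <-]; exists h => // x.
exact: le_trans (hf x) (fg x).
Qed.

Definition amplitude t n : R := normc (evolution lambda t (delta R 1) n).

Lemma amplitude_ge0 t n : 0 <= amplitude t n.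
Proof. exact: normc_ge0. Qed.

(** Domination by the exponential density of rate [1 / (2 T)]. The weight decays four times faster,
    which leaves room for bounds on the amplitude that grow with [t]. *)
Lemma averaged_prob_le T n (A : R) : 0 < T -> 0 <= A ->
  (forall t, 0 <= t -> amplitude t n ^+ 2 * expR (- (2 * t) / T) <=
     A * expR (- ((2 * T)^-1) * t)) ->
  (averaged_prob lambda T n <= (4 * A)%:E)%E.
Proof.
move=> T0 A0 h; rewrite /averaged_prob.
have r0 : 0 < (2 * T)^-1 by rewrite invr_gt0 mulr_gt0.
have -> : (4 * A)%:E = ((2 / T)%:E * (2 * T * A)%:E)%E.
  by rewrite -EFinM; congr EFin; field; rewrite gt_eqF.
apply: lee_wpmul2l; first by rewrite lee_fin divr_ge0// ltW.
have -> : (2 * T * A)%:E = (\int[lebesgue_measure]_t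
    ((2 * T * A)%:E * (exponential_pdf ((2 * T)^-1) t)%:E))%E.
  rewrite ge0_integralZl_EFin// ?integral_exponential_pdf ?mule1//.
  - by move=> t _; rewrite lee_fin exponential_pdf_ge0// ltW.
  - by apply/measurable_realfun.measurable_EFinP; exact: measurable_exponential_pdf.
  - by rewrite !mulr_ge0// ltW.
rewrite integral_mkcond; apply: ge0_integral_mono => t.
  apply: erestrict_ge0 => {}t _; rewrite lee_fin mulr_ge0 ?sqr_ge0// expR_ge0.
rewrite patchE; case: ifPn => ht; last first.
  by rewrite -EFinM lee_fin mulr_ge0 ?exponential_pdf_ge0// ?mulr_ge0// ltW.
have t0 : 0 <= t by move: ht; rewrite inE /= in_itv /= andbT.
rewrite -EFinM lee_fin inner_delta exponential_pdfE//.
apply: le_trans (h t t0) _.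
rewrite le_eqVlt; apply/orP; left; apply/eqP; field.
by rewrite gt_eqF.
Qed.

Lemma esum_int_le (S : set int) (a : int -> \bar R) (g : int -> R) (C : R) :
  (forall n, S n -> (a n <= (g n)%:E)%E) -> (forall n, 0 <= g n) ->
  (forall s : seq int, uniq s -> \sum_(n <- s) g n <= C) ->
  (\esum_(n in S) a n <= C%:E)%E.
Proof.
move=> ag g0 hC; apply: ge_ereal_sup => _ [F [finF FS] <-].
have h (r : seq int) : (forall i, i \in r -> S i) ->
    (\sum_(i <- r) a i <= (\sum_(i <- r) g i)%:E)%E.
  move=> hr; rewrite -sumEFin big_seq [X in (_ <= X)%E]big_seq.
  by apply: lee_sum => i ir; apply: ag; exact: hr.
rewrite fsbig_finite//; apply: le_trans (h _ _) _.
  by move=> i; rewrite in_fset_set// inE; exact: FS.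
by rewrite lee_fin; apply: hC; exact: finmap.fset_uniq.
Qed.

Lemma sum_inv_sqr_le (N : nat) : \sum_(k < N.+1) (k.+1%:R : R) ^- 2 <= 2 - (N.+1%:R)^-1.
Proof.
elim: N => [|N IH]; first by rewrite big_ord_recr big_ord0 /= expr1n invr1; lra.
rewrite big_ord_recr /=; apply: le_trans (lerD IH (lexx _)) _.
have h1 : 0 < N.+1%:R :> R by [].
have -> : N.+2%:R = N.+1%:R + 1 :> R by rewrite natr1.
move: (N.+1%:R : R) h1 => x x0.
have x1 : 0 < x + 1 by lra.
have h2 : (x + 1) ^- 2 <= (x * (x + 1))^-1.
  by rewrite lef_pV2 ?posrE ?exprn_gt0 ?mulr_gt0// expr2 ler_wpM2r//; lra.
have -> : (x + 1)^-1 = x^-1 - (x * (x + 1))^-1 by field; rewrite !gt_eqF.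
lra.
Qed.

Lemma sum_int_inv_sqr_le (s : seq int) : uniq s ->
  \sum_(n <- s) (1 + `|n|%:~R : R) ^- 2 <= 4.
Proof.
move=> us.
pose g (n : int) : R := (1 + `|n|%:~R) ^- 2.
have g0 n : 0 <= g n by rewrite /g invr_ge0 sqr_ge0.
have [M M0 hM] : exists2 M : nat, (0 < M)%N & forall n, n \in s -> (`|n|%N < M)%N.
  exists (\sum_(n <- s) `|n|%N).+1 => // n ns.
  by rewrite ltnS (big_rem n ns) /= leq_addr.
pose W := [seq Posz k | k <- iota 0 M] ++ [seq Negz k | k <- iota 0 M].
have uW : uniq W.
  rewrite cat_uniq !map_inj_uniq ?iota_uniq//=; last 2 first.
  - by move=> x y [].
  - by move=> x y [].
  rewrite andbT; apply/hasPn => _ /mapP[k _ ->]; apply/negP => /mapP[j _]//.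
have sW n : n \in s -> n \in W.
  move=> /hM; rewrite mem_cat; case: n => k hk; apply/orP; [left|right];
    apply/mapP; exists k => //; rewrite mem_iota /= add0n.
    exact: hk.
  exact: ltnW hk.
have -> : \sum_(n <- s) (1 + `|n|%:~R : R) ^- 2 = \sum_(n <- W | n \in s) g n.
  rewrite -[RHS]big_filter; apply: perm_big; apply: uniq_perm; rewrite ?filter_uniq//.
  move=> n; rewrite mem_filter; case: (boolP (n \in s)) => //= ns.
  by rewrite sW.
apply: (@le_trans _ _ (\sum_(n <- W) g n)).
  rewrite [leRHS](bigID (fun n => n \in s)) /= lerDl.
  by apply: sumr_ge0 => n _.
have h1 := @sum_inv_sqr_le M.-1; rewrite prednK// in h1.
have iM : 0 <= (M%:R : R)^-1 by rewrite invr_ge0.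
have -> : \sum_(n <- W) g n = \sum_(k < M) g k%:Z + \sum_(k < M) g (Negz k).
  by rewrite big_cat !big_map (_ : iota 0 M = index_iota 0 M) ?big_mkord// /index_iota subn0.
have eq1 : \sum_(k < M) g k%:Z = \sum_(k < M) (k.+1%:R : R) ^- 2.
  by apply: eq_bigr => k _; rewrite /g -pmulrn -[k.+1%:R]natr1 addrC.
have le2 : \sum_(k < M) g (Negz k) <= \sum_(k < M) (k.+1%:R : R) ^- 2.
  apply: ler_sum => k _; rewrite /g (_ : `|Negz k|%:~R = k.+1%:R :> R)//.
  have k0 : 0 < k.+1%:R :> R by [].
  move: (k.+1%:R : R) k0 => x x0.
  have x1 : 0 < 1 + x by lra.
  rewrite lef_pV2 ?posrE ?exprn_gt0// ler_sqr ?nnegrE ?ltW//; lra.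
rewrite eq1; lra.
Qed.

End OutsideProbability.

Section Asymptotics.
Variable R : realType.
Implicit Types (T a b c p : R).

Lemma powR_expR T a : 0 < T -> T `^ a = expR (a * ln T).
Proof. by move=> T0; rewrite /powR gt_eqF. Qed.

Lemma near_ln_ge (M : R) : \forall T \near +oo, M <= ln T.
Proof.
near=> T.
have T0 : expR M <= T by near: T; apply: nbhs_pinfty_ge; exact: num_real.
by rewrite -(expRK M) ler_ln ?posrE ?expR_gt0// (lt_le_trans (expR_gt0 M)).
Unshelve. all: by end_near. Qed.

Lemma near_pos : \forall T \near (+oo : set_system R), 1 <= T /\ 0 < T.
Proof.
near=> T.
have T1 : 1 <= T by near: T; apply: nbhs_pinfty_ge; exact: num_real.
by split=> //; exact: lt_le_trans T1.
Unshelve. all: by end_near. Qed.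

Lemma near_powR_ge (M a : R) : 0 < a -> \forall T \near +oo, M <= T `^ a.
Proof.
move=> a0; near=> T.
have [T1 T0] : 1 <= T /\ 0 < T by near: T; exact: near_pos.
rewrite powR_expR//; apply: le_trans (expR_ge1Dx _).
have : M / a <= ln T by near: T; exact: near_ln_ge.
by rewrite ler_pdivrMr// => h; lra.
Unshelve. all: by end_near. Qed.

Lemma near_powR_le (C a b : R) : a < b -> \forall T \near +oo, C * T `^ a <= T `^ b.
Proof.
move=> ab; near=> T.
have [T1 T0] : 1 <= T /\ 0 < T by near: T; exact: near_pos.
have -> : b = (b - a) + a by ring.
rewrite powRD; last by rewrite (gt_eqF T0) implybT.
rewrite ler_wpM2r ?powR_ge0//.
by near: T; apply: near_powR_ge; rewrite subr_gt0.
Unshelve. all: by end_near. Qed.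

Lemma near_expR_decay c a p : 0 < c -> 0 < a ->
  \forall T \near +oo, expR (- (c * T `^ a)) <= T `^ (- p).
Proof.
move=> c0 a0; near=> T.
have [T1 T0] : 1 <= T /\ 0 < T by near: T; exact: near_pos.
have L0 : 0 <= ln T by rewrite ln_ge0.
have hL : 2 * p / (c * a ^+ 2) <= ln T by near: T; exact: near_ln_ge.
rewrite [leRHS]powR_expR// ler_expR mulNr lerN2.
have h := @expR_ge1Dxn R (a * ln T) 1 (mulr_ge0 (ltW a0) L0).
rewrite powR_expR//.
apply: (@le_trans _ _ (c * ((a * ln T) ^+ 2 / 2))).
  have ca : 0 < c * a ^+ 2 by rewrite mulr_gt0// exprn_gt0.
  rewrite ler_pdivrMr// in hL.
  have := ler_wpM2r L0 hL; rewrite exprMn; lra.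
rewrite ler_wpM2l ?(ltW c0)//; apply: le_trans h.
have -> : (2`!%:R : R) = 2 by []; lra.
Unshelve. all: by end_near. Qed.

Lemma expR1_le4 : expR (1 : R) <= 4.
Proof.
have h : expR (2^-1 : R) <= 2.
  rewrite -[leLHS]invrK -expRN -[leRHS]invrK lef_pV2 ?posrE ?expR_gt0 ?invr_gt0//.
  by apply: le_trans (expR_ge1Dx _); lra.
have -> : (1 : R) = 2^-1 + 2^-1 by field.
by rewrite expRD; have := expR_gt0 (2^-1 : R); nra.
Qed.

Lemma expR_le_pow4 (x : R) (M : nat) : x <= M%:R -> expR x <= 4 ^+ M.
Proof.
move=> xM; apply: (@le_trans _ _ (expR M%:R)); first by rewrite ler_expR.
rewrite -[M%:R]mulr1 expRM_natl lerXn2r ?nnegrE ?expR_ge0//.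
exact: expR1_le4.
Qed.

Lemma pow4_decay (x : R) (M : nat) : x <= M%:R -> 4 ^- M <= expR (- x) :> R.
Proof.
move=> xM; rewrite expRN lef_pV2 ?posrE ?expR_gt0 ?exprn_gt0//.
exact: expR_le_pow4.
Qed.

Lemma sqr_le_pow2 (N : nat) : ((N + 2) ^ 2 <= 5 * 2 ^ N)%N.
Proof.
elim: N => [|[|[|N]] IH]//.
rewrite (expnS 2) mulnCA; apply: leq_trans (leq_mul (leqnn 2) IH).
rewrite !expnS !expn0; nia.
Qed.

End Asymptotics.

(** * A priori bounds on the amplitude *)

Section AmplitudeBounds.
Variable R : realType.
Variable lambda : R.
Hypothesis l0 : 0 <= lambda.
Local Notation b := (wave_scale lambda).
Local Notation amp := (amplitude lambda).
Implicit Types (t : R) (n : int).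

Lemma amplitude_ballistic t n : 0 <= t ->
  amp t n <= 4 * 4 ^- `|(n - 1)%R| * expR (8 * (t / b)).
Proof.
move=> t0; have := @evolution_bound R lambda t 0 n `|(n - 1)%R|%N l0 t0 (lexx 0).
rewrite mulr0 add0r; apply => m hm.
by rewrite /fwave (wave_support _ _ hm).1 normr0.
Qed.

(** A crude stand-in for unitarity, obtained by cutting the expansion near [8 t / b], where the tail
    becomes bounded. *)
Lemma amplitude_linear t n : 0 <= t -> amp t n <= 4 * (8 * (t / b) + 2).
Proof.
move=> t0; have b0 := wave_scale_gt0 l0.
set tau := t / b; have tau0 : 0 <= 8 * tau by rewrite mulr_ge0// divr_ge0// ltW.
pose M := (Num.truncn (8 * tau)).+1.
have hM : 8 * tau <= M%:R by rewrite ltW// truncnS_gt.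
have hM' : M%:R <= 8 * tau + 1.
  by rewrite /M -natr1 lerD2r; rewrite truncn_le.
have h := @evolution_bound R lambda t 2 n M l0 t0 (ler0n _ 2)
  (fun m _ => fwave_bound m n l0).
rewrite -/tau in h.
have h2 : 4 ^- M * expR (8 * tau) <= 1.
  by rewrite ler_pdivrMl ?exprn_gt0// mulr1 expR_le_pow4.
have -> : 4 * (8 * tau + 2) = 2 * (8 * tau + 1) * 2 + 4 * 1 by ring.
apply: le_trans h _; rewrite -[4 * 4 ^- M * _]mulrA.
apply: lerD; first by lra.
by rewrite ler_wpM2l.
Qed.

Definition poly_cst : R := 4 * (16 / b + 2) ^+ 3 + 20.

Lemma poly_cst_ge0 : 0 <= poly_cst.
Proof.
have b0 := wave_scale_gt0 l0.
by rewrite /poly_cst addr_ge0// mulr_ge0// exprn_ge0// addr_ge0// divr_ge0// ltW.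
Qed.

(** The weight [(1 + |n|)^2] serves the summation over [n]. Where [|n - 1| >= 16 t / b] ballistic
    decay beats it; elsewhere it is quadratic in [t] and the linear bound completes the cube. *)
Lemma amplitude_poly t n : 0 <= t ->
  (1 + `|n|%:~R) ^+ 2 * amp t n <= poly_cst * (1 + t) ^+ 3.
Proof.
move=> t0; have b0 := wave_scale_gt0 l0.
set N := `|(n - 1)%R|%N.
set tau := t / b; have tau0 : 0 <= tau by rewrite divr_ge0// ltW.
have nN : 1 + `|n|%:~R <= N%:R + 2 :> R.
  have h : (1 + `|n| <= N%:Z + 2)%R by rewrite /N; lia.
  by move: h; rewrite -(ler_int R) !intrD -!pmulrn.
have n0 : 0 <= 1 + `|n|%:~R :> R by rewrite addr_ge0// ler0z.
have t1 : 1 <= (1 + t) ^+ 3 by apply: exprn_ege1; lra.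
have hn2 : (1 + `|n|%:~R) ^+ 2 <= (N%:R + 2) ^+ 2 :> R.
  by rewrite ler_sqr ?nnegrE// (le_trans n0).
have a0 := amplitude_ge0 lambda t n.
have k0 : 0 <= (16 / b + 2) ^+ 3 by rewrite exprn_ge0// addr_ge0// divr_ge0// ltW.
case: (lerP (16 * tau) N%:R) => h.
  have h1 : amp t n <= 4 * 2 ^- N.
    apply: le_trans (amplitude_ballistic n t0) _; rewrite -/N -/tau -mulrA ler_wpM2l//.
    rewrite ler_pdivrMl ?exprn_gt0// (_ : 4 = 2 * 2 :> R); last by rewrite -natrM.
    rewrite exprMn mulfK ?expf_neq0//.
    have E : expR (8 * tau) ^+ 2 <= (2 ^+ N) ^+ 2.
      rewrite -expRM_natl -exprM mulnC exprM (_ : 2 ^+ 2 = 4); last by rewrite -natrX.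
      by apply: expR_le_pow4; lra.
    by move: E; rewrite ler_sqr ?nnegrE ?expR_ge0 ?exprn_ge0.
  have h2 : (N%:R + 2) ^+ 2 <= 5 * 2 ^+ N :> R.
    by have := sqr_le_pow2 N; rewrite -(ler_nat R) natrM !natrX natrD.
  apply: (@le_trans _ _ (5 * 2 ^+ N * (4 * 2 ^- N))).
    by apply: ler_pM => //; exact: le_trans h2.
  have -> : 5 * 2 ^+ N * (4 * 2 ^- N) = 20 :> R by field; rewrite expf_neq0.
  by rewrite /poly_cst; nra.
have h1 := amplitude_linear n t0; rewrite -/tau in h1.
have tt : tau = t * b^-1 by [].
have tk : 16 * tau + 2 <= (16 / b + 2) * (1 + t).
  have : 0 <= b^-1 by rewrite invr_ge0 ltW.
  rewrite tt; move: t0; nra.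
apply: (@le_trans _ _ ((16 * tau + 2) ^+ 2 * (4 * (16 * tau + 2)))).
  apply: ler_pM => //.
    by apply: le_trans hn2 _; rewrite ler_sqr ?nnegrE; lra.
  by apply: le_trans h1 _; lra.
have -> : (16 * tau + 2) ^+ 2 * (4 * (16 * tau + 2)) = 4 * (16 * tau + 2) ^+ 3 by ring.
have h3 : (16 * tau + 2) ^+ 3 <= (16 / b + 2) ^+ 3 * (1 + t) ^+ 3.
  by rewrite -exprMn lerXn2r ?nnegrE//; [lra|apply: le_trans tk; lra].
by rewrite /poly_cst mulrDl; move: h3 t1; lra.
Qed.

End AmplitudeBounds.

(** * Rapid decay and the transport exponent *)

Section TransportDecay.
Variable R : realType.
Variable lambda : R.
Local Notation amp := (amplitude lambda).
Implicit Types (t T a p : R) (n : int).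

Lemma exp_dominates_poly (k : nat) T t : (0 < k)%N -> 1 <= T -> 0 <= t ->
  (1 + t) ^+ k <= (k%:R * T) ^+ k * expR (t / T).
Proof.
move=> k0 T1 t0; have k1 : 1 <= k%:R :> R by rewrite ler1n.
have kT : 1 <= k%:R * T by nra.
have -> : t / T = k%:R * (t / (k%:R * T)).
  by field; rewrite !gt_eqF//; lra.
rewrite expRM_natl -exprMn lerXn2r ?nnegrE ?mulr_ge0 ?expR_ge0//; try lra.
apply: (@le_trans _ _ (k%:R * T * (1 + t / (k%:R * T)))).
  have -> : k%:R * T * (1 + t / (k%:R * T)) = k%:R * T + t.
    by field; rewrite !gt_eqF//; lra.
  by rewrite lerD2r.
by rewrite ler_wpM2l ?expR_ge1Dx//; lra.
Qed.

(** The time range exceeds [T] by a power because beyond [T ^ (1 + eps)] the exponential weight is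
    itself smaller than any power of [T]. *)
Definition rapidly_small a : Prop := exists2 eps : R, 0 < eps &
  forall p, \forall T \near +oo, forall t n, 0 <= t -> t <= T `^ (1 + eps) ->
    T `^ a < `|n|%:~R -> amp t n <= T `^ (- p).

Lemma outside_prob_small a q : 0 <= lambda -> rapidly_small a ->
  \forall T \near +oo, (outside_prob lambda (T `^ a) T <= (T `^ (- q))%:E)%E.
Proof.
move=> l0 [eps e0 hs].
pose Cp := poly_cst lambda; have Cp0 : 0 <= Cp := poly_cst_ge0 l0.
pose C1 := 16 * (3 ^+ 3 * Cp + 6 ^+ 6 * Cp ^+ 2).
near=> T.
have [T1 T0] : 1 <= T /\ 0 < T by near: T; exact: near_pos.
(* The exponents [q + 4] and [q + 7] pay for the factors [T ^+ 3] and [T ^+ 6] of the polynomial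
   bounds and leave one power of [T] for the constants. *)
have h1 : forall t n, 0 <= t -> t <= T `^ (1 + eps) ->
    T `^ a < `|n|%:~R -> amp t n <= T `^ (- (q + 4)) by near: T; exact: hs.
have h2 : expR (- (2^-1 * T `^ eps)) <= T `^ (- (q + 7)).
  by near: T; apply: near_expR_decay; rewrite ?invr_gt0.
have h3 : C1 * T `^ (- q - 1) <= T `^ (- q).
  by near: T; apply: near_powR_le; lra.
have powT (k : nat) (x : R) : T ^+ k * T `^ x = T `^ (k%:R + x).
  by rewrite powRD ?(gt_eqF T0) ?implybT// powR_mulrn// ltW.
pose E := 3 ^+ 3 * Cp * T `^ (- q - 1) + 6 ^+ 6 * Cp ^+ 2 * T `^ (- q - 1).
have E0 : 0 <= E by rewrite addr_ge0// !mulr_ge0 ?exprn_ge0 ?powR_ge0.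
apply: (@le_trans _ _ (16 * E)%:E); last first.
  by rewrite lee_fin; apply: le_trans h3; rewrite /E /C1; lra.
apply: (@esum_int_le _ _ _ (fun n => 4 * E * (1 + `|n|%:~R) ^- 2)).
- move=> n /= hn; rewrite -mulrA; apply: averaged_prob_le => //.
    by rewrite mulr_ge0// invr_ge0 sqr_ge0.
  move=> t t0.
  set D : R := (1 + `|n|%:~R) ^+ 2.
  have D1 : 1 <= D.
    by rewrite /D; apply: exprn_ege1; rewrite lerDl ler0z.
  have D0 : 0 < D by exact: lt_le_trans D1.
  have hp := amplitude_poly l0 n t0; rewrite -/D -/Cp in hp.
  have am0 := amplitude_ge0 lambda t n.
  (* In terms of [y] the weight is [y ^ 4], the dominating density is proportional to [y], and
     [y ^ 2] cancels the factor [exp (t / T)] of [exp_dominates_poly]. *)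
  set y := expR (- ((2 * T)^-1 * t)).
  have yE : expR (- (2^-1 * (t / T))) = y.
    by rewrite /y; congr (expR (- _)); field; rewrite gt_eqF.
  rewrite [- (2 * T)^-1 * t]mulNr -/y.
  have y0 : 0 < y by exact: expR_gt0.
  have y1 : y <= 1 by rewrite /y -expR0 ler_expR oppr_le0 mulr_ge0// invr_ge0 mulr_ge0// ltW.
  have y4 : expR (- (2 * t) / T) = y ^+ 4.
    by rewrite -yE -expRM_natl; congr expR; field; rewrite gt_eqF.
  have y2 : expR (t / T) * y ^+ 2 = 1.
    by rewrite -yE -expRM_natl -expRD -[RHS]expR0; congr expR; field; rewrite gt_eqF.
  rewrite y4 [E / D * y]mulrAC ler_pdivlMr//.
  suff key : amp t n ^+ 2 * D <= E * expR (t / T) \/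
      (amp t n ^+ 2 * D) * y <= E * expR (t / T).
    have yy : amp t n ^+ 2 * D * y <= E * expR (t / T).
      case: key => // key; apply: le_trans key.
      by rewrite ler_piMr// mulr_ge0 ?sqr_ge0// ltW.
    have -> : amp t n ^+ 2 * y ^+ 4 * D = (amp t n ^+ 2 * D * y) * y ^+ 3 by ring.
    have -> : E * y = E * expR (t / T) * y ^+ 3.
      by rewrite -[LHS]mulr1 -y2; ring.
    by rewrite ler_wpM2r// exprn_ge0// ltW.
  have ex0 : 0 <= expR (t / T) by exact: expR_ge0.
  case: (lerP t (T `^ (1 + eps))) => ht.
  + left; have ha := h1 t n t0 ht hn.
    have h := exp_dominates_poly (k := 3) isT T1 t0.
    have -> : amp t n ^+ 2 * D = amp t n * (D * amp t n) by ring.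
    apply: (@le_trans _ _ (T `^ (- (q + 4)) * (Cp * ((3 * T) ^+ 3 * expR (t / T))))).
      apply: ler_pM => //; first by rewrite mulr_ge0// ltW.
      by apply: le_trans hp _; rewrite ler_wpM2l.
    have -> : T `^ (- (q + 4)) * (Cp * ((3 * T) ^+ 3 * expR (t / T))) =
       3 ^+ 3 * Cp * (T ^+ 3 * T `^ (- (q + 4))) * expR (t / T) by ring.
    rewrite powT (_ : 3 + - (q + 4) = - q - 1); last by ring.
    rewrite /E ler_wpM2r// lerDl !mulr_ge0 ?exprn_ge0 ?powR_ge0//.
  + right; have h := exp_dominates_poly (k := 6) isT T1 t0.
    have yT : y <= T `^ (- (q + 7)).
      apply: le_trans h2; rewrite -yE ler_expR lerN2 ler_wpM2l ?invr_ge0//.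
      rewrite ler_pdivlMr// mulrC; apply: ltW; move: ht.
      by rewrite powRD ?(gt_eqF T0) ?implybT// powRr1// ltW.
    have hD : amp t n ^+ 2 * D <= Cp ^+ 2 * (1 + t) ^+ 6.
      have -> : Cp ^+ 2 * (1 + t) ^+ 6 = (Cp * (1 + t) ^+ 3) ^+ 2 by ring.
      apply: (@le_trans _ _ ((D * amp t n) ^+ 2)).
        have -> : (D * amp t n) ^+ 2 = (amp t n ^+ 2 * D) * D by ring.
        by rewrite ler_peMr// mulr_ge0 ?sqr_ge0// ltW.
      have DP0 : 0 <= D * amp t n by rewrite mulr_ge0// ltW.
      by rewrite ler_sqr ?nnegrE// (le_trans DP0).
    apply: (@le_trans _ _ (Cp ^+ 2 * ((6 * T) ^+ 6 * expR (t / T)) * T `^ (- (q + 7)))).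
      apply: ler_pM => //; [by rewrite mulr_ge0 ?sqr_ge0// ltW|exact: ltW|].
      by apply: le_trans hD _; rewrite ler_wpM2l ?sqr_ge0.
    have -> : Cp ^+ 2 * ((6 * T) ^+ 6 * expR (t / T)) * T `^ (- (q + 7)) =
       6 ^+ 6 * Cp ^+ 2 * (T ^+ 6 * T `^ (- (q + 7))) * expR (t / T) by ring.
    rewrite powT (_ : 6 + - (q + 7) = - q - 1); last by ring.
    rewrite /E ler_wpM2r// lerDr !mulr_ge0 ?exprn_ge0 ?powR_ge0//.
- by move=> n; rewrite mulr_ge0 ?invr_ge0 ?sqr_ge0// mulr_ge0.
- move=> s us; rewrite -mulr_sumr; have := sum_int_inv_sqr_le R us.
  by move=> /(ler_wpM2l (mulr_ge0 (ler0n _ 4) E0)); lra.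
Unshelve. all: by end_near. Qed.

Lemma rapidly_small_limsup a : 0 <= lambda -> rapidly_small a ->
  ~ (-oo < limf_esup
             (fun T : R => lne (outside_prob lambda (T `^ a) T) * ((ln T)^-1)%:E)
             (pinfty_nbhs R))%E.
Proof.
move=> l0 hs.
suff h (M : R) : (limf_esup
    (fun T : R => lne (outside_prob lambda (T `^ a) T) * ((ln T)^-1)%:E)
    (pinfty_nbhs R) <= (- M)%:E)%E.
  move: (limf_esup _ _) h => [r| |] h //; last by have := h 0%R.
  by exfalso; have := h (1 - r)%R; rewrite lee_fin; lra.
have [V hV1 hV2] : exists2 V, pinfty_nbhs R V & forall T, V T ->
    (outside_prob lambda (T `^ a) T <= (T `^ (- M))%:E)%E /\ 1 < T.
  exists [set T | (outside_prob lambda (T `^ a) T <= (T `^ (- M))%:E)%E /\ 1 < T] => //.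
  near=> T; split; last by near: T; apply: nbhs_pinfty_gt; exact: num_real.
  by near: T; exact: outside_prob_small.
apply: (@le_trans _ _ (ereal_sup ((fun T : R => lne (outside_prob lambda (T `^ a) T) * ((ln T)^-1)%:E)%E @` V))).
  by apply: ereal_inf_lbound; exists V.
apply: ge_ereal_sup => _ [T VT <-].
have [hT T1] := hV2 T VT.
have T0 : 0 < T by exact: lt_trans T1.
have L0 : 0 < ln T by rewrite ln_gt0.
have -> : (- M)%:E = ((- M * ln T)%:E * ((ln T)^-1)%:E)%E.
  by rewrite -EFinM; congr EFin; field; rewrite gt_eqF.
apply: lee_wpmul2r; first by rewrite lee_fin invr_ge0 ltW.
rewrite -ln_powR -lne_EFin ?powR_gt0// lee_lne//.
- rewrite in_itv /= leey andbT; apply: esum_ge0 => n _.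
  rewrite /averaged_prob mule_ge0 ?lee_fin ?divr_ge0 ?(ltW T0)//.
  by apply: integral_ge0 => t _; rewrite lee_fin mulr_ge0 ?sqr_ge0 ?expR_ge0.
- by rewrite in_itv /= leey andbT lee_fin powR_ge0.
Unshelve. all: by end_near. Qed.

End TransportDecay.

(** * Choice of scales *)

Section FibonacciGrowth.
Variable R : realType.

Lemma eta_sqr : eta R ^+ 2 = eta R + 1.
Proof. by rewrite eta_theta; have := theta_sqr R; lra. Qed.

Lemma eta_gt1 : 1 < eta R.
Proof. by rewrite eta_theta; have /andP[] := theta_bounds R; lra. Qed.

Lemma eta_exprSS n : eta R ^+ n.+2 = eta R ^+ n.+1 + eta R ^+ n.
Proof. by rewrite -addn2 exprD eta_sqr mulrDr mulr1 -exprSr. Qed.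

Lemma fibn_le_eta n : (fibn n)%:R <= eta R ^+ n.
Proof.
have e1 := eta_gt1.
suff : (fibn n)%:R <= eta R ^+ n /\ (fibn n.+1)%:R <= eta R ^+ n.+1 by case.
elim: n => [|n [IH1 IH2]]; first by rewrite expr0 expr1; split => //; exact: ltW.
split=> //; rewrite fibnSS natrD eta_exprSS.
exact: lerD.
Qed.

Lemma eta_le_fibn n : eta R ^+ n <= (fibn n.+1)%:R.
Proof.
have /andP[t1 t2] := theta_bounds R.
suff : eta R ^+ n <= (fibn n.+1)%:R /\ eta R ^+ n.+1 <= (fibn n.+2)%:R by case.
elim: n => [|n [IH1 IH2]].
  by rewrite expr0 expr1; split => //; rewrite eta_theta /= ; lra.
split=> //; rewrite (fibnSS n.+1) natrD eta_exprSS.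
exact: lerD.
Qed.

Lemma expR_ln_nat (x : R) n : 0 < x -> x ^+ n = expR (n%:R * ln x).
Proof. by move=> x0; rewrite expRM_natl lnK. Qed.

End FibonacciGrowth.

Section RapidlySmall.
Variable R : realType.
Variable lambda : R.
Local Notation b := (wave_scale lambda).
Local Notation amp := (amplitude lambda).
Local Notation c := (trace_cst R).

Lemma rapidly_small_ballistic (a : R) : 0 <= lambda -> 1 < a -> rapidly_small lambda a.
Proof.
move=> l0 a1; have b0 := wave_scale_gt0 l0.
pose eps := (a - 1) / 2; have e0 : 0 < eps by rewrite divr_gt0//; lra.
exists eps => // p; near=> T => t n t0 tT hn.
have [T1 T0] : 1 <= T /\ 0 < T by near: T; exact: near_pos.
have h1 : 16 / b * T `^ (1 + eps) <= T `^ a.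
  by near: T; apply: near_powR_le; rewrite /eps; lra.
have h2 : expR (- (2^-1 * T `^ a)) <= T `^ (- (p + 1)).
  by near: T; apply: near_expR_decay; lra.
have h3 : 16 * T `^ (- (p + 1)) <= T `^ (- p).
  by near: T; apply: near_powR_le; lra.
apply: le_trans (amplitude_ballistic l0 n t0) _; apply: le_trans h3.
have nN : `|n|%:~R - 1 <= `|(n - 1)%R|%N%:R :> R.
  have h : (`|n| - 1 <= `|(n - 1)%R|%N%:Z)%R by clear; lia.
  by move: h; rewrite -(ler_int R) intrB.
have h4 : T `^ a - 1 <= `|(n - 1)%R|%N%:R by apply: le_trans nN; rewrite lerD2r ltW.
have h5 : t / b <= T `^ (1 + eps) / b by rewrite ler_wpM2r// invr_ge0 ltW.
apply: (@le_trans _ _ (4 * expR (- (T `^ a - 1)) * expR (8 * (t / b)))).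
  by rewrite ler_wpM2r ?expR_ge0// ler_wpM2l// pow4_decay.
rewrite -mulrA -expRD.
have h6 : expR (- (T `^ a - 1) + 8 * (t / b)) <= expR (1 + - (2^-1 * T `^ a)).
  by rewrite ler_expR; move: h1 h5; lra.
rewrite (expRD 1) in h6.
have h7 := ler_pM (expR_ge0 1) (expR_ge0 _) (expR1_le4 R) h2.
move: (le_trans h6 h7); lra.
Unshelve. all: by end_near. Qed.

Section Spectral.
Hypothesis hl : 1129 / 100 <= lambda.
Local Notation k0 := (rate lambda).

Lemma rate_gt3 : 3 < k0.
Proof. by have := hl; rewrite /rate; lra. Qed.

Lemma lambda_ge0 : 0 <= lambda.
Proof. by have hl' := hl; lra. Qed.

Definition block_exponent : R := 2 * ln (eta R) / ln k0.

Lemma block_exponent_gt0 : 0 < block_exponent.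
Proof.
have := rate_gt3; have := eta_gt1 R => h1 h2.
by rewrite /block_exponent divr_gt0 ?mulr_gt0 ?ln_gt0//; lra.
Qed.

(** [N] returns settle the height [1 / Y], since [3 > 2 * c], and [l] further indices raise the
    trace to [c ^ Z]. As [fibn n] grows like [eta ^ n], a block of index about [2 N + l] has length
    of order [Y ^ block_exponent * Z]. *)
Lemma block_choice (Y Z : R) : 1 <= Y -> 1 <= Z -> exists N l k : nat,
  [/\ 2 * c < k0 ^+ N * Y^-1, (2 <= k)%N, (N.*2 + l <= k.+1)%N,
   Z <= (fibn l)%:R &
   (fibn k.+1)%:R <= expR (block_exponent * ln 3 + 4 * ln (eta R)) *
     Y `^ block_exponent * Z].
Proof.
move=> Y1 Z1; have k3 := rate_gt3; have e1 := eta_gt1 R.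
have Y0 : 0 < Y by exact: lt_le_trans Y1.
have Z0 : 0 < Z by exact: lt_le_trans Z1.
have ZE : Z = expR (ln Z) by rewrite lnK ?posrE.
have lk : 0 < ln k0 by rewrite ln_gt0; lra.
have le : 0 < ln (eta R) by rewrite ln_gt0.
have k00 : 0 < k0 by lra.
have e0 : 0 < eta R by lra.
pose x := ln (3 * Y) / ln k0.
pose v := ln Z / ln (eta R).
have x0 : 0 <= x by rewrite divr_ge0 ?(ltW lk)// ln_ge0; lra.
have v0 : 0 <= v by rewrite divr_ge0 ?(ltW le)// ln_ge0.
pose N := (Num.truncn x).+1; pose j := (Num.truncn v).+1.
have hN : x <= N%:R by rewrite ltW// truncnS_gt.
have hN' : N%:R <= x + 1 by rewrite /N -natr1 lerD2r truncn_le.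
have hj : v <= j%:R by rewrite ltW// truncnS_gt.
have hj' : j%:R <= v + 1 by rewrite /j -natr1 lerD2r truncn_le.
exists N, j.+1, (N.*2 + j)%N; split.
- have h : 3 * Y <= k0 ^+ N.
    rewrite (expR_ln_nat _ k00) -[leLHS]lnK ?posrE; last by rewrite mulr_gt0.
    by rewrite ler_expR; move: hN; rewrite /x ler_pdivrMr.
  rewrite ltr_pdivlMr//; apply: lt_le_trans h.
  by rewrite /trace_cst ltr_pM2r//; lra.
- by rewrite /N doubleS.
- by rewrite addnS.
- apply: le_trans (eta_le_fibn R j).
  rewrite (expR_ln_nat _ e0) -[leLHS]lnK ?posrE// ler_expR.
  by move: hj; rewrite /v ler_pdivrMr.
- apply: le_trans (fibn_le_eta R _) _.
  rewrite (expR_ln_nat _ e0) powR_expR// [in leRHS]ZE -!expRD ler_expR.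
  have E1 : x * ln (eta R) *+ 2 = block_exponent * (ln 3 + ln Y).
    by rewrite /x /block_exponent lnM ?posrE//; field; rewrite gt_eqF.
  have E2 : v * ln (eta R) = ln Z by rewrite /v divfK// gt_eqF.
  have hNl := ler_wpM2r (ltW le) hN'; have hjl := ler_wpM2r (ltW le) hj'.
  have -> : (N.*2 + j).+1%:R = N%:R *+ 2 + j%:R + 1 :> R.
    by rewrite -natr1 natrD -muln2 natrM mulr_natr.
  have -> : (N%:R *+ 2 + j%:R + 1) * ln (eta R) =
    2 * (N%:R * ln (eta R)) + j%:R * ln (eta R) + ln (eta R) by ring.
  move: hNl hjl E1 E2; rewrite !mulrDl !mul1r mulr2n; lra.
Qed.

Lemma fwave_estimate (Y z : R) (N l k : nat) n m : 2 <= Y -> 0 <= z ->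
  2 * c < k0 ^+ N * Y^-1 -> (2 <= k)%N -> (N.*2 + l <= k.+1)%N ->
  (c ^+ fibn l)^-1 <= z -> ((fibn k.+1).+1 < `|n|)%N ->
  `|fwave lambda m n| * (1 - Y^-1) ^+ m <= 8 * (4 + 2 / b) * Y ^+ 2 * z.
Proof.
move=> Y2 z0 g1 g2 g3 cz nk.
have Y0 : 0 < Y by apply: lt_le_trans Y2.
have l0 := lambda_ge0.
have b0 := wave_scale_gt0 l0.
have bb : 0 <= 2 / b by rewrite divr_ge0// ltW.
have Yh : Y^-1 <= 1 / 2 by rewrite div1r lef_pV2 ?posrE.
have Yi : 0 < Y^-1 by rewrite invr_gt0.
have r1 : 1 / 2 <= 1 - Y^-1 by clear -hl Yh; lra.
have r2 : 1 - Y^-1 < 1 by rewrite gtrBl.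
have c0 : 0 < c by rewrite /trace_cst; clear -hl; lra.
apply: le_of_sqr.
  by apply: mulr_ge0 => //; apply: mulr_ge0; [apply: mulr_ge0 => //; apply: addr_ge0|exact: sqr_ge0].
have := wave_outside_bound m hl r1 r2; rewrite (_ : 1 - (1 - Y^-1) = Y^-1); last by rewrite opprB addrC subrK.
move=> /(_ N l k n g1 g2 g3 nk).
rewrite !(invrK Y) => H; apply: le_trans H _.
have cf : 0 <= (c ^+ fibn l)^-1 by rewrite invr_ge0; apply: exprn_ge0; exact: ltW.
have Yb : 0 <= 4 * Y + 2 / b.
  by apply: addr_ge0 => //; apply: mulr_ge0 => //; exact: ltW.
have hA : 0 <= (4 * Y + 2 / b) / c ^+ fibn l by exact: mulr_ge0.
have hA' : (4 * Y + 2 / b) / c ^+ fibn l <= (4 + 2 / b) * Y * z.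
  have q1 : 4 * Y + 2 / b <= (4 + 2 / b) * Y.
    by rewrite [leRHS]mulrDl lerD2l ler_peMr// (le_trans _ Y2)// ler1n.
  exact: ler_pM Yb cf q1 cz.
have hA2 : ((4 * Y + 2 / b) / c ^+ fibn l) ^+ 2 <= ((4 + 2 / b) * Y * z) ^+ 2.
  by rewrite ler_sqr ?nnegrE// (le_trans hA).
apply: (@le_trans _ _ (((4 + 2 / b) * Y * z) ^+ 2 * (50 * Y))).
  by apply: ler_wpM2r hA2; apply: mulr_ge0 => //; exact: ltW.
have -> : (8 * (4 + 2 / b) * Y ^+ 2 * z) ^+ 2 =
  ((4 + 2 / b) * Y * z) ^+ 2 * (64 * Y ^+ 2) by ring.
by rewrite ler_wpM2l ?sqr_ge0//; clear -hl Y2 Y0; nra.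
Qed.

Definition amplitude_cst : R :=
  2 * (16 / b + 1) * (8 * (4 + 2 / b) * expR (32 / b + 2)).

(** Up to time [Y] only indices [m] of order [Y] matter, and for these the weight [(1 - 1 / Y) ^ m]
    of Cauchy's estimate is bounded below by a constant. *)
Lemma amplitude_estimate (Y z : R) t n : 2 <= Y -> 0 <= z -> 0 <= t -> t <= Y ->
  (forall m, `|fwave lambda m n| * (1 - Y^-1) ^+ m <= 8 * (4 + 2 / b) * Y ^+ 2 * z) ->
  amp t n <= amplitude_cst * Y ^+ 3 * z + 4 * expR (- (8 / b * Y)).
Proof.
move=> Y2 z0 t0 tY wb.
have Y0 : 0 < Y by apply: lt_le_trans Y2.
have Y1 : 1 <= Y by apply: le_trans Y2; rewrite ler1n.
have l0 := lambda_ge0.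
have b0 := wave_scale_gt0 l0.
have bb : 0 <= 2 / b by rewrite divr_ge0// ltW.
have b32 : 0 <= 32 / b by rewrite divr_ge0// ltW.
have b16 : 0 <= 16 / b by rewrite divr_ge0// ltW.
have Yi : 0 < Y^-1 by rewrite invr_gt0.
have Yh : Y^-1 <= 1 / 2 by rewrite div1r lef_pV2 ?posrE.
have YY : Y * Y^-1 = 1 by rewrite mulfV// gt_eqF.
have rho0 : 0 <= 1 - Y^-1 by clear -hl Yh; lra.
have er : 1 <= (1 - Y^-1) * expR (2 / Y).
  apply: (@le_trans _ _ ((1 - Y^-1) * (1 + 2 / Y))).
    by clear -hl Yi Yh; nra.
  by rewrite ler_wpM2l// expR_ge1Dx.
set G1 := 8 * (4 + 2 / b) * Y ^+ 2 * z in wb.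
have G10 : 0 <= G1.
  by apply: mulr_ge0 => //; apply: mulr_ge0; [apply: mulr_ge0 => //; apply: addr_ge0|exact: sqr_ge0].
pose M0 := (Num.truncn (16 * (Y / b))).+1.
have Yb0 : 0 <= Y / b by rewrite divr_ge0// ltW.
have Yb : 0 <= 16 * (Y / b) by rewrite mulr_ge0.
have hM : 16 * (Y / b) <= M0%:R by rewrite ltW// truncnS_gt.
have hM' : M0%:R <= (16 / b + 1) * Y.
  apply: (@le_trans _ _ (16 * (Y / b) + 1)); first by rewrite /M0 -natr1 lerD2r truncn_le.
  rewrite [leRHS]mulrDl mul1r; have -> : 16 / b * Y = 16 * (Y / b) by ring.
  by rewrite lerD2l.
pose G := G1 * expR (32 / b + 2).
have G0 : 0 <= G by rewrite mulr_ge0// expR_ge0.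
have fG m : (m < M0)%N -> `|fwave lambda m n| <= G.
  move=> hm; have f0 := normr_ge0 (fwave lambda m n).
  have rm : 1 <= (1 - Y^-1) ^+ m * expR (m%:R * (2 / Y)).
    by rewrite expRM_natl -exprMn exprn_ege1.
  have em : expR (m%:R * (2 / Y)) <= expR (32 / b + 2).
    rewrite ler_expR; apply: (@le_trans _ _ ((16 / b + 1) * Y * (2 / Y))).
      rewrite ler_wpM2r ?divr_ge0 ?(ltW Y0)//; apply: le_trans hM'.
      by rewrite ler_nat ltnW.
    by rewrite le_eqVlt; apply/orP; left; apply/eqP; field; rewrite !gt_eqF.
  apply: (@le_trans _ _ (`|fwave lambda m n| * ((1 - Y^-1) ^+ m * expR (m%:R * (2 / Y))))).
    by rewrite ler_peMr.
  rewrite [leLHS]mulrA /G.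
  exact: ler_pM (mulr_ge0 f0 (exprn_ge0 m rho0)) (expR_ge0 _) (wb m) em.
have := evolution_bound l0 t0 G0 fG; rewrite -/(amplitude lambda t n) => H.
apply: le_trans H _; apply: lerD.
- have -> : amplitude_cst * Y ^+ 3 * z = 2 * ((16 / b + 1) * Y) * G.
    by rewrite /amplitude_cst /G /G1; ring.
  by rewrite ler_wpM2r// ler_wpM2l.
- apply: (@le_trans _ _ (4 * expR (- (16 * (Y / b))) * expR (8 * (Y / b)))).
    have q1 : 0 <= 4 * 4 ^- M0 :> R by apply: mulr_ge0 => //; rewrite invr_ge0 exprn_ge0.
    have q2 : 4 * 4 ^- M0 <= 4 * expR (- (16 * (Y / b))) by rewrite ler_wpM2l// pow4_decay.
    have q3 : expR (8 * (t / b)) <= expR (8 * (Y / b)).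
      by rewrite ler_expR ler_wpM2l// ler_wpM2r// ltW// invr_gt0.
    exact: ler_pM q1 (expR_ge0 _) q2 q3.
  rewrite -mulrA -expRD ler_wpM2l//.
  by rewrite ler_expR le_eqVlt; apply/orP; left; apply/eqP; ring.
Qed.

Lemma rapidly_small_spectral (a : R) : block_exponent < a -> rapidly_small lambda a.
Proof.
have l0 := lambda_ge0.
have b0 := wave_scale_gt0 l0; have B0 := block_exponent_gt0.
set be := block_exponent in B0 * => ba.
(* With [Y = T ^ (1 + eps)] and [Z = T ^ eps] the block length is of order [T ^ s]; this [eps] puts
   [s] midway between [be] and [a]. *)
pose eps := (a - be) / (2 * (be + 1)).
have e0 : 0 < eps by rewrite divr_gt0//; lra.
pose s := be * (1 + eps) + eps.
have sa : s < a.
  have -> : s = (a + be) / 2 by rewrite /s /eps; field; rewrite gt_eqF//; lra.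
  lra.
pose C := expR (be * ln 3 + 4 * ln (eta R)).
have c0 : 0 < c by rewrite /trace_cst; clear -hl; lra.
have lc : 0 < ln c by rewrite ln_gt0// /trace_cst; clear -hl; lra.
have K0 : 0 <= amplitude_cst.
  have bn k : 0 <= k%:R / b by rewrite divr_ge0// ltW.
  apply: mulr_ge0; apply: mulr_ge0 => //; try exact: expR_ge0.
    by apply: addr_ge0 => //; exact: (bn 16).
  by apply: mulr_ge0 => //; apply: addr_ge0 => //; exact: (bn 2).
exists eps => // p.
have e1 : 0 < 1 + eps by rewrite addr_gt0.
have p1 : - (p + 1) < - p by rewrite ltrN2 ltrDl.
have a0 : 0 < a by exact: lt_trans ba.
near=> T => t n t0 tY hn.
have [T1 T0] : 1 <= T /\ 0 < T by near: T; exact: near_pos.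
have Y2 : 2 <= T `^ (1 + eps) by near: T; exact: near_powR_ge.
have Z1 : 1 <= T `^ eps by near: T; exact: near_powR_ge.
have h1 : 2 * C * T `^ s <= T `^ a by near: T; exact: near_powR_le.
have h2 : 2 + 1 <= T `^ a by near: T; exact: near_powR_ge.
have h3 : expR (- (ln c * T `^ eps)) <= T `^ (- (3 * (1 + eps) + p + 1)).
  by near: T; exact: near_expR_decay.
have h4 : expR (- (8 / b * T `^ (1 + eps))) <= T `^ (- (p + 1)).
  by near: T; apply: near_expR_decay => //; rewrite divr_gt0.
have h5 : (amplitude_cst + 4) * T `^ (- (p + 1)) <= T `^ (- p).
  by near: T; exact: near_powR_le.
have [N [l [k [g1 g2 g3 g4 g5]]]] := block_choice (le_trans (ler1n R 2) Y2) Z1.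
have nk : ((fibn k.+1).+1 < `|n|)%N.
  rewrite -(ltr_nat R) -natr1; have -> : `|n|%N%:R = `|n|%:~R :> R by [].
  apply: le_lt_trans hn; move: g5; rewrite -/be -/C -powRrM -mulrA.
  rewrite -powRD ?(gt_eqF T0) ?implybT// [(1 + eps) * be]mulrC -/s.
  by move: h1 h2; clear -hl; lra.
have cZ : (c ^+ fibn l)^-1 <= expR (- (ln c * T `^ eps)).
  rewrite (expR_ln_nat _ c0) -expRN ler_expR lerN2 mulrC.
  by apply: ler_wpM2r => //; exact: ltW.
have wb m := fwave_estimate m Y2 (expR_ge0 _) g1 g2 g3 cZ nk.
apply: le_trans (amplitude_estimate Y2 (expR_ge0 _) t0 tY wb) _.
apply: le_trans h5; rewrite [leRHS]mulrDl; apply: lerD; last by rewrite ler_wpM2l.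
rewrite -mulrA ler_wpM2l//.
have -> : T `^ (- (p + 1)) = (T `^ (1 + eps)) ^+ 3 * T `^ (- (3 * (1 + eps) + p + 1)).
  rewrite -powR_mulrn ?powR_ge0// -powRrM -powRD ?(gt_eqF T0) ?implybT//.
  by congr powR; ring.
by rewrite ler_wpM2l// exprn_ge0// powR_ge0.
Unshelve. all: by end_near. Qed.

End Spectral.
End RapidlySmall.

(** * Comparison of the exponents *)

Section Exponents.
Variable R : realType.
Variable lambda : R.
Local Notation z := (zeta lambda).
Local Notation r := (rr lambda).
Local Notation e := (eta R).

Lemma zeta_equation : 8 <= lambda -> z * z + 3 = (lambda - 4) * z.
Proof.
move=> l8; have D0 : 0 <= (lambda - 4) ^+ 2 - 12 by nra.
have := sqr_sqrtr D0; rewrite /zeta; move: (Num.sqrt _) => s hs.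
lra.
Qed.

Lemma zeta_ge3 : 8 <= lambda -> 3 <= z.
Proof.
move=> l8; rewrite /zeta.
have : 2 <= Num.sqrt ((lambda - 4) ^+ 2 - 12).
  have -> : (2 : R) = Num.sqrt (2 ^+ 2) by rewrite sqrtr_sqr ger0_norm.
  by rewrite ler_wsqrtr//; nra.
by move: (Num.sqrt _) => s; lra.
Qed.

Lemma zeta_le : 8 <= lambda -> z <= lambda - 4.
Proof. by move=> l8; have := zeta_equation l8; have := zeta_ge3 l8; nra. Qed.

Lemma rr_ge : 8 <= lambda -> 2 * z + 30 <= r.
Proof. by move=> l8; have := zeta_le l8; rewrite /rr; lra. Qed.

Lemma eta_bounds : 809 / 500 <= e <= 13 / 8.
Proof.
have := sqrt5_sqr R; have := sqrtr_ge0 (5 : R); rewrite /eta.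
move: (Num.sqrt 5) => s s0 hs.
have s1 : 559 / 250 <= s by nra.
have s2 : s <= 9 / 4 by nra.
by apply/andP; split; lra.
Qed.

Lemma ln_le_subr1 (x : R) : 0 < x -> ln x <= x - 1.
Proof.
move=> x0; have := @le_ln1Dx R (x - 1).
by rewrite (_ : 1 + (x - 1) = x); [apply; lra|ring].
Qed.

(* Weighted AM-GM in logarithmic form: [(zeta + 5)^9 >= 4^9 zeta^5]. *)
Lemma ln_rate_ge : 8 <= lambda -> 5 * ln z <= 9 * ln (rate lambda).
Proof.
move=> l8; have z3 := zeta_ge3 l8; have zl := zeta_le l8.
have z0 : 0 < z by lra.
pose y := (z + 5) / 4.
have y0 : 0 < y by rewrite /y; lra.
have y1 : ln y <= ln (rate lambda).
  by rewrite ler_ln ?posrE//; rewrite /y /rate; lra.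
(* The weights 5 and 4 go with the ratios of [9 zeta / 5] and [45 / 4] to [zeta + 5], whose weighted
   sum is 9 whatever [zeta] is. *)
have p0 : 0 < 20 / 9 :> R by lra.
have q0 : 0 < 16 / 45 :> R by lra.
have py : 0 < 20 / 9 * y by exact: mulr_gt0.
have qy : 0 < 16 / 45 * y by exact: mulr_gt0.
have h1 : ln z - (ln (20 / 9) + ln y) <= z / (20 / 9 * y) - 1.
  by rewrite -(lnM p0 y0) -ln_div ?posrE// ln_le_subr1// divr_gt0.
have h2 : - (ln (16 / 45) + ln y) <= (16 / 45 * y)^-1 - 1.
  by rewrite -(lnM q0 y0) -lnV ?posrE// ln_le_subr1// invr_gt0.
have h3 : 5 * (z / (20 / 9 * y) - 1) + 4 * ((16 / 45 * y)^-1 - 1) = 0.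
  rewrite /y; field; rewrite gt_eqF//; lra.
have h4 : 5 * ln (20 / 9 : R) + 4 * ln (16 / 45 : R) <= 0.
  rewrite !mulr_natl -!lnXn// -lnM ?posrE ?exprn_gt0//.
  by apply: ln_le0; lra.
lra.
Qed.

(** Five times [2 zeta <= r] together with [eta ^ 14 <= 2 ^ 5 * r]. The coefficients are those
    required by the constant [5 / 9] in [block_exponent_le]. *)
Lemma ln_rr_ge : 8 <= lambda -> 5 * ln z + 14 * ln e <= 6 * ln r.
Proof.
move=> l8; have z3 := zeta_ge3 l8; have hr := rr_ge l8.
have /andP[e1 e2] := eta_bounds; have e0 : 0 < e by lra.
have z0 : 0 < z by lra.
have r0 : 0 < r by lra.
have h1 : ln 2 + ln z <= ln r.
  have z2 : 0 < 2 * z by lra.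
  by rewrite -lnM ?posrE// ler_ln ?posrE//; lra.
have h2 : 14 * ln e <= 5 * ln 2 + ln r.
  rewrite !mulr_natl -!lnXn// -lnM ?posrE ?exprn_gt0// (exprM e 2 7).
  rewrite ler_ln ?posrE ?exprn_gt0 ?mulr_gt0 ?exprn_gt0//.
  apply: (@le_trans _ _ ((21 / 8) ^+ 7)).
    by rewrite lerXn2r ?nnegrE ?exprn_ge0 ?(ltW e0)//; rewrite ?eta_sqr; lra.
  apply: (@le_trans _ _ (2 ^+ 5 * 36)); first by lra.
  by rewrite ler_wpM2l ?exprn_ge0//; lra.
lra.
Qed.

Lemma alpha_boundE : 8 <= lambda -> alpha_bound lambda =
  (3 * ln r - (ln z + ln e)) / (ln r + ln e) * (2 * ln e / ln z).
Proof.
move=> l8; have z3 := zeta_ge3 l8; have hr := rr_ge l8; have e1 := eta_gt1 R.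
have z0 : 0 < z by lra.
have r0 : 0 < r by lra.
have e0 : 0 < e by lra.
by rewrite /alpha_bound (lnM z0 e0) (lnM r0 e0).
Qed.

(** [zeta * eta ^ 3 <= r] makes the first factor of [alpha_bound] at least 2, and [zeta <= eta ^ 4]
    makes the second at least [1 / 2]. *)
Lemma alpha_bound_ge1 : 8 <= lambda -> z <= e ^+ 4 -> 1 <= alpha_bound lambda.
Proof.
move=> l8 ze; have z3 := zeta_ge3 l8; have hr := rr_ge l8; have e1 := eta_gt1 R.
have /andP[eb1 eb2] := eta_bounds.
have z0 : 0 < z by lra.
have r0 : 0 < r by lra.
have e0 : 0 < e by lra.
have Lz : 0 < ln z by apply: ln_gt0; apply: lt_le_trans z3; rewrite ltr1n.
have Le : 0 < ln e by rewrite ln_gt0.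
have Lr : 0 < ln r by rewrite ln_gt0; clear -lambda hr z3; lra.
have e3 : e ^+ 3 = 2 * e + 1 by rewrite exprS eta_sqr; have := eta_sqr R; lra.
have e4 : e ^+ 4 = 3 * e + 2 by rewrite exprS e3; have := eta_sqr R; lra.
have h1 : ln z <= 4 * ln e.
  by rewrite mulr_natl -lnXn// ler_ln ?posrE ?exprn_gt0.
have h2 : ln z + 3 * ln e <= ln r.
  have ez : 0 < z * e ^+ 3 by rewrite (mulr_gt0 z0)// exprn_gt0.
  rewrite mulr_natl -lnXn// -lnM ?posrE ?exprn_gt0// ler_ln ?posrE//.
  by rewrite e3; rewrite e4 in ze; nra.
rewrite alpha_boundE//.
have q1 : 2 <= (3 * ln r - (ln z + ln e)) / (ln r + ln e).
  by rewrite ler_pdivlMr; lra.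
have q2 : 1 <= 2 * (2 * ln e / ln z).
  by rewrite !mulrA ler_pdivlMr//; lra.
apply: le_trans q2 _; rewrite ler_wpM2r//.
by rewrite divr_ge0 ?mulr_ge0 ?ltW.
Qed.

(** The number [5 / 9] separates two ratios: it is at most [ln rate / ln zeta] and at least [(ln r +
    ln eta) / (3 ln r - ln (zeta * eta))]. *)
Lemma block_exponent_le : 8 <= lambda -> e ^+ 4 < z ->
  1129 / 100 <= lambda /\ block_exponent lambda <= alpha_bound lambda.
Proof.
move=> l8 ze; have z3 := zeta_ge3 l8; have hr := rr_ge l8; have e1 := eta_gt1 R.
have /andP[eb1 eb2] := eta_bounds.
have z0 : 0 < z by lra.
have e3 : e ^+ 3 = 2 * e + 1 by rewrite exprS eta_sqr; have := eta_sqr R; lra.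
have e4 : e ^+ 4 = 3 * e + 2 by rewrite exprS e3; have := eta_sqr R; lra.
(* [eta ^ 4 = 3 eta + 2] is at least 6.854, and [lambda - 4 = zeta + 3 / zeta] is then at least
   7.29. *)
have hl : 1129 / 100 <= lambda.
  rewrite e4 in ze; have hz : 3427 / 500 <= z by lra.
  have E := zeta_equation l8.
  have h : 729 / 100 * z <= (lambda - 4) * z by rewrite -E; nra.
  by rewrite ler_pM2r// in h; clear -lambda h; lra.
split=> //.
have Lz : 0 < ln z by apply: ln_gt0; apply: lt_le_trans z3; rewrite ltr1n.
have Le : 0 < ln e by rewrite ln_gt0.
have Lr : 0 < ln r by rewrite ln_gt0; clear -lambda hr z3; lra.
have k3 := rate_gt3 hl.
have Lk : 0 < ln (rate lambda) by apply: ln_gt0; apply: lt_trans k3; rewrite ltr1n.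
have h1 := ln_rate_ge l8; have h2 := ln_rr_ge l8.
rewrite alpha_boundE// /block_exponent.
have re : 0 < ln r + ln e by rewrite addr_gt0.
rewrite ler_pdivrMr//.
have -> : (3 * ln r - (ln z + ln e)) / (ln r + ln e) * (2 * ln e / ln z) * ln (rate lambda) =
  2 * ln e * ((3 * ln r - (ln z + ln e)) * ln (rate lambda) / ((ln r + ln e) * ln z)).
  by field; rewrite !gt_eqF.
have le2 : 0 <= 2 * ln e by rewrite mulr_ge0// ltW.
apply: ler_peMr => //; rewrite ler_pdivlMr ?mulr_gt0// mul1r.
have h3 : ln r + ln e <= 5 / 9 * (3 * ln r - (ln z + ln e)).
  by clear -lambda h2; lra.
have h4 : 0 <= 3 * ln r - (ln z + ln e) by clear -lambda h2 Lz Le; lra.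
have h5 := ler_wpM2r (ltW Lz) h3.
have h6 := ler_wpM2l h4 h1.
clear -lambda h5 h6; lra.
Qed.

End Exponents.

Theorem theorem5p1 (R : realType) (lambda : R) (hlambda : 8 < lambda) :
  (alpha_u_plus lambda <= (alpha_bound lambda)%:E)%E.
Proof.
have l8 := ltW hlambda.
have l0 : 0 <= lambda by exact: le_trans l8.
apply: ge_ereal_sup => _ [a [a0 ha] <-]; rewrite lee_fin leNgt; apply/negP => h.
apply: (@rapidly_small_limsup R lambda a l0 _ ha).
case: (leP (zeta lambda) (eta R ^+ 4)) => hz.
  by apply: rapidly_small_ballistic => //; apply: le_lt_trans h; exact: alpha_bound_ge1.
have [hl hb] := block_exponent_le l8 hz.
by apply: rapidly_small_spectral => //; exact: le_lt_trans h.
Qed.
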